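(* Let $(\Omega,d,\mu)$ be a space of homogeneous type and let $L$ be a non-negative, self-adjoint, injective operator on $L^2(\Omega,\mu)$ whose semigroup $\{e^{-tL}\}_{t>0}$ satisfies the Davies-Gaffney estimates. Let $f\in H^1_L$. Then $$\lim_{u\to0}L^{iu}f=f,$$ where $u\in\mathbb{R}$ and the limit is in the norm of $H^1_L$.
   Context: Setting. $(\Omega,d)$ is a metric space with a positive measure $\mu$; $B_d(x,t)=\{y\in\Omega: d(x,y)<t\}$ and $V(x,t)=\mu(B_d(x,t))$. $(\Omega,d,\mu)$ is a space of homogeneous type in the sense of Coifman-Weiss: there is $C>0$ with $\mu(B_d(x,2t))\le C\mu(B_d(x,t))$ for all $x\in\Omega$, $t>0$ (as usual, balls have positive finite measure). $L$ is a non-negative self-adjoint operator on $L^2(\Omega,\mu)$, injective on its domain, and $T_t=e^{-tL}$. Davies-Gaffney estimates: there are constants $C,c>0$ such that for all $t>0$, all open $U_1,U_2\subset\Omega$ and all $f_i\in L^2(\Omega)$ with $\operatorname{supp}f_i\subset U_i$ ($i=1,2$), $$|\langle T_tf_1,f_2\rangle|\le C\exp\left(-\frac{\operatorname{dist}(U_1,U_2)^2}{ct}\right)\|f_1\|_{L^2(\Omega)}\|f_2\|_{L^2(\Omega)}.$$ Hardy space. For $f\in L^2(\Omega)$ let $$S_hf(x)=\left(\iint_{\Gamma(x)}|t^2LT_{t^2}f(y)|^2\,\frac{d\mu(y)}{V(x,t)}\frac{dt}{t}\right)^{1/2},\qquad \Gamma(x)=\{(y,t)\in\Omega\times(0,\infty):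 d(x,y)\le t\}.$$ $H^1_L$ is the (abstract) completion of $\{f\in L^2(\Omega):\|S_hf\|_{L^1(\Omega)}<\infty\}$ in the norm $\|f\|_{H^1_L}=\|S_hf\|_{L^1(\Omega)}$. Imaginary powers. With $E$ the spectral measure of $\sqrt{L}$ (so $Lf=\int_0^\infty\lambda^2\,dE(\lambda)f$; $E(\{0\})=0$ since $L$ is injective), $L^{iu}f=\int_{(0,\infty)}\lambda^{2iu}\,dE(\lambda)f$ on $L^2(\Omega)$ for $u\in\mathbb{R}$. On $H^1_L$, $L^{iu}$ is understood as its unique bounded extension from the dense subspace $\{f\in L^2(\Omega):\|S_hf\|_{L^1(\Omega)}<\infty\}$ (this extension exists). *)

(* Defs.v *)
From HB Require Import structures.
From mathcomp Require Import all_boot all_order all_algebra.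
From mathcomp Require Import all_classical all_reals all_analysis measurable_realfun.
From mathcomp Require Import complex.

Set Implicit Arguments.
Unset Strict Implicit.
Unset Printing Implicit Defensive.
Import Order.TTheory GRing.Theory Num.Theory.
Import numFieldTopology.Exports numFieldNormedType.Exports.
Import ComplexField.Normc.

Local Open Scope classical_set_scope.
Local Open Scope complex_scope.
Local Open Scope ring_scope.

#[short(type="metricMeasurableType")]
HB.structure Definition MetricMeasurable (R : realType) (d : measure_display) :=
  {T of Metric R T & Measurable d T}.

Section HomogeneousType.
Context (R : realType) (d : measure_display) (T : metricMeasurableType R d).
Variable mu : {measure set T -> \bar R}.

(* [ball x t] is the open ball [set y | mdist x y < t] (lemma ballEmdist). *)
Definition homogeneous_type :=
  [/\ (measurable : set (set T)) = <<s (open : set (set T)) >>,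
      (forall (x : T) (t : R), 0 < t -> (0 < mu (ball x t) < +oo)%E) &
      exists2 C : R, 0 < C &
        forall (x : T) (t : R), 0 < t ->
          (mu (ball x (2 * t)) <= C%:E * mu (ball x t))%E].

Definition set_dist (U V : set T) : R :=
  inf [set mdist p.1 p.2 | p in U `*` V].

End HomogeneousType.

(* The complex space L^2(mu). Its elements are represented by functions, and  *)
(* an operator on L^2(mu) is a map on functions that respects equality mu-a.e.*)
Section ComplexL2.
Context (R : realType) (d : measure_display) (T : measurableType d).
Variable mu : {measure set T -> \bar R}.
Implicit Types f g : T -> R[i].

Definition cmeasurable f :=
  measurable_fun [set: T] (fun x => complex.Re (f x)) /\
  measurable_fun [set: T] (fun x => complex.Im (f x)).

Definition L2norm f : \bar R := Lnorm mu 2%:E (fun x => (normc (f x))%:E).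

Definition L2 f := cmeasurable f /\ (L2norm f < +oo)%E.

Definition distL2 f g : \bar R := L2norm (fun x => f x - g x).

Definition dotL2 f g : R[i] :=
  (\int[mu]_x complex.Re (f x * (g x)^*)) +i*
  (\int[mu]_x complex.Im (f x * (g x)^*)).

Definition eqL2 f g := {ae mu, forall x, f x = g x}.

(* a *: f + g *)
Definition lincomb (a : R[i]) f g : T -> R[i] := fun x => a * f x + g x.

Record unbounded_op := UnboundedOp {
  dom : set (T -> R[i]) ;
  op :> (T -> R[i]) -> (T -> R[i]) ;
  dom_L2 : forall f, dom f -> L2 f ;
  dom_ae : forall f g, dom f -> L2 g -> eqL2 f g -> dom g ;
  dom0 : dom (fun=> 0) ;
  dom_lincomb : forall a f g, dom f -> dom g -> dom (lincomb a f g) ;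
  op_L2 : forall f, dom f -> L2 (op f) ;
  op_ae : forall f g, dom f -> dom g -> eqL2 f g -> eqL2 (op f) (op g) ;
  op_lincomb : forall a f g, dom f -> dom g ->
    eqL2 (op (lincomb a f g)) (lincomb a (op f) (op g)) }.

Definition densely_defined (L : unbounded_op) :=
  forall f, L2 f -> forall e : R, 0 < e ->
    exists2 g, dom L g & (distL2 f g < e%:E)%E.

(* The left-hand side of the equivalence says that g is in the domain of the  *)
(* adjoint of L, with value h.                                                *)
Definition self_adjoint (L : unbounded_op) :=
  densely_defined L /\
  forall g h, L2 g -> L2 h ->
    (forall f, dom L f -> dotL2 (L f) g = dotL2 f h) <->
    (dom L g /\ eqL2 (L g) h).

Definition nonnegative_op (L : unbounded_op) :=
  forall f, dom L f -> 0 <= dotL2 (L f) f.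

Definition injective_op (L : unbounded_op) :=
  forall f, dom L f -> eqL2 (L f) (fun=> 0) -> eqL2 f (fun=> 0).

(* Projection-valued Borel measures on R (resolutions of the identity). *)
Record pvm := PVM {
  proj :> set (measurableTypeR R) -> (T -> R[i]) -> (T -> R[i]) ;
  proj_L2 : forall A f, measurable A -> L2 f -> L2 (proj A f) ;
  proj_ae : forall A f g, measurable A -> L2 f -> L2 g ->
    eqL2 f g -> eqL2 (proj A f) (proj A g) ;
  proj_lincomb : forall A a f g, measurable A -> L2 f -> L2 g ->
    eqL2 (proj A (lincomb a f g)) (lincomb a (proj A f) (proj A g)) ;
  proj_sym : forall A f g, measurable A -> L2 f -> L2 g ->
    dotL2 (proj A f) g = dotL2 f (proj A g) ;
  projI : forall A B f, measurable A -> measurable B -> L2 f ->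
    eqL2 (proj (A `&` B) f) (proj A (proj B f)) ;
  proj0 : forall f, L2 f -> eqL2 (proj set0 f) (fun=> 0) ;
  projT : forall f, L2 f -> eqL2 (proj setT f) f ;
  proj_sigma_additive : forall (F : (set (measurableTypeR R))^nat) f g,
    (forall n, measurable (F n)) -> trivIset setT F -> L2 f -> L2 g ->
    (\sum_(0 <= k < n) dotL2 (proj (F k) f) g : R[i]^o) @[n --> \oo] -->
      (dotL2 (proj (\bigcup_k F k) f) g : R[i]^o) }.

Lemma Re_mul_conj (z : R[i]) : complex.Re (z * z^*) = normc z ^+ 2.
Proof.
case: z => a b /=; rewrite sqr_sqrtr ?addr_ge0 ?sqr_ge0//.
by rewrite mulrN opprK -!expr2.
Qed.

Lemma continuous_Re : continuous (@complex.Re R : R[i]^o -> R).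
Proof.
move=> z A /nbhs_ballP[e /= e0 eA]; apply/(@nbhs_ballP _ R[i]^o).
exists e%:C => [|w zw]; first by rewrite /= ltcR.
apply: eA; rewrite /ball /= -ltcR.
by apply: le_lt_trans zw; rewrite -raddfB; exact: normc_ge_Re.
Qed.


Lemma eq_dotL2 f f' g g' : L2 f -> L2 f' -> L2 g -> L2 g' ->
  eqL2 f f' -> eqL2 g g' -> dotL2 f g = dotL2 f' g'.
Proof.
have mp : forall h k, L2 h -> L2 k ->
    measurable_fun setT (fun x => complex.Re (h x * (k x)^*)) /\
    measurable_fun setT (fun x => complex.Im (h x * (k x)^*)).
  move=> h k [[hr hi] _] [[kr ki] _]; split.
    rewrite [X in measurable_fun _ X](_ : _ = (fun x =>
      complex.Re (h x) * complex.Re (k x) + complex.Im (h x) * complex.Im (k x))).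
      by apply: measurable_funD; exact: measurable_funM.
    apply/funext => x; case: (h x) (k x) => a b [u v] /=.
    by rewrite mulrN opprK.
  rewrite [X in measurable_fun _ X](_ : _ = (fun x =>
    complex.Im (h x) * complex.Re (k x) - complex.Re (h x) * complex.Im (k x))).
    by apply: measurable_funB; exact: measurable_funM.
  apply/funext => x; case: (h x) (k x) => a b [u v] /=.
  by rewrite addrC mulrN.
move=> lf lf' lg lg' ff' gg'.
have [r1 i1] := mp _ _ lf lg; have [r2 i2] := mp _ _ lf' lg'.
rewrite /dotL2 /Rintegral; congr (fine _ +i* fine _).
  apply: ae_eq_integral => //; try exact/measurable_EFinP.
  by apply: filterS2 ff' gg' => x -> -> _.
apply: ae_eq_integral => //; try exact/measurable_EFinP.
by apply: filterS2 ff' gg' => x -> -> _.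
Qed.

Lemma integral_normc2_fin f : L2 f ->
  (\int[mu]_x (normc (f x) ^+ 2)%:E \is a fin_num)%E.
Proof.
move=> [_ lf]; rewrite ge0_fin_numE; last first.
  by apply: integral_ge0 => x _; rewrite lee_fin sqr_ge0.
move: lf; rewrite /L2norm unlock /= => /lty_poweRy.
rewrite invr_neq0 ?pnatr_eq0// => /(_ isT); apply: le_lt_trans.
rewrite le_eqVlt; apply/orP; left; apply/eqP; apply: eq_integral => x _.
rewrite /= ger0_norm ?powR_mulrn//; case: (f x) => a b; exact: sqrtr_ge0.
Qed.

Lemma integral_projE (E : pvm) f A : L2 f -> measurable A ->
  (\int[mu]_x (normc (E A f x) ^+ 2)%:E)%E =
  (complex.Re (dotL2 (E A f) f))%:E.
Proof.
move=> lf mA; have lEf := proj_L2 E mA lf.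
have -> : dotL2 (E A f) f = dotL2 (E A f) (E A f).
  rewrite -(proj_sym E mA lEf lf); apply: eq_dotL2 => //.
    exact: proj_L2.
    by have := projI E mA mA lf; rewrite setIid.
  exact: nearW.
rewrite -(fineK (integral_normc2_fin lEf)) /dotL2 /= /Rintegral.
by congr ((fine _)%:E); apply: eq_integral => x _; rewrite -Re_mul_conj.
Qed.

(* The measure A |-> <E(A) f, f> = |E(A) f|^2 (and 0 if f is not in L^2). *)
Definition spectral_measure (E : pvm) f (A : set (measurableTypeR R)) : \bar R :=
  if `[< L2 f >] then (\int[mu]_x (normc (E A f x) ^+ 2)%:E)%E else 0%E.

Section SpectralMeasure.
Variables (E : pvm) (f : T -> R[i]).

Let spectral_measure0 : spectral_measure E f set0 = 0%E.
Proof.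
rewrite /spectral_measure; case: asboolP => // lf.
rewrite integral_projE//.
have l0 := proj_L2 E measurable0 lf.
have lz : L2 (fun=> 0).
  split; first by split; exact: measurable_cst.
  rewrite /L2norm; under [X in Lnorm _ _ X]eq_fun do rewrite normc0.
  by rewrite Lnorm0// gt_eqF// lte_fin.
rewrite (eq_dotL2 l0 lz lf lf (proj0 E lf))//; last exact: nearW.
rewrite /dotL2 /= /Rintegral.
under eq_integral do rewrite mul0r.
by rewrite integral0.
Qed.

Let spectral_measure_ge0 A : (0 <= spectral_measure E f A)%E.
Proof.
rewrite /spectral_measure; case: asboolP => // _.
by apply: integral_ge0 => x _; rewrite lee_fin sqr_ge0.
Qed.

Let spectral_measure_sigma_additive : semi_sigma_additive (spectral_measure E f).
Proof.
move=> F mF tF mUF; rewrite /spectral_measure; case: asboolP => lf; last first.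
  under eq_fun do rewrite big1//.
  exact: cvg_cst.
rewrite integral_projE//.
rewrite [X in X @ _ --> _](_ : _ = (fun n =>
    (complex.Re (\sum_(0 <= k < n) dotL2 (E (F k) f) f))%:E)); last first.
  apply/funext => n; rewrite raddf_sum -sumEFin.
  by apply: eq_bigr => k _; rewrite integral_projE.
apply: cvg_EFin; first exact: nearW.
have h := @proj_sigma_additive E F f f mF tF lf lf.
exact: (cvg_comp _ _ h (@continuous_Re (dotL2 (E (\bigcup_k F k) f) f))).
Qed.

HB.instance Definition _ := isMeasure.Build _ _ _ (spectral_measure E f)
  spectral_measure0 spectral_measure_ge0 spectral_measure_sigma_additive.

End SpectralMeasure.

Definition step_fun (n : nat) (c : 'I_n -> R[i])
    (A : 'I_n -> set (measurableTypeR R)) (lambda : R) : R[i] :=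
  \sum_(k < n) c k * (\1_(A k) lambda)%:C.

Definition step_op (E : pvm) (n : nat) (c : 'I_n -> R[i])
    (A : 'I_n -> set (measurableTypeR R)) f : T -> R[i] :=
  fun x => \sum_(k < n) c k * E (A k) f x.

(* h is the spectral integral of phi against E at f: the value at phi of the  *)
(* extension to L^2(spectral_measure E f) of the isometry sending a step      *)
(* function to the same combination of the E (A k) f. In particular f is then *)
(* in the natural domain, phi being square integrable.                        *)
Definition is_spectral_integral (E : pvm) (phi : R -> R[i]) f h :=
  [/\ L2 f, L2 h &
    forall e : R, 0 < e -> exists n c (A : 'I_n -> set (measurableTypeR R)),
      [/\ forall k, measurable (A k),
          (\int[spectral_measure E f]_lambda
             (normc (phi lambda - step_fun c A lambda)%R ^+ 2)%:E < e%:E)%E &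
          (distL2 h (step_op E c A f) < e%:E)%E]].

(* Determined up to mu-a.e. equality, whenever the integral is defined. *)
Definition spectral_integral (E : pvm) (phi : R -> R[i]) f : T -> R[i] :=
  xget (fun=> 0) [set h | is_spectral_integral E phi f h].

(* E is the spectral measure of the square root of L; the equivalence         *)
(* includes the equality of the domains of L and of the integral of lambda^2. *)
Definition sqrt_spectral_measure (L : unbounded_op) (E : pvm) :=
  (forall f, L2 f -> eqL2 (E [set lambda | (lambda : R) < 0] f) (fun=> 0)) /\
  (forall f h, L2 f -> L2 h ->
    is_spectral_integral E (fun lambda => (lambda ^+ 2)%:C) f h <->
    (dom L f /\ eqL2 (L f) h)).

(* exp(-tL) and L^{iu}, E being the spectral measure of the square root of L. *)
Definition semigroup (E : pvm) (t : R) : (T -> R[i]) -> (T -> R[i]) :=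
  spectral_integral E (fun lambda => (expR (- (t * lambda ^+ 2)))%:C).

Definition imaginary_power (E : pvm) (u : R) : (T -> R[i]) -> (T -> R[i]) :=
  spectral_integral E (fun lambda =>
    if 0 < lambda then cos (2 * u * ln lambda) +i* sin (2 * u * ln lambda)
    else 0).

End ComplexL2.

Section HardySpace.
Context (R : realType) (d : measure_display) (T : metricMeasurableType R d).
Variable mu : {measure set T -> \bar R}.
Implicit Types f g : T -> R[i].

Definition ess_support f : set T :=
  [set x | forall r : R, 0 < r -> ~ {ae mu, forall y, ball x r y -> f y = 0}].

Definition davies_gaffney (E : pvm mu) :=
  exists C c : R, [/\ 0 < C, 0 < c &
    forall (t : R) (U1 U2 : set T) f1 f2, 0 < t -> open U1 -> open U2 ->
      L2 mu f1 -> L2 mu f2 -> ess_support f1 `<=` U1 -> ess_support f2 `<=` U2 ->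
      normc (dotL2 mu (semigroup E t f1) f2) <=
        C * expR (- (set_dist U1 U2 ^+ 2 / (c * t))) *
        fine (L2norm mu f1) * fine (L2norm mu f2)].

(* {y | (y, t) belongs to the cone Gamma(x)} *)
Definition cone_section (x : T) (t : R) : set T := [set y | mdist x y <= t].

(* The integral over the cone is written as an iterated integral, so that for *)
(* each t the class of t^2 L exp(-t^2 L) f in L^2 is all that matters.        *)
Definition square_function (L : unbounded_op mu) (E : pvm mu) f (x : T) : \bar R :=
  sqrte (\int[lebesgue_measure]_(t in `]0, +oo[)
    \int[mu]_(y in cone_section x t)
      (normc ((t ^+ 2)%:C * L (semigroup E (t ^+ 2) f) y) ^+ 2
        / fine (mu (ball x t)) / t)%:E).

Definition hardy_norm (L : unbounded_op mu) (E : pvm mu) f : \bar R :=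
  (\int[mu]_x square_function L E f x)%E.

Definition pre_hardy (L : unbounded_op mu) (E : pvm mu) : set (T -> R[i]) :=
  [set f | L2 mu f /\ (hardy_norm L E f < +oo)%E].

(* H, with the embedding iota, is a completion of the pre-Hardy space. *)
Definition hardy_completion (L : unbounded_op mu) (E : pvm mu)
    (H : completeNormedModType R[i]) (iota : (T -> R[i]) -> H) :=
  [/\ forall a f g, pre_hardy L E f -> pre_hardy L E g ->
        iota (lincomb a f g) = a *: iota f + iota g,
      forall f, pre_hardy L E f -> `|iota f| = (fine (hardy_norm L E f))%:C &
      dense (iota @` pre_hardy L E)].

(* J is the bounded extension to H of A, defined on the pre-Hardy space. *)
Definition bounded_extension (L : unbounded_op mu) (E : pvm mu)
    (H : completeNormedModType R[i]) (iota : (T -> R[i]) -> H)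
    (A : (T -> R[i]) -> (T -> R[i])) (J : {linear H -> H}) :=
  continuous J /\
  forall f, pre_hardy L E f -> pre_hardy L E (A f) /\ J (iota f) = iota (A f).

End HardySpace.

(* Main.v *)
Require Import Defs.
From mathcomp Require Import all_boot all_order all_algebra.
From mathcomp Require Import all_classical all_reals all_analysis measurable_realfun.
From mathcomp Require Import complex ring lra.
Import Order.TTheory GRing.Theory Num.Theory.
Import numFieldTopology.Exports numFieldNormedType.Exports.
Import ComplexField.Normc.
Local Open Scope classical_set_scope.
Local Open Scope complex_scope.
Local Open Scope ring_scope.

(* The operators L^{iu} are given to be bounded on H^1_L for each single u, and
   they form a group by the functional calculus on L^2. Cut the upper half space
   into increasing regions Q_k on which V(x, t) and t are bounded below and x and
   t above: the part of |S_h f|_1 that comes from Q_k is at most C_k |f|_2, and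
   |S_h f|_1 is the supremum of these parts. As u |-> L^{iu} f is continuous in
   L^2, the norm of L^{iu} f in H^1_L is, up to a factor 2, lower semicontinuous
   in u. So by Baire's theorem the operators L^{iu} are bounded uniformly for u
   in some interval, hence, by the group law, for u near 0. A second application
   of Baire's theorem gives an interval I around some small a and a k such that
   the part of |S_h L^{iu} f|_1 off Q_k is small for all u in I; on Q_k the
   L^2-continuity applies, so u |-> L^{iu} f has small oscillation in H^1_L near
   a, and then, by the group law, near 0. *)

Set Implicit Arguments.
Unset Strict Implicit.
Unset Printing Implicit Defensive.

(** * Complex-valued functions and the seminorm of L^2 *)

(** The sets of exponents in the two Baire arguments are not known to be closed, because
    semicontinuity costs a factor 2. Baire's theorem is therefore used in the form that one of the
    covering sets is dense in an interval; the bound then passes to the whole interval at twice its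
    size. The factor comes from |a - b|^2 <= 2 |a|^2 + 2 |b|^2, applied to the densities pointwise
    before roots are taken. The order of the two applications matters: the return from a to 0 is
    L^{iu} f - f = L^{-ia} (L^{i(a+u)} f - L^{ia} f), and a depends on the accuracy wanted, so it
    has to lie where a uniform bound is already known. Two facts account for the length of the
    preparation. A spectral integral is a choice among the functions satisfying a relation, so its
    existence and the rules of the calculus, valid up to null sets, have to come from step functions
    and the completeness of L^2. And t^2 L exp(-t^2 L) f is determined only as a class for each t,
    so joint measurability of the cone integrals in (x, t) has to be extracted from continuity in
    t. *)

Section ComplexMeasurable.
Context (R : realType) (d : measure_display) (T : measurableType d).
Implicit Types f g h : T -> R[i].

Lemma normc_ge0 (z : R[i]) : 0 <= normc z.
Proof. by case: z => a b; exact: sqrtr_ge0. Qed.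

Lemma sqr_normc_ReIm (z : R[i]) :
  normc z ^+ 2 = complex.Re z ^+ 2 + complex.Im z ^+ 2.
Proof. by case: z => a b; rewrite /= sqr_sqrtr// addr_ge0 ?sqr_ge0. Qed.

Lemma normc_real (a : R) : normc a%:C = `|a|.
Proof. by rewrite /= expr0n/= addr0 sqrtr_sqr. Qed.

Lemma normc_distC (z w : R[i]) : normc (z - w) = normc (w - z).
Proof. by rewrite -normcN opprB. Qed.

Lemma le_normcB (z w : R[i]) : normc (z - w) <= normc z + normc w.
Proof. by rewrite (le_trans (le_normcD _ _))// normcN. Qed.

Lemma cmeasurable_cst (a : R[i]) : cmeasurable (fun _ : T => a).
Proof. by split; exact: measurable_cst. Qed.

Lemma cmeasurable_real (f : T -> R) : measurable_fun setT f ->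
  cmeasurable (fun x => (f x)%:C).
Proof. by move=> mf; split => //; exact: measurable_cst. Qed.

Lemma cmeasurableD f g : cmeasurable f -> cmeasurable g ->
  cmeasurable (fun x => f x + g x).
Proof.
move=> [f1 f2] [g1 g2]; split.
  by under eq_fun do rewrite raddfD; exact: measurable_funD.
by under eq_fun do rewrite raddfD; exact: measurable_funD.
Qed.

Lemma cmeasurableN f : cmeasurable f -> cmeasurable (fun x => - f x).
Proof.
move=> [f1 f2]; split.
  by under eq_fun do rewrite raddfN; exact: measurableT_comp.
by under eq_fun do rewrite raddfN; exact: measurableT_comp.
Qed.

Lemma cmeasurableB f g : cmeasurable f -> cmeasurable g ->
  cmeasurable (fun x => f x - g x).
Proof. by move=> ? ?; apply: cmeasurableD => //; exact: cmeasurableN. Qed.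

Lemma cmeasurableM f g : cmeasurable f -> cmeasurable g ->
  cmeasurable (fun x => f x * g x).
Proof.
move=> [f1 f2] [g1 g2]; split.
  rewrite [X in measurable_fun _ X](_ : _ = (fun x =>
    complex.Re (f x) * complex.Re (g x) - complex.Im (f x) * complex.Im (g x))).
    by apply: measurable_funB; exact: measurable_funM.
  by apply/funext => x; case: (f x) (g x) => a b [u v].
rewrite [X in measurable_fun _ X](_ : _ = (fun x =>
  complex.Re (f x) * complex.Im (g x) + complex.Im (f x) * complex.Re (g x))).
  by apply: measurable_funD; exact: measurable_funM.
by apply/funext => x; case: (f x) (g x) => a b [u v] /=; rewrite addrC.
Qed.

Lemma cmeasurable_conj f : cmeasurable f -> cmeasurable (fun x => (f x)^*).
Proof.
move=> [f1 f2]; split.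
  rewrite [X in measurable_fun _ X](_ : _ = (fun x => complex.Re (f x)))//.
  by apply/funext => x; case: (f x).
rewrite [X in measurable_fun _ X](_ : _ = (fun x => - complex.Im (f x))).
  exact: measurableT_comp.
by apply/funext => x; case: (f x).
Qed.

Lemma cmeasurable_sum (I : finType) (F : I -> T -> R[i]) :
  (forall i, cmeasurable (F i)) -> cmeasurable (fun x => \sum_i F i x).
Proof.
move=> mF; suff : forall s : seq I, cmeasurable (fun x => \sum_(i <- s) F i x).
  by apply.
elim=> [|i s IH].
  by under eq_fun do rewrite big_nil; exact: cmeasurable_cst.
by under eq_fun do rewrite big_cons; exact: cmeasurableD.
Qed.

Lemma measurable_sqr_normc f : cmeasurable f ->
  measurable_fun setT (fun x => normc (f x) ^+ 2).
Proof.
move=> [f1 f2]; under eq_fun do rewrite sqr_normc_ReIm.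
by apply: measurable_funD; exact: measurable_funX.
Qed.

Lemma measurable_normc f : cmeasurable f ->
  measurable_fun setT (fun x => normc (f x)).
Proof.
move=> mf; rewrite [X in measurable_fun _ X](_ : _ =
  Num.sqrt \o (fun x => normc (f x) ^+ 2)); last first.
  by apply/funext => x /=; rewrite sqrtr_sqr ger0_norm// normc_ge0.
apply: measurableT_comp; last exact: measurable_sqr_normc.
by apply: continuous_measurable_fun; exact: sqrt_continuous.
Qed.

End ComplexMeasurable.
#[global] Hint Extern 0 (is_true (0 <= normc _)) => solve [apply: normc_ge0] : core.

Section L2Seminorm.
Context (R : realType) (d : measure_display) (T : measurableType d).
Variable mu : {measure set T -> \bar R}.
Implicit Types f g h : T -> R[i].

(** Real-valued, so that estimates can be handled by real arithmetic. As [fine] sends +oo to 0, it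
    is the norm only for f in [L2]. *)
Definition nrm2 f : R := fine (L2norm mu f).

Lemma L2norm_ge0 f : (0 <= L2norm mu f)%E.
Proof. exact: Lnorm_ge0. Qed.

Lemma nrm2_ge0 f : 0 <= nrm2 f.
Proof. by rewrite fine_ge0// L2norm_ge0. Qed.

Lemma sqr_L2norm f :
  (L2norm mu f `^ 2 = \int[mu]_x (normc (f x) ^+ 2)%:E)%E.
Proof.
rewrite /L2norm poweR_Lnorm ?pnatr_eq0//; apply: eq_integral => x _.
by rewrite abse_EFin poweR_EFin ger0_norm// powR_mulrn.
Qed.

Lemma L2_fine f : L2 mu f -> L2norm mu f = (nrm2 f)%:E.
Proof. by move=> [_ lf]; rewrite fineK// ge0_fin_numE// L2norm_ge0. Qed.

Lemma sqr_nrm2 f : L2 mu f ->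
  (\int[mu]_x (normc (f x) ^+ 2)%:E = (nrm2 f ^+ 2)%:E)%E.
Proof.
by move=> lf; rewrite -sqr_L2norm L2_fine// poweR_EFin powR_mulrn// nrm2_ge0.
Qed.

Lemma nrm2_le f (a : R) : L2 mu f -> 0 <= a ->
  (\int[mu]_x (normc (f x) ^+ 2)%:E <= (a ^+ 2)%:E)%E -> nrm2 f <= a.
Proof.
by move=> lf a0; rewrite sqr_nrm2// lee_fin ler_pXn2r// nnegrE nrm2_ge0.
Qed.

Lemma L2P f : cmeasurable f ->
  L2 mu f <-> (\int[mu]_x (normc (f x) ^+ 2)%:E < +oo)%E.
Proof.
move=> mf; split=> [lf|]; first by rewrite sqr_nrm2// ltry.
by rewrite -sqr_L2norm => /lty_poweRy lf; split=> //; apply: lf.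
Qed.

(** With [b] the sum of the moduli of two functions, this reduces the triangle inequality [L2D] to
    Minkowski's inequality for real functions. *)
Lemma le_L2norm_Lnorm f (b : T -> R) : cmeasurable f ->
  measurable_fun setT b -> (forall x, normc (f x) <= b x) ->
  (L2norm mu f <= Lnorm mu 2%:E (EFin \o b))%E.
Proof.
move=> mf mb fb; rewrite /L2norm unlock /= !poweR12_sqrt; last 2 first.
- by apply: integral_ge0 => x _; rewrite lee_fin powR_ge0.
- by apply: integral_ge0 => x _; rewrite lee_fin powR_ge0.
rewrite lee_sqrt; last by apply: integral_ge0 => x _; rewrite lee_fin powR_ge0.
apply: ge0_le_integral => //.
- apply/measurable_EFinP; apply: (measurableT_comp (measurable_powR _)).
  by apply: measurableT_comp => //; exact: measurable_normc.
- apply/measurable_EFinP; apply: (measurableT_comp (measurable_powR _)).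
  exact: measurableT_comp.
- move=> x _; have b0 := le_trans (normc_ge0 _) (fb x).
  by rewrite lee_fin !ger0_norm// ge0_ler_powR ?nnegrE.
Qed.

Lemma L2_le f g : cmeasurable f -> L2 mu g ->
  (forall x, normc (f x) <= normc (g x)) -> L2 mu f /\ nrm2 f <= nrm2 g.
Proof.
move=> mf lg fg.
have fgE : (L2norm mu f <= L2norm mu g)%E.
  by apply: le_L2norm_Lnorm => //; apply: measurable_normc; case: lg.
have lf : L2 mu f by split => //; apply: le_lt_trans fgE _; case: lg.
by split => //; rewrite -lee_fin -!L2_fine.
Qed.

Lemma L2D f g : L2 mu f -> L2 mu g ->
  L2 mu (fun x => f x + g x) /\ nrm2 (fun x => f x + g x) <= nrm2 f + nrm2 g.
Proof.
move=> lf lg; have [mf _] := lf; have [mg _] := lg.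
have mfg := cmeasurableD mf mg.
have le : (L2norm mu (fun x => f x + g x)%R <= (nrm2 f + nrm2 g)%:E)%E.
  rewrite EFinD -!L2_fine//.
  apply: (le_trans (@le_L2norm_Lnorm _ (fun x => normc (f x) + normc (g x)) _ _ _)).
  - exact: mfg.
  - by apply: measurable_funD; exact: measurable_normc.
  - by move=> x; exact: le_normcD.
  - apply: (@minkowski_EFin _ _ _ _ (fun x => normc (f x)) (fun x => normc (g x))).
    + exact: measurable_normc.
    + exact: measurable_normc.
    + by rewrite ler1n.
have lfg : L2 mu (fun x => f x + g x) by split => //; rewrite (le_lt_trans le)// ltry.
by split => //; rewrite -lee_fin -L2_fine.
Qed.

Lemma L2Z a f : L2 mu f ->
  L2 mu (fun x => a * f x) /\ nrm2 (fun x => a * f x) = normc a * nrm2 f.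
Proof.
move=> lf; have [mf _] := lf.
have maf : cmeasurable (fun x => a * f x) by apply: cmeasurableM => //; exact: cmeasurable_cst.
have E : (\int[mu]_x (normc (a * f x)%R ^+ 2)%:E = ((normc a * nrm2 f) ^+ 2)%:E)%E.
  under eq_integral do rewrite normcM exprMn EFinM.
  rewrite ge0_integralZl_EFin ?sqr_ge0//.
  - by rewrite sqr_nrm2// -EFinM -exprMn.
  - by move=> x _; rewrite lee_fin sqr_ge0.
  - by apply/measurable_EFinP; exact: measurable_sqr_normc.
have laf : L2 mu (fun x => a * f x) by apply/L2P => //; rewrite E ltry.
split => //; apply/eqP; rewrite -(@eqrXn2 _ 2)// ?nrm2_ge0 ?mulr_ge0 ?nrm2_ge0//.
by move: E; rewrite sqr_nrm2// => -[->].
Qed.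

Lemma L2N f : L2 mu f ->
  L2 mu (fun x => - f x) /\ nrm2 (fun x => - f x) = nrm2 f.
Proof.
move=> lf; have [h1 h2] := L2Z (-1) lf.
rewrite (_ : (fun x => - f x) = (fun x => -1 * f x)).
  by split => //; rewrite h2 normcN normc1 mul1r.
by apply/funext => x; rewrite mulN1r.
Qed.

Lemma L2B f g : L2 mu f -> L2 mu g ->
  L2 mu (fun x => f x - g x) /\ nrm2 (fun x => f x - g x) <= nrm2 f + nrm2 g.
Proof.
by move=> lf lg; have [lNg <-] := L2N lg; exact: L2D.
Qed.

Lemma L2_0 : L2 mu (fun=> 0).
Proof.
apply/L2P; first exact: cmeasurable_cst.
under eq_integral do rewrite normc0 expr0n/=.
by rewrite integral0.
Qed.

Lemma nrm2_0 : nrm2 (fun=> 0) = 0.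
Proof.
apply/eqP; rewrite -sqrf_eq0; apply/eqP/EFin_inj.
rewrite -sqr_nrm2; last exact: L2_0.
under eq_integral do rewrite normc0 expr0n/=.
by rewrite integral0.
Qed.

Lemma L2_lincomb a f g : L2 mu f -> L2 mu g -> L2 mu (lincomb a f g).
Proof. by move=> lf lg; have [] := L2D (L2Z a lf).1 lg. Qed.

Lemma L2_sum (I : finType) (F : I -> T -> R[i]) :
  (forall i, L2 mu (F i)) -> L2 mu (fun x => \sum_i F i x).
Proof.
move=> lF; suff : forall s : seq I, L2 mu (fun x => \sum_(i <- s) F i x) by apply.
elim=> [|i s IH]; first by under eq_fun do rewrite big_nil; exact: L2_0.
by under eq_fun do rewrite big_cons; exact: (L2D (lF i) IH).1.
Qed.

Lemma nrm2_distC f g : nrm2 (fun x => f x - g x) = nrm2 (fun x => g x - f x).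
Proof.
rewrite /nrm2 /L2norm; congr (fine (Lnorm _ _ _)).
by apply/funext => x; rewrite normc_distC.
Qed.

Lemma nrm2_triangle f g h : L2 mu f -> L2 mu g -> L2 mu h ->
  nrm2 (fun x => f x - h x) <=
  nrm2 (fun x => f x - g x) + nrm2 (fun x => g x - h x).
Proof.
move=> lf lg lh; have [_] := L2D (L2B lf lg).1 (L2B lg lh).1.
by under [X in nrm2 X <= _]eq_fun do rewrite addrA subrK.
Qed.

Lemma nrm2_dist f g : L2 mu f -> L2 mu g ->
  `|nrm2 f - nrm2 g| <= nrm2 (fun x => f x - g x).
Proof.
have h f' g' : L2 mu f' -> L2 mu g' ->
    nrm2 f' - nrm2 g' <= nrm2 (fun x => f' x - g' x).
  move=> lf lg; rewrite lerBlDr.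
  have [_] := L2D (L2B lf lg).1 lg.
  by under [X in nrm2 X <= _]eq_fun do rewrite subrK.
move=> lf lg; rewrite ler_norml h// andbT lerNl opprB nrm2_distC; exact: h.
Qed.

Lemma nrm2_eq0 f : L2 mu f -> nrm2 f = 0 -> eqL2 mu f (fun=> 0).
Proof.
move=> lf f0; have := L2_fine lf; rewrite f0 => /Lnorm_eq0_eq0 h.
have mf : measurable_fun setT (fun x => (normc (f x))%:E).
  by apply/measurable_EFinP; apply: measurable_normc; case: lf.
have := h mf; rewrite lte_fin ltr0n => /(_ isT).
by apply: filterS => x /(_ I) [/eq0_normc].
Qed.

Lemma eqL2_nrm2B f g : L2 mu f -> L2 mu g ->
  nrm2 (fun x => f x - g x) = 0 -> eqL2 mu f g.
Proof.
move=> lf lg /(nrm2_eq0 (L2B lf lg).1).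
by apply: filterS => x /eqP; rewrite subr_eq0 => /eqP.
Qed.

Lemma eq_nrm2 f g : L2 mu f -> L2 mu g -> eqL2 mu f g -> nrm2 f = nrm2 g.
Proof.
move=> lf lg fg; apply/eqP; rewrite -(@eqrXn2 _ 2)// ?nrm2_ge0//; apply/eqP/EFin_inj.
rewrite -!sqr_nrm2//; apply: ae_eq_integral => //.
- by apply/measurable_EFinP/measurable_sqr_normc; case: lf.
- by apply/measurable_EFinP/measurable_sqr_normc; case: lg.
- by apply: filterS fg => x ->.
Qed.

Lemma eqL2_sym f g : eqL2 mu f g -> eqL2 mu g f.
Proof. by apply: filterS => x ->. Qed.

Lemma eqL2_trans f g h : eqL2 mu f g -> eqL2 mu g h -> eqL2 mu f h.
Proof. by apply: filterS2 => x -> ->. Qed.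

End L2Seminorm.

(** * Completeness of L^2 *)

Section Completeness.
Context (R : realType) (d : measure_display) (T : measurableType d).
Variable mu : {measure set T -> \bar R}.

(** The sequence is its first term plus the partial sums of its telescoping series, which converges
    absolutely. *)
Lemma cvgn_bounded_variation (v : R^nat) (b : R) :
  (forall n, \sum_(0 <= k < n) `|v k.+1 - v k| <= b) -> cvgn v.
Proof.
move=> vb; suff : cvgn (series (telescope v)).
  move=> c; rewrite (_ : v = (fun n => v 0%N + series (telescope v) n)).
    by apply: is_cvgD => //; exact: is_cvg_cst.
  by apply/funext => n; exact: eq_sum_telescope.
apply: normed_cvg; apply: nondecreasing_is_cvgn.
  move=> m n mn; rewrite /series /mk_sequence/= [leRHS](big_cat_nat (leq0n _) mn)//= lerDl.
  exact: sumr_ge0.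
by exists b => _ [n _ <-]; exact: vb.
Qed.

Lemma limn_einf_le (v : (\bar R)^nat) b : (forall n, (v n <= b)%E) ->
  (limn_einf v <= b)%E.
Proof.
move=> vb; rewrite limn_einf_lim; apply: lime_le; first exact: is_cvg_einfs.
apply: nearW => n; apply: le_trans (vb n).
by apply: ereal_inf_lbound; exists n => /=.
Qed.

Lemma sum_half_le m : \sum_(0 <= k < m) (2^-1 : R) ^+ k <= 2.
Proof.
suff -> : \sum_(0 <= k < m) (2^-1 : R) ^+ k = 2 - 2 * 2^-1 ^+ m.
  by rewrite gerBl mulr_ge0// exprn_ge0// invr_ge0.
elim: m => [|m IH]; first by rewrite big_geq// expr0 mulr1 subrr.
by rewrite big_nat_recr//= IH exprS; field.
Qed.

Variable u : nat -> T -> R[i].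
Hypothesis lu : forall n, L2 mu (u n).
Hypothesis du : forall n, nrm2 mu (fun x => u n.+1 x - u n x) <= 2^-1 ^+ n.

Let fast_cauchy n m : nrm2 mu (fun x => u (n + m)%N x - u n x) <= 2 * 2^-1 ^+ n.
Proof.
suff h : nrm2 mu (fun x => u (n + m)%N x - u n x) <=
    2^-1 ^+ n * \sum_(0 <= k < m) 2^-1 ^+ k.
  rewrite (le_trans h)// mulrC ler_wpM2r ?exprn_ge0 ?invr_ge0//.
  exact: sum_half_le.
elim: m => [|m IH].
  rewrite big_geq// mulr0 addn0 (_ : (fun x => _) = (fun=> 0)) ?nrm2_0//.
  by apply/funext => x; rewrite subrr.
rewrite big_nat_recr//= mulrDr -exprD.
rewrite (le_trans (nrm2_triangle (lu _) (lu (n + m)) (lu _)))// addrC lerD//.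
by rewrite addnS.
Qed.

Let s N x := \sum_(0 <= k < N) normc (u k.+1 x - u k x).

Let s_ge0 N x : 0 <= s N x. Proof. by apply: sumr_ge0. Qed.

Let L2_s N : L2 mu (fun x => (s N x)%:C) /\ nrm2 mu (fun x => (s N x)%:C) <= 2.
Proof.
suff [l h] : L2 mu (fun x => (s N x)%:C) /\
    nrm2 mu (fun x => (s N x)%:C) <= \sum_(0 <= k < N) 2^-1 ^+ k.
  by split => //; rewrite (le_trans h)// sum_half_le.
elim: N => [|N [l h]].
  rewrite (_ : (fun x => _) = (fun=> 0)).
    by rewrite nrm2_0 big_geq//; split => //; exact: L2_0.
  by apply/funext => x; rewrite /s big_geq.
have [lB _] := L2B (lu N.+1) (lu N).
have [lN hN] : L2 mu (fun x => (normc (u N.+1 x - u N x))%:C) /\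
    nrm2 mu (fun x => (normc (u N.+1 x - u N x))%:C) <=
    nrm2 mu (fun x => u N.+1 x - u N x).
  apply: L2_le => //; last by move=> x; rewrite normc_real ger0_norm.
  by apply: cmeasurable_real; apply: measurable_normc; case: lB.
have [lD hD] := L2D l lN.
rewrite (_ : (fun x => (s N.+1 x)%:C) =
  (fun x => (s N x)%:C + (normc (u N.+1 x - u N x))%:C)).
  split => //; rewrite (le_trans hD)// big_nat_recr//= lerD//.
  exact: le_trans hN (du N).
by apply/funext => x; rewrite /s big_nat_recr//= rmorphD.
Qed.

(** The partial variations [s N] increase with N and have L^2 norm at most 2, so by monotone
    convergence the limit of their squares has integral at most 4 and is finite almost
    everywhere. *)
Let ae_s_bounded : {ae mu, forall x, exists b, forall N, s N x <= b}.
Proof.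
pose g N x := ((s N x) ^+ 2)%:E.
have gE N x : g N x = (normc (s N x)%:C ^+ 2)%:E.
  by rewrite normc_real ger0_norm.
have mg N : measurable_fun setT (g N).
  rewrite (funext (gE N)); apply/measurable_EFinP/measurable_sqr_normc.
  by case: (L2_s N).1.
have ndg x : {homo g ^~ x : n m / (n <= m)%N >-> (n <= m)%E}.
  move=> n m nm; rewrite /g lee_fin lerXn2r ?nnegrE//.
  by rewrite /s [leRHS](big_cat_nat (leq0n _) nm)//= lerDl sumr_ge0.
have g0 N x : (0 <= g N x)%E by rewrite lee_fin sqr_ge0.
have mG : measurable_fun setT (fun x => limn (g ^~ x)).
  rewrite (_ : (fun x => limn (g ^~ x)) = (fun x => limn_esup (g ^~ x))).
    exact: measurable_fun_limn_esup.
  apply/funext => x; apply/esym.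
  by have [] := cvg_limn_einf_sup (ereal_nondecreasing_is_cvgn (ndg x)).
have G0 x : (0 <= limn (g ^~ x))%E.
  apply: lime_ge; last by apply: nearW => N.
  exact: ereal_nondecreasing_is_cvgn.
have iG : mu.-integrable setT (fun x => limn (g ^~ x)).
  apply/integrableP; split => //.
  under eq_integral do rewrite gee0_abs//.
  rewrite monotone_convergence//.
  apply: (@le_lt_trans _ _ 4%:E); last exact: ltry.
  apply: lime_le.
    apply: ereal_nondecreasing_is_cvgn => n m nm.
    by apply: ge0_le_integral => // x _; exact: ndg.
  apply: nearW => N; under eq_integral do rewrite gE.
  rewrite (sqr_nrm2 (L2_s N).1) lee_fin (_ : 4 = 2 ^+ 2); last by ring.
  by rewrite lerXn2r ?nnegrE ?nrm2_ge0// (L2_s N).2.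
have := integrable_ae measurableT iG; apply: filterS => x /(_ I) fG.
(* From a^2 <= b follows a <= 1 + b, which spares a square root. *)
exists (1 + fine (limn (g ^~ x))) => N.
have : s N x ^+ 2 <= fine (limn (g ^~ x)).
  rewrite -lee_fin fineK// (cvg_lim _ (ereal_nondecreasing_cvgn (ndg x)))//.
  by apply: ereal_sup_ubound; exists N.
have := s_ge0 N x; move: (s N x) (fine _) => a b; nra.
Qed.

(** The Riesz-Fischer argument for a sequence with steps at most 2^-n. Taking upper limits of the
    real and imaginary parts gives a function that is defined and measurable everywhere, and is the
    limit wherever the total variation is finite. *)
Lemma L2_complete : exists h, L2 mu h /\
  forall n, nrm2 mu (fun x => h x - u n x) <= 2 * 2^-1 ^+ n.
Proof.
pose r x := fine (limn_esup (fun n => (complex.Re (u n x))%:E)).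
pose i x := fine (limn_esup (fun n => (complex.Im (u n x))%:E)).
pose h x := r x +i* i x.
have mh : cmeasurable h.
  split.
    apply: (measurableT_comp (fine_measurable measurableT)).
    apply: measurable_fun_limn_esup => n; apply/measurable_EFinP.
    by have [[]] := lu n.
  apply: (measurableT_comp (fine_measurable measurableT)).
  apply: measurable_fun_limn_esup => n; apply/measurable_EFinP.
  by have [[]] := lu n.
have cvg_ae : {ae mu, forall x, complex.Re (u n x) @[n --> \oo] --> r x /\
                                complex.Im (u n x) @[n --> \oo] --> i x}.
  apply: filterS ae_s_bounded => x [b sb].
  have H (v : R^nat) : cvgn v -> v @ \oo --> fine (limn_esup (EFin \o v)).
    move=> cv; have [l vl] : exists l : R, v @ \oo --> l by exists (lim (v @ \oo)).
    have -> : limn_esup (EFin \o v) = l%:E.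
      have /cvg_limn_einf_sup[_ ->//] : (EFin \o v) @ \oo --> l%:E.
      by apply: cvg_EFin => //; exact: nearW.
    exact: vl.
  split; apply: H; apply: (@cvgn_bounded_variation _ b) => N;
    apply: le_trans (sb N); apply: ler_sum => k _.
    rewrite -raddfB /=; case: (_ - _) => p q /=.
    by rewrite -sqrtr_sqr ler_wsqrtr// lerDl sqr_ge0.
  rewrite -raddfB /=; case: (_ - _) => p q /=.
  by rewrite -sqrtr_sqr ler_wsqrtr// lerDr sqr_ge0.
(* Fatou's lemma, as m grows, carries the bound [fast_cauchy] from u (n + m) - u n to h - u n. *)
have bnd n : (\int[mu]_x (normc (h x - u n x)%R ^+ 2)%:E <=
    ((2 * 2^-1 ^+ n) ^+ 2)%:E)%E.
  pose w m x := (normc (u (n + m)%N x - u n x) ^+ 2)%:E.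
  have mw m : measurable_fun setT (w m).
    apply/measurable_EFinP/measurable_sqr_normc/cmeasurableB.
      by case: (lu (n + m)).
    by case: (lu n).
  have w0 m x : (0 <= w m x)%E by rewrite lee_fin sqr_ge0.
  apply: (@le_trans _ _ (\int[mu]_x limn_einf (w ^~ x))%E).
    rewrite le_eqVlt; apply/orP; left; apply/eqP.
    apply: ae_eq_integral => //.
    - apply/measurable_EFinP/measurable_sqr_normc/cmeasurableB => //.
      by case: (lu n).
    - rewrite (_ : (fun x => limn_einf (w ^~ x)) =
                   (fun x => - limn_esup (fun m => - w m x))%E).
        apply: measurableT_comp => //.
        apply: measurable_fun_limn_esup => m.
        exact: measurableT_comp.
      by apply/funext => x.
    apply: filterS cvg_ae => x [rx ix] _; apply/esym.
    have hw : (fun m => normc (u (n + m)%N x - u n x) ^+ 2) @ \oo -->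
        normc (h x - u n x) ^+ 2.
      rewrite (_ : (fun m => _) = (fun m =>
        (complex.Re (u (m + n)%N x) - complex.Re (u n x)) ^+ 2 +
        (complex.Im (u (m + n)%N x) - complex.Im (u n x)) ^+ 2)); last first.
        by apply/funext => m; rewrite sqr_normc_ReIm !raddfB addnC.
      rewrite sqr_normc_ReIm !raddfB /=.
      have sq (a : R^nat) (c l : R) : a @ \oo --> l ->
          (fun m => (a (m + n)%N - c) ^+ 2) @ \oo --> (l - c) ^+ 2.
        move=> al; rewrite expr2; under eq_fun do rewrite expr2.
        have hc : (fun m => a (m + n)%N - c) @ \oo --> l - c.
          by apply: cvgB; [rewrite -(cvg_shiftn n) in al|exact: cvg_cst].
        exact: cvgM.
      by apply: cvgD; [exact: (sq (fun m => complex.Re (u m x)))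
                      |exact: (sq (fun m => complex.Im (u m x)))].
    suff /cvg_limn_einf_sup[->//] : w m x @[m --> \oo] -->
      (normc (h x - u n x) ^+ 2)%:E by [].
    by apply: cvg_EFin; [exact: nearW|exact: hw].
  apply: le_trans (fatou mu measurableT mw _) _ => //.
  apply: limn_einf_le => m; rewrite sqr_nrm2; last exact: (L2B (lu _) (lu _)).1.
  by rewrite lee_fin lerXn2r ?nnegrE ?nrm2_ge0 ?fast_cauchy.
have lhn n : L2 mu (fun x => h x - u n x).
  apply/L2P; first by apply: cmeasurableB => //; case: (lu n).
  by rewrite (le_lt_trans (bnd n))// ltry.
exists h; split.
  have [] := L2D (lhn 0%N) (lu 0%N).
  by rewrite (_ : (fun x => _) = h)//; apply/funext => x; rewrite subrK.
move=> n; rewrite -(@ler_pXn2r _ 2)// ?nnegrE ?nrm2_ge0//.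
by rewrite -lee_fin -sqr_nrm2.
Qed.

End Completeness.

(** * Inner products and step functions of a spectral measure *)

Section InnerProduct.
Context (R : realType) (d : measure_display) (T : measurableType d).
Variable mu : {measure set T -> \bar R}.
Implicit Types f g h : T -> R[i].

Lemma integrable_sqr_normc f : L2 mu f ->
  mu.-integrable setT (fun x => (normc (f x) ^+ 2)%:E).
Proof.
move=> lf; have [mf _] := lf; apply/integrableP; split.
  by apply/measurable_EFinP; exact: measurable_sqr_normc.
under eq_integral do rewrite gee0_abs ?lee_fin ?sqr_ge0//.
by rewrite sqr_nrm2// ltry.
Qed.

(** Dominated convergence for the squares, with majorant |g|^2. It serves both for spectral measures
    and for restrictions of a function to shrinking balls. *)
Lemma nrm2_dominated_cvg (h_ : nat -> T -> R[i]) g : L2 mu g ->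
  (forall n, cmeasurable (h_ n)) -> (forall n x, normc (h_ n x) <= normc (g x)) ->
  (forall x, normc (h_ n x) @[n --> \oo] --> 0) -> nrm2 mu (h_ n) @[n --> \oo] --> 0.
Proof.
move=> lg mh hg h0; have lh n : L2 mu (h_ n) := (L2_le (mh n) lg (hg n)).1.
pose w n x := (normc (h_ n x) ^+ 2)%:E.
have mw n : measurable_fun setT (w n).
  by apply/measurable_EFinP/measurable_sqr_normc.
have w0 x : w n x @[n --> \oo] --> 0%:E.
  apply: cvg_EFin; first exact: nearW.
  rewrite [X in X @ _ --> _](_ : _ = (fun n => normc (h_ n x) * normc (h_ n x))).
    by rewrite -(mulr0 0); exact: cvgM.
  by apply/funext => n; rewrite /= expr2.
have wK n x : (`|w n x| <= (normc (g x) ^+ 2)%:E)%E.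
  by rewrite gee0_abs ?lee_fin ?sqr_ge0// lerXn2r ?nnegrE.
have [_ _] := @dominated_convergence _ _ _ mu setT measurableT w (cst 0%E)
  (fun x => (normc (g x) ^+ 2)%:E) mw (measurable_cst _)
  (nearW _ (fun x _ => w0 x)) (integrable_sqr_normc lg) (nearW _ (fun x n _ => wK n x)).
rewrite integral0 => iw.
apply/cvgrPdist_le => e e0; have e2 : 0 < e ^+ 2 by rewrite exprn_gt0.
move/fine_cvgP : iw => [_ /cvgrPdist_le /(_ _ e2)].
apply: filterS => n; rewrite /= !sub0r !normrN => le.
rewrite ger0_norm ?nrm2_ge0//; apply: nrm2_le; [exact: lh|exact: ltW|].
rewrite sqr_nrm2// lee_fin; apply: le_trans le.
by rewrite [X in fine X](sqr_nrm2 (lh n)) /= ler_norm.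
Qed.

Lemma integrable_mul_conj f g : L2 mu f -> L2 mu g ->
  mu.-integrable setT (fun x => (complex.Re (f x * (g x)^*))%:E) /\
  mu.-integrable setT (fun x => (complex.Im (f x * (g x)^*))%:E).
Proof.
move=> lf lg; have [mf _] := lf; have [mg _] := lg.
have [m1 m2] := cmeasurableM mf (cmeasurable_conj mg).
have isum := integrableD measurableT (integrable_sqr_normc lf) (integrable_sqr_normc lg).
have bd (z w : R[i]) : `|complex.Re (z * w^*)| <= normc z ^+ 2 + normc w ^+ 2 /\
    `|complex.Im (z * w^*)| <= normc z ^+ 2 + normc w ^+ 2.
  rewrite !sqr_normc_ReIm; case: z w => a b [p q] /=.
  have := sqr_ge0 (a - p); have := sqr_ge0 (a + p).
  have := sqr_ge0 (b - p); have := sqr_ge0 (b + p).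
  have := sqr_ge0 (a - q); have := sqr_ge0 (a + q).
  have := sqr_ge0 (b - q); have := sqr_ge0 (b + q).
  have := sqr_ge0 a; have := sqr_ge0 b; have := sqr_ge0 p; have := sqr_ge0 q.
  by move=> *; split; rewrite ler_norml; apply/andP; split; nra.
split; apply: (le_integrable measurableT _ _ isum).
- exact/measurable_EFinP.
- move=> x _; rewrite -EFinD !abse_EFin lee_fin [leRHS]ger0_norm; first exact: (bd _ _).1.
  by rewrite addr_ge0// sqr_ge0.
- exact/measurable_EFinP.
- move=> x _; rewrite -EFinD !abse_EFin lee_fin [leRHS]ger0_norm; first exact: (bd _ _).2.
  by rewrite addr_ge0// sqr_ge0.
Qed.

Lemma dotL2_lincomb a f h g : L2 mu f -> L2 mu h -> L2 mu g ->
  dotL2 mu (lincomb a f h) g = a * dotL2 mu f g + dotL2 mu h g.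
Proof.
move=> lf lh lg; have [rf jf] := integrable_mul_conj lf lg.
have [rh jh] := integrable_mul_conj lh lg.
have lin (p q : R) (u v w : T -> R) : mu.-integrable setT (EFin \o u) ->
    mu.-integrable setT (EFin \o v) -> mu.-integrable setT (EFin \o w) ->
    \int[mu]_x (p * u x + q * v x + w x) =
    p * (\int[mu]_x u x) + q * (\int[mu]_x v x) + \int[mu]_x w x.
  move=> iu iv iw.
  have ipu : mu.-integrable setT (EFin \o (fun x => p * u x)).
    exact: (integrableZl measurableT p iu).
  have iqv : mu.-integrable setT (EFin \o (fun x => q * v x)).
    exact: (integrableZl measurableT q iv).
  rewrite RintegralD//; last exact: (integrableD measurableT ipu iqv).
  by rewrite RintegralD// !RintegralZl.
case: a => p q; rewrite /dotL2.
have -> : \int[mu]_x complex.Re (lincomb (p +i* q) f h x * (g x)^*) =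
  \int[mu]_x (p * complex.Re (f x * (g x)^*) + (- q) * complex.Im (f x * (g x)^*)
     + complex.Re (h x * (g x)^*)).
  apply: eq_Rintegral => x _; rewrite /lincomb.
  by case: (f x) (g x) (h x) => [u1 u2] [v1 v2] [w1 w2] /=; ring.
have -> : \int[mu]_x complex.Im (lincomb (p +i* q) f h x * (g x)^*) =
  \int[mu]_x (p * complex.Im (f x * (g x)^*) + q * complex.Re (f x * (g x)^*)
     + complex.Im (h x * (g x)^*)).
  apply: eq_Rintegral => x _; rewrite /lincomb.
  by case: (f x) (g x) (h x) => [u1 u2] [v1 v2] [w1 w2] /=; ring.
by rewrite !lin//; simpc; congr (_ +i* _); ring.
Qed.

Lemma dotL2C f g : L2 mu f -> L2 mu g -> dotL2 mu g f = (dotL2 mu f g)^*.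
Proof.
move=> lf lg; have [_ jf] := integrable_mul_conj lf lg.
rewrite /dotL2 /=; congr (_ +i* _).
  by apply: eq_Rintegral => x _; case: (f x) (g x) => [a b] [p q] /=; ring.
rewrite -[RHS]mulN1r -RintegralZl//; apply: eq_Rintegral => x _.
by case: (f x) (g x) => [a b] [p q] /=; ring.
Qed.

Lemma dotL2_nrm2 f : L2 mu f -> dotL2 mu f f = (nrm2 mu f ^+ 2)%:C.
Proof.
move=> lf; rewrite /dotL2; congr (_ +i* _).
  apply/EFin_inj; rewrite -sqr_nrm2// -(fineK (integral_normc2_fin lf)).
  by rewrite /Rintegral; congr ((fine _)%:E); apply: eq_integral => x _; rewrite Re_mul_conj.
rewrite (_ : (fun x => complex.Im (f x * (f x)^*)) = (fun=> 0)).
  by rewrite /Rintegral integral0.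
by apply/funext => x; case: (f x) => a b /=; ring.
Qed.

Lemma dotL2_suml (I : finType) (c : I -> R[i]) (v : I -> T -> R[i]) g :
  (forall i, L2 mu (v i)) -> L2 mu g ->
  dotL2 mu (fun x => \sum_i c i * v i x) g = \sum_i c i * dotL2 mu (v i) g.
Proof.
move=> lv lg; have lz : L2 mu (fun=> 0) := L2_0 mu.
suff : forall s : seq I, L2 mu (fun x => \sum_(i <- s) c i * v i x) /\
  dotL2 mu (fun x => \sum_(i <- s) c i * v i x) g =
  \sum_(i <- s) c i * dotL2 mu (v i) g by move=> /(_ (index_enum I))[].
elim=> [|i s [ls IH]].
  rewrite (_ : (fun x => _) = (fun=> 0)); last by apply/funext => x; rewrite big_nil.
  split => //; rewrite big_nil.
  (* The value at 0 comes from linearity alone, through 0 = -1 * 0 + 0. *)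
  have := dotL2_lincomb (-1) lz lz lg.
  rewrite (_ : lincomb (-1) _ _ = (fun=> 0)) ?mulN1r ?addNr//.
  by apply/funext => x; rewrite /lincomb mulr0 addr0.
rewrite (_ : (fun x => _) = lincomb (c i) (v i) (fun x => \sum_(i <- s) c i * v i x)).
  by split; [exact: L2_lincomb|rewrite dotL2_lincomb// big_cons IH].
by apply/funext => x; rewrite big_cons.
Qed.

Lemma dotL2_sum (I : finType) (c : I -> R[i]) (v : I -> T -> R[i]) :
  (forall i, L2 mu (v i)) ->
  dotL2 mu (fun x => \sum_i c i * v i x) (fun x => \sum_i c i * v i x) =
  \sum_i c i * (\sum_j c j * dotL2 mu (v j) (v i))^*.
Proof.
move=> lv; have ls : L2 mu (fun x => \sum_i c i * v i x).
  by apply: L2_sum => i; exact: (L2Z (c i) (lv i)).1.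
rewrite dotL2_suml//; apply: eq_bigr => i _; congr (_ * _).
by rewrite (dotL2C ls)// dotL2_suml.
Qed.

End InnerProduct.

(** A square cell of side e / 2 has diameter e / sqrt 2, so its lower left corner is within e of
    each of its points. *)
Lemma normc_le_halves (R : realType) (a b p q e : R) : 0 < e ->
  p <= a < p + e / 2 -> q <= b < q + e / 2 ->
  normc ((a +i* b) - (p +i* q)) <= e.
Proof.
move=> e0 /andP[a1 a2] /andP[b1 b2] /=.
have -> : e = Num.sqrt (e ^+ 2) by rewrite sqrtr_sqr gtr0_norm.
apply: ler_wsqrtr.
have h1 : 0 <= a - p <= e / 2 by apply/andP; split; lra.
have h2 : 0 <= b - q <= e / 2 by apply/andP; split; lra.
move: (a - p) (b - q) h1 h2 => x y /andP[x0 x1] /andP[y0 y1].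
have xe : x ^+ 2 <= (e / 2) ^+ 2 by rewrite lerXn2r ?nnegrE//; lra.
have ye : y ^+ 2 <= (e / 2) ^+ 2 by rewrite lerXn2r ?nnegrE//; lra.
have := sqr_ge0 e; rewrite (_ : e ^+ 2 = 4 * (e / 2) ^+ 2); last by field.
lra.
Qed.

(** The index is the truncation of (x + C) / r, which is at most that of 2 C / r; the successor
    makes room for this last value. Uniqueness is what leaves a single nonzero term in the step
    function built on the grid. *)
Lemma grid_index (R : realType) (C r x : R) : 0 < r -> `|x| <= C ->
  exists i : 'I_(Num.truncn (2 * C / r)).+1,
    (i%:R * r - C <= x < i%:R * r - C + r) /\
    forall j : 'I_(Num.truncn (2 * C / r)).+1,
      j%:R * r - C <= x < j%:R * r - C + r -> j = i.
Proof.
move=> r0; rewrite ler_norml => /andP[v1 v2].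
have q0 : 0 <= (x + C) / r by apply: divr_ge0; [lra|exact: ltW].
have /andP[t1 t2] := truncn_itv q0.
have iM : (Num.truncn ((x + C) / r) < (Num.truncn (2 * C / r)).+1)%N.
  rewrite ltnS; apply: le_truncn.
  by rewrite ler_pM2r ?invr_gt0//; lra.
exists (Ordinal iM); split.
  move: t1 t2; rewrite -natr1 ler_pdivlMr// ltr_pdivrMr//= => t1 t2.
  by apply/andP; split; lra.
move=> j /andP[j1 j2]; apply/val_inj => /=; apply/esym/truncn_def; apply/andP; split.
  by rewrite ler_pdivlMr//; lra.
by rewrite ltr_pdivrMr// -natr1; lra.
Qed.

Section StepCalculus.
Context (R : realType) (d : measure_display) (T : measurableType d).
Variables (mu : {measure set T -> \bar R}) (E : pvm mu).
Implicit Types f g h : T -> R[i].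
Local Notation borel := (set (measurableTypeR R)).

(* As step_fun and step_op, but indexed by any finite type, so that sums and
   products of step functions need no renumbering. *)
Definition fstep_fun (I : finType) (c : I -> R[i]) (A : I -> borel) (l : R) : R[i] :=
  \sum_i c i * (\1_(A i) l)%:C.

Definition fstep_op (I : finType) (c : I -> R[i]) (A : I -> borel) f : T -> R[i] :=
  fun x => \sum_i c i * E (A i) f x.

Lemma spectral_measureE f A : L2 mu f -> measurable A ->
  spectral_measure E f A = (nrm2 mu (E A f) ^+ 2)%:E.
Proof.
move=> lf mA; rewrite /spectral_measure; case: asboolP => // _.
by rewrite sqr_nrm2//; exact: proj_L2.
Qed.

Lemma spectral_measureT f : L2 mu f ->
  spectral_measure E f setT = (nrm2 mu f ^+ 2)%:E.
Proof.
move=> lf; rewrite spectral_measureE//; congr ((_ ^+ _)%:E).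
by apply: eq_nrm2 => //; [exact: proj_L2|exact: projT].
Qed.

(** The projections are symmetric and multiply by intersecting sets. The right-hand side is the
    spectral measure of the intersection, hence also the inner product of the two indicators, see
    [dotL2_indic]. *)
Lemma dotL2_proj f A B : L2 mu f -> measurable A -> measurable B ->
  dotL2 mu (E A f) (E B f) = (nrm2 mu (E (A `&` B) f) ^+ 2)%:C.
Proof.
move=> lf mA mB; have mAB : measurable (A `&` B) by exact: measurableI.
have self C : measurable C -> dotL2 mu (E C f) f = (nrm2 mu (E C f) ^+ 2)%:C.
  move=> mC; have lC := proj_L2 E mC lf.
  rewrite -dotL2_nrm2// -(proj_sym E mC lC lf); apply: eq_dotL2 => //.
  - exact: proj_L2.
  - by have := projI E mC mC lf; rewrite setIid.
  - exact: nearW.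
rewrite -self// -(proj_sym E mB (proj_L2 E mA lf) lf); apply: eq_dotL2 => //.
- exact: (proj_L2 E mB (proj_L2 E mA lf)).
- exact: proj_L2.
- by rewrite setIC; exact/eqL2_sym/projI.
- exact: nearW.
Qed.

Lemma cmeasurable_indic (A : borel) : measurable A ->
  cmeasurable (fun l : measurableTypeR R => (\1_A l : R)%:C).
Proof. by move=> mA; exact/cmeasurable_real/measurable_indic. Qed.

Lemma cmeasurable_fstep (I : finType) (c : I -> R[i]) (A : I -> borel) :
  (forall i, measurable (A i)) -> cmeasurable (fstep_fun c A : measurableTypeR R -> R[i]).
Proof.
move=> mA; apply: cmeasurable_sum => i; apply: cmeasurableM.
  exact: cmeasurable_cst.
exact: cmeasurable_indic.
Qed.

Lemma L2_indic f A : L2 mu f -> measurable A ->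
  L2 (spectral_measure E f) (fun l => (\1_A l : R)%:C).
Proof.
move=> lf mA; apply/L2P; first exact: cmeasurable_indic.
under eq_integral do rewrite normc_real ger0_norm// indicE -natrX.
rewrite [ltLHS](_ : _ = \int[spectral_measure E f]_l (\1_A l)%:E)%E; last first.
  by apply: eq_integral => l _; rewrite indicE; case: (_ \in _).
by rewrite integral_indic// setIT [ltLHS](spectral_measureE lf mA) ltry.
Qed.

Lemma dotL2_indic f A B : L2 mu f -> measurable A -> measurable B ->
  dotL2 (spectral_measure E f) (fun l => (\1_A l : R)%:C) (fun l => (\1_B l : R)%:C) =
  (nrm2 mu (E (A `&` B) f) ^+ 2)%:C.
Proof.
move=> lf mA mB; have mAB : measurable (A `&` B) by exact: measurableI.
rewrite /dotL2; congr (_ +i* _); last first.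
  rewrite (_ : (fun l => _) = (fun=> 0)); first by rewrite /Rintegral integral0.
  by apply/funext => l /=; ring.
apply/EFin_inj; rewrite -spectral_measureE// -[RHS]fineK; last first.
  by rewrite spectral_measureE.
congr ((fine _)%:E); rewrite -[in RHS](setIT (A `&` B)) -integral_indic//.
by apply: eq_integral => l _; rewrite indicI /=; congr (_%:E); ring.
Qed.

Lemma L2_fstep_op (I : finType) (c : I -> R[i]) (A : I -> borel) f :
  (forall i, measurable (A i)) -> L2 mu f -> L2 mu (fstep_op c A f).
Proof.
by move=> mA lf; apply: L2_sum => i; exact: (L2Z (c i) (proj_L2 E (mA i) lf)).1.
Qed.

(** The vectors E(A i) f and the indicators of the A i have the same Gram matrix, so equal
    combinations have equal norms; the sets may overlap. *)
Lemma nrm2_fstep (I : finType) (c : I -> R[i]) (A : I -> borel) f :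
  (forall i, measurable (A i)) -> L2 mu f ->
  L2 (spectral_measure E f) (fstep_fun c A) /\
  nrm2 mu (fstep_op c A f) = nrm2 (spectral_measure E f) (fstep_fun c A).
Proof.
move=> mA lf; have l1 i := L2_indic lf (mA i).
have ls : L2 (spectral_measure E f) (fstep_fun c A).
  by apply: L2_sum => i; exact: (L2Z (c i) (l1 i)).1.
split => //; apply/eqP; rewrite -(@eqrXn2 _ 2)// ?nrm2_ge0//; apply/eqP.
apply: complexI; rewrite -!dotL2_nrm2//; last exact: L2_fstep_op.
rewrite (dotL2_sum c (fun i => proj_L2 E (mA i) lf)) (dotL2_sum c l1).
apply: eq_bigr => i _; congr (_ * _^*); apply: eq_bigr => j _; congr (_ * _).
by rewrite dotL2_proj// dotL2_indic.
Qed.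

Lemma fstep_step (I : finType) (c : I -> R[i]) (A : I -> borel) :
  (forall i, measurable (A i)) ->
  exists n (c' : 'I_n -> R[i]) (A' : 'I_n -> borel),
    [/\ forall k, measurable (A' k), step_fun c' A' = fstep_fun c A &
        forall f, step_op E c' A' f = fstep_op c A f].
Proof.
move=> mA; exists #|I|, (c \o enum_val), (A \o enum_val); split => //=.
  apply/funext => l; rewrite /step_fun /fstep_fun.
  by rewrite (reindex _ (onW_bij _ (enum_val_bij I))).
move=> f; apply/funext => x; rewrite /step_op /fstep_op.
by rewrite (reindex _ (onW_bij _ (enum_val_bij I))).
Qed.

Lemma fstep_funB (I J : finType) (c : I -> R[i]) (A : I -> borel)
    (c' : J -> R[i]) (A' : J -> borel) :
  (forall i, measurable (A i)) -> (forall j, measurable (A' j)) ->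
  exists (K : finType) (b : K -> R[i]) (B : K -> borel),
    [/\ forall k, measurable (B k),
        fstep_fun b B = (fun l => fstep_fun c A l - fstep_fun c' A' l) &
        forall f, fstep_op b B f = (fun x => fstep_op c A f x - fstep_op c' A' f x)].
Proof.
move=> mA mA'; exists (I + J)%type,
  (fun k => match k with inl i => c i | inr j => - c' j end),
  (fun k => match k with inl i => A i | inr j => A' j end); split.
- by case.
- apply/funext => l; rewrite /fstep_fun big_sumType/= -sumrN.
  by congr (_ + _); apply: eq_bigr => j _; rewrite mulNr.
- move=> f; apply/funext => x; rewrite /fstep_op big_sumType/= -sumrN.
  by congr (_ + _); apply: eq_bigr => j _; rewrite mulNr.
Qed.

(** Products of step functions live on the pairwise intersections, where [projI] applies. Equality
    is only almost everywhere, since a projection is linear only up to null sets; finitely many of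
    these are discarded. *)
Lemma fstep_funM (I J : finType) (c : I -> R[i]) (A : I -> borel)
    (c' : J -> R[i]) (A' : J -> borel) :
  (forall i, measurable (A i)) -> (forall j, measurable (A' j)) ->
  exists (K : finType) (b : K -> R[i]) (B : K -> borel),
    [/\ forall k, measurable (B k),
        fstep_fun b B = (fun l => fstep_fun c A l * fstep_fun c' A' l) &
        forall f, L2 mu f ->
          eqL2 mu (fstep_op b B f) (fstep_op c A (fstep_op c' A' f))].
Proof.
move=> mA mA'; exists (I * J)%type, (fun k => c k.1 * c' k.2),
  (fun k => A k.1 `&` A' k.2); split.
- by move=> k; exact: measurableI.
- apply/funext => l; rewrite /fstep_fun mulr_suml.
  under [RHS]eq_bigr do rewrite mulr_sumr.
  rewrite pair_big/=; apply: eq_bigr => -[i j] _ /=.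
  by rewrite indicI /= rmorphM; ring.
- move=> f lf; rewrite /fstep_op.
  have h1 : {ae mu, forall x, forall i j,
      E (A i `&` A' j) f x = E (A i) (E (A' j) f) x}.
    apply: filter_forall => i; apply: filter_forall => j.
    exact: projI.
  have h2 : {ae mu, forall x, forall i,
      E (A i) (fun y => \sum_j c' j * E (A' j) f y) x =
      \sum_j c' j * E (A i) (E (A' j) f) x}.
    apply: filter_forall => i.
    suff : forall s : seq J, L2 mu (fun y => \sum_(j <- s) c' j * E (A' j) f y) /\
        eqL2 mu (E (A i) (fun y => \sum_(j <- s) c' j * E (A' j) f y))
          (fun x => \sum_(j <- s) c' j * E (A i) (E (A' j) f) x).
      by move=> /(_ (index_enum J))[].
    elim=> [|j s [ls IH]].
      rewrite (_ : (fun y => _) = (fun=> 0)); last first.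
        by apply/funext => x; rewrite big_nil.
      have lz := L2_0 mu; split => //.
      have := proj_lincomb E (-1) (mA i) lz lz; apply: filterS => x.
      rewrite (_ : lincomb (-1) _ _ = (fun=> 0)); last first.
        by apply/funext => y; rewrite /lincomb mulr0 addr0.
      by rewrite /lincomb mulN1r addNr big_nil.
    rewrite (_ : (fun y => \sum_(j <- _ :: _) _) =
      lincomb (c' j) (E (A' j) f) (fun y => \sum_(j <- s) c' j * E (A' j) f y)).
      have lj := proj_L2 E (mA' j) lf; split; first exact: L2_lincomb.
      apply: filterS2 (proj_lincomb E (c' j) (mA i) lj ls) IH => x -> e.
      by rewrite /lincomb e big_cons.
    by apply/funext => y; rewrite big_cons.
  apply: filterS2 h1 h2 => x e1 e2.
  under [RHS]eq_bigr do rewrite e2 mulr_sumr.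
  rewrite pair_big/=; apply: eq_bigr => -[i j] _ /=.
  by rewrite e1 mulrA.
Qed.

Lemma fstep_op_lincomb (I : finType) (c : I -> R[i]) (A : I -> borel) a f g :
  (forall i, measurable (A i)) -> L2 mu f -> L2 mu g ->
  eqL2 mu (fstep_op c A (lincomb a f g)) (lincomb a (fstep_op c A f) (fstep_op c A g)).
Proof.
move=> mA lf lg.
have : {ae mu, forall x, forall i,
    E (A i) (lincomb a f g) x = lincomb a (E (A i) f) (E (A i) g) x}.
  by apply: filter_forall => i; exact: proj_lincomb.
apply: filterS => x e; rewrite /fstep_op /lincomb mulr_sumr -big_split/=.
by apply: eq_bigr => i _; rewrite e /lincomb; ring.
Qed.

Lemma fstep_op_ae (I : finType) (c : I -> R[i]) (A : I -> borel) f g :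
  (forall i, measurable (A i)) -> L2 mu f -> L2 mu g -> eqL2 mu f g ->
  eqL2 mu (fstep_op c A f) (fstep_op c A g).
Proof.
move=> mA lf lg fg.
have : {ae mu, forall x, forall i, E (A i) f x = E (A i) g x}.
  by apply: filter_forall => i; exact: proj_ae.
by apply: filterS => x e; apply: eq_bigr => i _; rewrite e.
Qed.

(** The square of side 2 C that contains the values is cut into half-open cells of side e / 2, and
    phi is replaced on the preimage of each cell by the lower left corner of the cell. *)
Lemma fstep_approx (phi : measurableTypeR R -> R[i]) (C e : R) :
  cmeasurable phi -> (forall l, normc (phi l) <= C) -> 0 < e ->
  exists (I : finType) (c : I -> R[i]) (A : I -> borel),
    (forall i, measurable (A i)) /\
    forall l, normc (phi l - fstep_fun c A l) <= e.
Proof.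
move=> [m1 m2] bC e0; pose r := e / 2; have r0 : 0 < r by rewrite divr_gt0.
pose M := (Num.truncn (2 * C / r)).+1.
pose val (i : 'I_M) : R := i%:R * r - C.
pose slab (v : measurableTypeR R -> R) (i : 'I_M) : borel :=
  v @^-1` `[val i, val i + r[%classic.
have mslab v i : measurable_fun setT v -> measurable (slab v i).
  by move=> mv; rewrite -[slab v i]setTI; exact: mv.
pose re l := complex.Re (phi l); pose im l := complex.Im (phi l).
pose A (k : 'I_M * 'I_M) := slab re k.1 `&` slab im k.2.
pose c (k : 'I_M * 'I_M) := val k.1 +i* val k.2.
exists ('I_M * 'I_M)%type, c, A; split.
  by move=> k; apply: measurableI; exact: mslab.
have C0 l : 0 <= C := le_trans (normc_ge0 _) (bC l).
have slabP (v : R -> R) l : `|v l| <= C -> exists i, slab v i l /\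
    forall j, slab v j l -> j = i.
  move=> /(grid_index r0)[i [i1 i2]]; exists i.
  by split => [|j]; rewrite /slab /= in_itv//=; exact: i2.
move=> l.
have [b1 b2] : `|re l| <= C /\ `|im l| <= C.
  split; apply: le_trans (bC l); rewrite /re /im; case: (phi l) => a b /=.
    by rewrite -sqrtr_sqr ler_wsqrtr// lerDl sqr_ge0.
  by rewrite -sqrtr_sqr ler_wsqrtr// lerDr sqr_ge0.
have [i [il iu]] := slabP _ _ b1; have [j [jl ju]] := slabP _ _ b2.
have -> : fstep_fun c A l = c (i, j).
  rewrite /fstep_fun (bigD1 (i, j))//= big1 ?addr0.
    by rewrite indicE mem_set// mulr1.
  move=> [i' j'] /eqP ij; rewrite indicE memNset ?mulr0// => -[/= /iu e1 /ju e2].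
  by apply: ij; rewrite e1 e2.
move: il jl; rewrite /slab /= !in_itv /= /re /im /c /=.
case: (phi l) => a b /= h1 h2.
exact: normc_le_halves.
Qed.

End StepCalculus.

(** * The bounded Borel functional calculus *)

(** Used with K the norm of f: dividing by 1 + K makes the error relative to K without a separate
    case K = 0. *)
Lemma div_double_succ_le (R : realFieldType) (z K : R) : 0 <= z -> 0 <= K ->
  z / (2 * (1 + K)) * K <= z / 2.
Proof.
move=> z0 K0; have K1 : 0 < 1 + K by rewrite ltr_pwDl.
rewrite [leLHS](_ : _ = z / 2 * (K / (1 + K))).
  rewrite ler_piMr//; first by rewrite divr_ge0.
  by rewrite ler_pdivrMr// mul1r lerDr.
by field; rewrite gt_eqF.
Qed.

Section BoundedCalculus.
Context (R : realType) (d : measure_display) (T : measurableType d).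
Variables (mu : {measure set T -> \bar R}) (E : pvm mu).
Implicit Types (f g h : T -> R[i]) (phi psi : measurableTypeR R -> R[i]).
Local Notation borel := (set (measurableTypeR R)).
Local Notation "''S_' f" := (spectral_measure E f) (at level 8, f at level 2).

(** The spectral measure of f has total mass |f|^2, so the constant C has norm C |f| with respect to
    it. *)
Lemma nrm2_spectral_bounded phi f (C : R) : L2 mu f -> cmeasurable phi ->
  (forall l, normc (phi l) <= C) ->
  L2 'S_f phi /\ nrm2 'S_f phi <= C * nrm2 mu f.
Proof.
move=> lf mphi bC.
have C0 : 0 <= C := le_trans (normc_ge0 _) (bC 0).
have mC : cmeasurable (fun _ : measurableTypeR R => C%:C) by exact: cmeasurable_cst.
have iC : (\int['S_f]_l (normc (C%:C : R[i]) ^+ 2)%:E = ((C * nrm2 mu f) ^+ 2)%:E)%E.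
  rewrite integral_cst// [X in (_ * X)%E](spectral_measureT E lf).
  by rewrite -EFinM normc_real ger0_norm// exprMn.
have lC : L2 'S_f (fun=> C%:C) by apply/L2P => //; rewrite iC ltry.
have nC : nrm2 'S_f (fun=> C%:C) = C * nrm2 mu f.
  apply/eqP; rewrite -(@eqrXn2 _ 2)// ?nrm2_ge0 ?mulr_ge0 ?nrm2_ge0//.
  by apply/eqP/EFin_inj; rewrite -sqr_nrm2.
rewrite -nC; apply: L2_le => // l.
by rewrite normc_real ger0_norm.
Qed.

(** Any step function can be tested against the ones supplied by the definition of the spectral
    integral, since on the difference of two step functions the isometry is already known. *)
Lemma fstep_op_spectral_integral (I : finType) (c : I -> R[i]) (A : I -> borel) phi f h :
  (forall i, measurable (A i)) ->
  is_spectral_integral E phi f h -> L2 'S_f phi ->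
  nrm2 mu (fun x => h x - fstep_op E c A f x) <=
  nrm2 'S_f (fun l => phi l - fstep_fun c A l).
Proof.
move=> mA [lf lh H] lphi; apply/ler_addgt0Pr => e e0.
(* The definition bounds a norm in L^2(mu) but a squared norm for the spectral measure, hence the
   two entries. *)
pose e' := Num.min (e / 2) ((e / 2) ^+ 2).
have e20 : 0 < e / 2 by rewrite divr_gt0.
have e'0 : 0 < e' by rewrite lt_min e20 exprn_gt0.
have [n [c' [A' [mA' iphi dh]]]] := H e' e'0.
have ls := L2_fstep_op E c mA lf; have ls' := L2_fstep_op E c' mA' lf.
have [l1 _] := nrm2_fstep E c mA lf; have [l1' _] := nrm2_fstep E c' mA' lf.
have b1 : nrm2 mu (fun x => h x - fstep_op E c' A' f x) <= e / 2.
  rewrite -lee_fin -L2_fine; last exact: (L2B lh ls').1.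
  rewrite (le_trans (ltW dh))// lee_fin ge_min lexx//.
have b2 : nrm2 'S_f (fun l => phi l - fstep_fun c' A' l) <= e / 2.
  apply: nrm2_le; [exact: (L2B lphi l1').1|exact: ltW|].
  by rewrite (le_trans (ltW iphi))// lee_fin ge_min lexx orbT.
have b3 : nrm2 mu (fun x => fstep_op E c' A' f x - fstep_op E c A f x) =
    nrm2 'S_f (fun l => fstep_fun c' A' l - fstep_fun c A l).
  have [K [b [B [mB <- oB]]]] := fstep_funB E c' c mA' mA.
  by rewrite -oB; exact: (nrm2_fstep E b mB lf).2.
have := nrm2_triangle lh ls' ls; have := nrm2_triangle l1' lphi l1.
rewrite b3 => t1 t2; rewrite nrm2_distC in b2.
apply: (le_trans t2); rewrite [leRHS](_ : _ = e / 2 + (e / 2 +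
  nrm2 'S_f (fun l => phi l - fstep_fun c A l))); last by field.
by rewrite lerD// (le_trans t1)// lerD.
Qed.

Lemma spectral_integral_exists phi f (C : R) : L2 mu f -> cmeasurable phi ->
  (forall l, normc (phi l) <= C) -> exists h, is_spectral_integral E phi f h.
Proof.
move=> lf mphi bC.
(* Chosen so that the n-th approximation costs at most 2^-n / 2 at f; consecutive ones then differ
   by at most 2^-n, as [L2_complete] requires. *)
pose e n : R := 2^-1 ^+ n / (2 * (1 + nrm2 mu f)).
have nf := nrm2_ge0 mu f.
have den : 0 < 2 * (1 + nrm2 mu f) by rewrite mulr_gt0// ltr_pwDl.
have e0 n : 0 < e n by rewrite divr_gt0// exprn_gt0// invr_gt0.
have ef n : e n * nrm2 mu f <= 2^-1 ^+ n / 2.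
  by rewrite div_double_succ_le// exprn_ge0// invr_ge0.
pose P n (s : {n : nat & (('I_n -> R[i]) * ('I_n -> borel))%type}) :=
  (forall k, measurable ((projT2 s).2 k)) /\
  forall l, normc (phi l - fstep_fun (projT2 s).1 (projT2 s).2 l) <= e n.
have /choice[s sP] : forall n, exists s, P n s.
  move=> n.
  have [I [c [A [mA approx]]]] := fstep_approx mphi bC (e0 n).
  have [m [c' [A' [mA' sf _]]]] := fstep_step E c mA.
  exists (existT _ m (c', A')); split => //= l.
  by rewrite -[fstep_fun _ _]/(step_fun c' A') sf.
pose u n := fstep_op E (projT2 (s n)).1 (projT2 (s n)).2 f.
have lu n : L2 mu (u n) by apply: L2_fstep_op => //; case: (sP n).
have lphi := (nrm2_spectral_bounded lf mphi bC).1.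
have ls n := (nrm2_fstep E (projT2 (s n)).1 (sP n).1 lf).1.
have bs n : nrm2 'S_f (fun l => phi l - fstep_fun (projT2 (s n)).1 (projT2 (s n)).2 l)
    <= 2^-1 ^+ n / 2.
  apply: le_trans (ef n).
  apply: (nrm2_spectral_bounded lf _ (sP n).2).2.
  by apply: cmeasurableB => //; apply: cmeasurable_fstep; exact: (sP n).1.
have du n : nrm2 mu (fun x => u n.+1 x - u n x) <= 2^-1 ^+ n.
  have [K [b [B [mB bE oB]]]] :=
    fstep_funB E (projT2 (s n.+1)).1 (projT2 (s n)).1 (sP n.+1).1 (sP n).1.
  rewrite /u -oB (nrm2_fstep E b mB lf).2 bE.
  apply: (le_trans (nrm2_triangle (ls _) lphi (ls _))).
  rewrite [leRHS](_ : _ = 2^-1 ^+ n / 2 + 2^-1 ^+ n / 2); last by field.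
  rewrite lerD// nrm2_distC (le_trans (bs _))//.
  by rewrite ler_pM2r ?invr_gt0// exprS ler_piMl ?exprn_ge0 ?invr_ge0// invf_le1// ler1n.
have [h [lh hu]] := L2_complete lu du.
exists h; split => // ep ep0.
have [n n2] : exists n, 2 * (2^-1 : R) ^+ n < ep.
  have : (fun n => (2^-1 : R) ^+ n) @ \oo --> 0.
    by apply: cvg_expr; rewrite ger0_norm ?invr_ge0// invf_lt1// ltr1n.
  move=> /cvgrPdist_lt /(_ (ep / 2)); rewrite divr_gt0// => /(_ isT)[n _ /(_ n (leqnn n))].
  rewrite /= sub0r normrN ger0_norm ?exprn_ge0 ?invr_ge0// => h2.
  by exists n; rewrite mulrC -ltr_pdivlMr.
exists (projT1 (s n)), (projT2 (s n)).1, (projT2 (s n)).2; split; first exact: (sP n).1.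
  rewrite sqr_nrm2; last exact: (L2B lphi (ls n)).1.
  rewrite lte_fin (le_lt_trans _ n2)//.
  apply: (@le_trans _ _ ((2^-1 ^+ n / 2) ^+ 2)).
    by rewrite lerXn2r ?nnegrE ?nrm2_ge0 ?bs// divr_ge0// exprn_ge0// invr_ge0.
  have z0 : 0 <= (2^-1 : R) ^+ n by rewrite exprn_ge0// invr_ge0.
  have z1 : (2^-1 : R) ^+ n <= 1 by rewrite exprn_ile1// ?invr_ge0// invf_le1// ler1n.
  by move: (2^-1 ^+ n) z0 z1 => z z0 z1; nra.
rewrite /distL2 [L2norm _ _](L2_fine (L2B lh (lu n)).1) lte_fin.
exact: le_lt_trans (hu n) n2.
Qed.

Definition bounded_borel phi :=
  cmeasurable phi /\ exists C : R, forall l, normc (phi l) <= C.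

Local Notation "''Phi_' phi" := (spectral_integral E phi) (at level 8, phi at level 2).

Lemma spectral_integralP phi f : L2 mu f -> bounded_borel phi ->
  is_spectral_integral E phi f ('Phi_phi f).
Proof.
move=> lf [mphi [C bC]]; have [h hh] := spectral_integral_exists lf mphi bC.
by rewrite /spectral_integral; case: xgetP => [_ -> //|/(_ h)].
Qed.

Lemma L2_spectral_integral phi f : L2 mu f -> bounded_borel phi -> L2 mu ('Phi_phi f).
Proof. by move=> lf bphi; case: (spectral_integralP lf bphi). Qed.

Lemma L2_spectral_bounded phi f : L2 mu f -> bounded_borel phi -> L2 'S_f phi.
Proof. by move=> lf [mphi [C bC]]; exact: (nrm2_spectral_bounded lf mphi bC).1. Qed.

(** One step function serves every f at once, because it approximates phi uniformly. The algebraic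
    rules below depend on this, as they compare the calculus at several vectors. *)
Lemma spectral_integral_approx phi (e : R) : bounded_borel phi -> 0 < e ->
  exists (I : finType) (c : I -> R[i]) (A : I -> borel),
    [/\ forall i, measurable (A i),
        forall l, normc (phi l - fstep_fun c A l) <= e &
        forall f, L2 mu f ->
          nrm2 mu (fun x => 'Phi_phi f x - fstep_op E c A f x) <= e * nrm2 mu f].
Proof.
move=> bphi e0; have [mphi [C bC]] := bphi.
have [I [c [A [mA sA]]]] := fstep_approx mphi bC e0.
exists I, c, A; split => // f lf.
apply: (le_trans (fstep_op_spectral_integral c mA (spectral_integralP lf bphi) _)).
  exact: L2_spectral_bounded.
apply: (nrm2_spectral_bounded lf _ sA).2.
by apply: cmeasurableB => //; exact: cmeasurable_fstep.
Qed.

Lemma nrm2_spectral_integral phi f : L2 mu f -> bounded_borel phi ->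
  nrm2 mu ('Phi_phi f) = nrm2 'S_f phi.
Proof.
move=> lf bphi; have lF := L2_spectral_integral lf bphi.
have lphi := L2_spectral_bounded lf bphi; have [mphi _] := bphi.
apply/eqP; rewrite eq_le; apply/andP; split; apply/ler_addgt0Pr => e e0;
  have den : 0 < 2 * (1 + nrm2 mu f) by rewrite mulr_gt0// ltr_pwDl// nrm2_ge0.
all: have [I [c [A [mA sA fA]]]] := spectral_integral_approx bphi (divr_gt0 e0 den).
all: have ls := L2_fstep_op E c mA lf; have [l1 n1] := nrm2_fstep E c mA lf.
all: have e2 : e / (2 * (1 + nrm2 mu f)) * nrm2 mu f <= e / 2
  by rewrite div_double_succ_le ?nrm2_ge0// ltW.
all: have b1 := le_trans (fA f lf) e2.
all: have b2 : nrm2 'S_f (fun l => phi l - fstep_fun c A l) <= e / 2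
  by apply: le_trans e2; apply: (nrm2_spectral_bounded lf _ sA).2;
     apply: cmeasurableB => //; exact: cmeasurable_fstep.
all: have := nrm2_dist lF ls; have := nrm2_dist lphi l1.
all: rewrite n1 !ler_norml => /andP[p1 p2] /andP[q1 q2]; lra.
Qed.

Lemma nrm2_spectral_integral_le phi f (C : R) : L2 mu f -> cmeasurable phi ->
  (forall l, normc (phi l) <= C) -> nrm2 mu ('Phi_phi f) <= C * nrm2 mu f.
Proof.
move=> lf mphi bC; rewrite nrm2_spectral_integral//; last by split => //; exists C.
exact: (nrm2_spectral_bounded lf mphi bC).2.
Qed.

(** Restricting to e <= 1 allows factors such as C + e in the error to be absorbed into K as C + 1;
    [spectral_integralM] needs this. *)
Lemma eqL2_small f g (K : R) : L2 mu f -> L2 mu g ->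
  (forall e, 0 < e -> e <= 1 -> nrm2 mu (fun x => f x - g x) <= e * K) -> eqL2 mu f g.
Proof.
move=> lf lg H; apply: eqL2_nrm2B => //.
apply/eqP; rewrite eq_le nrm2_ge0 andbT.
apply/ler_addgt0Pr => e e0; rewrite add0r.
have K0 : 0 < 1 + `|K| by rewrite ltr_pwDl.
have e1 : 0 < Num.min 1 (e / (1 + `|K|)) by rewrite lt_min ltr01 divr_gt0.
apply: (le_trans (H _ e1 _)); first by rewrite ge_min lexx.
apply: (@le_trans _ _ (Num.min 1 (e / (1 + `|K|)) * (1 + `|K|))).
  rewrite ler_wpM2l ?(ltW e1)//; have := ler_norm K; lra.
by rewrite -ler_pdivlMr// ge_min lexx orbT.
Qed.

Lemma spectral_integral_lincomb phi a f g : bounded_borel phi -> L2 mu f -> L2 mu g ->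
  eqL2 mu ('Phi_phi (lincomb a f g)) (lincomb a ('Phi_phi f) ('Phi_phi g)).
Proof.
move=> bphi lf lg; have lfg := L2_lincomb a lf lg.
have lF := L2_spectral_integral lf bphi; have lG := L2_spectral_integral lg bphi.
apply: (@eqL2_small _ _ (nrm2 mu (lincomb a f g) + normc a * nrm2 mu f + nrm2 mu g)).
- exact: L2_spectral_integral.
- exact: L2_lincomb.
move=> e e0 _; have [I [c [A [mA sA fA]]]] := spectral_integral_approx bphi e0.
have lsf := L2_fstep_op E c mA lf; have lsg := L2_fstep_op E c mA lg.
have lsfg := L2_fstep_op E c mA lfg; have llin := L2_lincomb a lsf lsg.
have lFG := L2_spectral_integral lfg bphi; have llF := L2_lincomb a lF lG.
apply: (le_trans (nrm2_triangle lFG lsfg llF)).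
rewrite mulrDr mulrDr -addrA; apply: lerD; first exact: fA.
rewrite (eq_nrm2 (g := fun x => a * (fstep_op E c A f x - 'Phi_phi f x)
   + (fstep_op E c A g x - 'Phi_phi g x))); last 3 first.
- exact: (L2B lsfg llF).1.
- exact: (L2D (L2Z a (L2B lsf lF).1).1 (L2B lsg lG).1).1.
- apply: filterS (fstep_op_lincomb E c a mA lf lg) => x ->.
  by rewrite /lincomb; ring.
apply: (le_trans (L2D (L2Z a (L2B lsf lF).1).1 (L2B lsg lG).1).2).
rewrite (L2Z a (L2B lsf lF).1).2; apply: lerD; last by rewrite nrm2_distC; exact: fA.
by rewrite mulrCA ler_wpM2l// nrm2_distC; exact: fA.
Qed.

Lemma spectral_integral_ae phi f g : bounded_borel phi -> L2 mu f -> L2 mu g ->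
  eqL2 mu f g -> eqL2 mu ('Phi_phi f) ('Phi_phi g).
Proof.
move=> bphi lf lg fg.
have lF := L2_spectral_integral lf bphi; have lG := L2_spectral_integral lg bphi.
apply: (@eqL2_small _ _ (nrm2 mu f + nrm2 mu g)) => // e e0 _.
have [I [c [A [mA sA fA]]]] := spectral_integral_approx bphi e0.
have lsf := L2_fstep_op E c mA lf; have lsg := L2_fstep_op E c mA lg.
apply: (le_trans (nrm2_triangle lF lsf lG)).
rewrite mulrDr; apply: lerD; first exact: fA.
rewrite (eq_nrm2 (g := fun x => fstep_op E c A g x - 'Phi_phi g x)).
- by rewrite nrm2_distC; exact: fA.
- exact: (L2B lsf lG).1.
- exact: (L2B lsg lG).1.
- by apply: filterS (fstep_op_ae E c mA lf lg fg) => x ->.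
Qed.

Lemma bounded_borelB phi psi : bounded_borel phi -> bounded_borel psi ->
  bounded_borel (fun l => phi l - psi l).
Proof.
move=> [m1 [C1 b1]] [m2 [C2 b2]]; split; first exact: cmeasurableB.
by exists (C1 + C2) => l; rewrite (le_trans (le_normcB _ _))// lerD.
Qed.

Lemma bounded_borelM phi psi : bounded_borel phi -> bounded_borel psi ->
  bounded_borel (fun l => phi l * psi l).
Proof.
move=> [m1 [C1 b1]] [m2 [C2 b2]]; split; first exact: cmeasurableM.
by exists (C1 * C2) => l; rewrite normcM ler_pM.
Qed.

Lemma spectral_integralB phi psi f :
  bounded_borel phi -> bounded_borel psi -> L2 mu f ->
  eqL2 mu ('Phi_(fun l => phi l - psi l) f) (fun x => 'Phi_phi f x - 'Phi_psi f x).
Proof.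
move=> bphi bpsi lf; have bB := bounded_borelB bphi bpsi.
have lF := L2_spectral_integral lf bphi; have lG := L2_spectral_integral lf bpsi.
have lB := L2_spectral_integral lf bB; have lFG := (L2B lF lG).1.
apply: (@eqL2_small _ _ (4 * nrm2 mu f)) => // e e0 _.
have [I [c [A [mA sA fA]]]] := spectral_integral_approx bphi e0.
have [J [c' [A' [mA' sA' fA']]]] := spectral_integral_approx bpsi e0.
have [K [b [B [mB bE oB]]]] := fstep_funB E c c' mA mA'.
have ls := L2_fstep_op E c mA lf; have ls' := L2_fstep_op E c' mA' lf.
have lsB := L2_fstep_op E b mB lf.
apply: (le_trans (nrm2_triangle lB lsB lFG)).
rewrite (_ : e * _ = (e + e) * nrm2 mu f + (e * nrm2 mu f + e * nrm2 mu f)); last by ring.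
apply: lerD.
  apply: (le_trans (fstep_op_spectral_integral b mB (spectral_integralP lf bB) _)).
    exact: L2_spectral_bounded.
  apply: (nrm2_spectral_bounded lf _ _).2.
    by apply: cmeasurableB; [case: bB|exact: cmeasurable_fstep].
  move=> l; rewrite bE.
  rewrite (_ : _ - _ = (phi l - fstep_fun c A l) - (psi l - fstep_fun c' A' l)); last by ring.
  by rewrite (le_trans (le_normcB _ _))// lerD.
rewrite oB (_ : (fun x => _) = (fun x => (fstep_op E c A f x - 'Phi_phi f x) +
  ('Phi_psi f x - fstep_op E c' A' f x))); last by apply/funext => x; ring.
apply: (le_trans (L2D (L2B ls lF).1 (L2B lG ls').1).2).
by apply: lerD; [rewrite nrm2_distC; exact: fA|exact: fA'].
Qed.

Lemma nrm2_fstep_op_le (I : finType) (c : I -> R[i]) (A : I -> borel) f (C : R) :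
  (forall i, measurable (A i)) -> L2 mu f ->
  (forall l, normc (fstep_fun c A l) <= C) ->
  nrm2 mu (fstep_op E c A f) <= C * nrm2 mu f.
Proof.
move=> mA lf bC; rewrite (nrm2_fstep E c mA lf).2.
by apply: (nrm2_spectral_bounded lf _ bC).2; exact: cmeasurable_fstep.
Qed.

(** With s and s' step functions within e of phi and psi, one passes from Phi(phi) Phi(psi) f to s
    Phi(psi) f, then to s s' f, then to Phi(phi psi) f. The last passage uses s s' - phi psi = s (s'
    - psi) + (s - phi) psi. *)
Lemma spectral_integralM phi psi f :
  bounded_borel phi -> bounded_borel psi -> L2 mu f ->
  eqL2 mu ('Phi_phi ('Phi_psi f)) ('Phi_(fun l => phi l * psi l) f).
Proof.
move=> bphi bpsi lf; have bM := bounded_borelM bphi bpsi.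
have [mphi [C1 b1]] := bphi; have [mpsi [C2 b2]] := bpsi.
have C10 : 0 <= C1 := le_trans (normc_ge0 _) (b1 0).
have C20 : 0 <= C2 := le_trans (normc_ge0 _) (b2 0).
have lG := L2_spectral_integral lf bpsi; have lF := L2_spectral_integral lG bphi.
have lM := L2_spectral_integral lf bM.
apply: (@eqL2_small _ _ (nrm2 mu ('Phi_psi f) + (C1 + 1) * nrm2 mu f +
  (C1 + 1 + C2) * nrm2 mu f)) => // e e0 e1.
have [I [c [A [mA sA fA]]]] := spectral_integral_approx bphi e0.
have [J [c' [A' [mA' sA' fA']]]] := spectral_integral_approx bpsi e0.
have [K [b [B [mB bE oB]]]] := fstep_funM E c c' mA mA'.
have ls' := L2_fstep_op E c' mA' lf; have lsG := L2_fstep_op E c mA lG.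
have lss := L2_fstep_op E c mA ls'; have lsB := L2_fstep_op E b mB lf.
have bs l : normc (fstep_fun c A l) <= C1 + 1.
  rewrite (_ : fstep_fun c A l = phi l - (phi l - fstep_fun c A l)); last by ring.
  by rewrite (le_trans (le_normcB _ _))// lerD// (le_trans (sA l)).
apply: (le_trans (nrm2_triangle lF lsG lM)).
rewrite !mulrDr -addrA; apply: lerD; first exact: fA.
apply: (le_trans (nrm2_triangle lsG lss lM)); apply: lerD.
  rewrite (eq_nrm2 (g := fstep_op E c A (lincomb (-1) (fstep_op E c' A' f) ('Phi_psi f)))).
  - apply: (le_trans (nrm2_fstep_op_le mA (L2_lincomb (-1) ls' lG) bs)).
    rewrite mulrCA ler_wpM2l ?addr_ge0// (le_trans _ (fA' f lf))//.
    rewrite (_ : lincomb _ _ _ = fun x => 'Phi_psi f x - fstep_op E c' A' f x)//.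
    by apply/funext => x; rewrite /lincomb; ring.
  - exact: (L2B lsG lss).1.
  - exact: (L2_fstep_op E c mA (L2_lincomb (-1) ls' lG)).
  - apply: filterS (fstep_op_lincomb E c (-1) mA ls' lG) => x ->.
    by rewrite /lincomb; ring.
rewrite (eq_nrm2 (g := fun x => fstep_op E b B f x - 'Phi_(fun l => phi l * psi l) f x)).
- rewrite nrm2_distC.
  apply: (le_trans (fstep_op_spectral_integral b mB (spectral_integralP lf bM) _)).
    exact: L2_spectral_bounded.
  rewrite mulrA; apply: (nrm2_spectral_bounded lf _ _).2.
    by apply: cmeasurableB; [case: bM|exact: cmeasurable_fstep].
  move=> l; rewrite bE.
  rewrite (_ : _ - _ = fstep_fun c A l * (psi l - fstep_fun c' A' l) +
    (phi l - fstep_fun c A l) * psi l); last by ring.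
  rewrite (le_trans (le_normcD _ _))// !normcM mulrDr lerD//.
    by rewrite mulrC ler_pM.
  by rewrite ler_pM.
- exact: (L2B lss lM).1.
- exact: (L2B lsB lM).1.
- by apply: filterS (oB f lf) => x ->.
Qed.

Lemma spectral_integral_indic f A : L2 mu f -> measurable A ->
  eqL2 mu ('Phi_(fun l => (\1_A l : R)%:C) f) (E A f).
Proof.
move=> lf mA.
have bA : bounded_borel (fun l => (\1_A l : R)%:C).
  split; first exact: cmeasurable_indic.
  by exists 1 => l; rewrite normc_real indicE ger0_norm// lern1 leq_b1.
apply: eqL2_nrm2B; [exact: L2_spectral_integral|exact: proj_L2|].
have mA1 : forall i : 'I_1, measurable A by [].
have := fstep_op_spectral_integral (fun _ : 'I_1 => 1) mA1
  (spectral_integralP lf bA) (L2_spectral_bounded lf bA).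
rewrite (_ : (fun l => _ - fstep_fun _ _ l) = (fun=> 0)).
  rewrite nrm2_0 /fstep_op; under eq_fun do rewrite big_ord1 mul1r.
  by move=> h; apply/eqP; rewrite eq_le h nrm2_ge0.
by apply/funext => l; rewrite /fstep_fun big_ord1 mul1r subrr.
Qed.

(** By the isometry this is a statement in L^2 of the spectral measure of f, which is finite, so the
    constant 2 C is an admissible majorant. All continuity in u and in t comes from here. *)
Lemma spectral_integral_cvg (phi_ : nat -> measurableTypeR R -> R[i]) phi f (C : R) :
  L2 mu f -> (forall n, cmeasurable (phi_ n)) -> cmeasurable phi ->
  (forall n l, normc (phi_ n l) <= C) ->
  (forall l, normc (phi_ n l - phi l) @[n --> \oo] --> 0) ->
  nrm2 mu (fun x => 'Phi_(phi_ n) f x - 'Phi_phi f x) @[n --> \oo] --> 0.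
Proof.
move=> lf mn m bn cn.
have b l : normc (phi l) <= C.
  apply/ler_addgt0Pr => e e0.
  have := cn l; move=> /cvgrPdist_le /(_ _ e0)[n _ /(_ n (leqnn n))].
  rewrite /= sub0r normrN ger0_norm// => h.
  rewrite (_ : phi l = phi_ n l - (phi_ n l - phi l)); last by ring.
  by rewrite (le_trans (le_normcB _ _))// lerD.
have C0 : 0 <= C := le_trans (normc_ge0 _) (b 0).
have bphi : bounded_borel phi by split => //; exists C.
have bphin n : bounded_borel (phi_ n) by split => //; exists C.
have bB n := bounded_borelB (bphin n) bphi.
have lFB n : L2 mu (fun x => 'Phi_(phi_ n) f x - 'Phi_phi f x).
  by apply: (L2B _ _).1; exact: L2_spectral_integral.
have E1 n : nrm2 mu (fun x => 'Phi_(phi_ n) f x - 'Phi_phi f x) =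
    nrm2 'S_f (fun l => phi_ n l - phi l).
  rewrite -nrm2_spectral_integral//; apply: eq_nrm2 => //.
  - exact: L2_spectral_integral.
  - exact/eqL2_sym/spectral_integralB.
rewrite (funext E1).
have bC : bounded_borel (fun _ : measurableTypeR R => (C + C)%:C).
  by split; [exact: cmeasurable_cst|exists (normc (C + C)%:C)].
apply: (nrm2_dominated_cvg (L2_spectral_bounded lf bC)) => //.
- by move=> n; exact: cmeasurableB.
- move=> n l; rewrite normc_real (le_trans (le_normcB _ _))//.
  by rewrite ger0_norm ?addr_ge0// lerD.
Qed.

End BoundedCalculus.

(** * Spectral integrals of unbounded symbols *)

Section SquareRootCalculus.
Context (R : realType) (d : measure_display) (T : measurableType d).
Variables (mu : {measure set T -> \bar R}) (E : pvm mu).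
Implicit Types (f g h : T -> R[i]) (phi psi : measurableTypeR R -> R[i]).
Local Notation borel := (set (measurableTypeR R)).
Local Notation "''S_' f" := (spectral_measure E f) (at level 8, f at level 2).
Local Notation "''Phi_' phi" := (spectral_integral E phi) (at level 8, phi at level 2).

Lemma bounded_borel_fstep (I : finType) (c : I -> R[i]) (A : I -> borel) :
  (forall i, measurable (A i)) -> bounded_borel (fstep_fun c A).
Proof.
move=> mA; split; first exact: cmeasurable_fstep.
exists (\sum_i normc (c i)) => l; rewrite /fstep_fun.
elim/big_rec2 : _ => [|i x y _ xy]; first by rewrite normc0.
rewrite (le_trans (le_normcD _ _))// lerD// normcM normc_real ger0_norm//.
by rewrite ler_piMr// indicE lern1 leq_b1.
Qed.

Lemma spectral_integral_fstep (I : finType) (c : I -> R[i]) (A : I -> borel) f :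
  (forall i, measurable (A i)) -> L2 mu f ->
  eqL2 mu ('Phi_(fstep_fun c A) f) (fstep_op E c A f).
Proof.
move=> mA lf; have bs := bounded_borel_fstep c mA.
apply: eqL2_nrm2B; [exact: L2_spectral_integral|exact: L2_fstep_op|].
have := fstep_op_spectral_integral c mA (spectral_integralP E lf bs)
  (L2_spectral_bounded E lf bs).
under [X in nrm2 'S_f X]eq_fun do rewrite subrr.
by rewrite nrm2_0 => h; apply/eqP; rewrite eq_le h nrm2_ge0.
Qed.

Lemma bounded_borel_cst (a : R[i]) : bounded_borel (fun _ : measurableTypeR R => a).
Proof. by split; [exact: cmeasurable_cst|exists (normc a)]. Qed.

Lemma spectral_integral_cst a f : L2 mu f ->
  eqL2 mu ('Phi_(fun=> a) f) (fun x => a * f x).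
Proof.
move=> lf; have := spectral_integral_fstep (fun _ : 'I_1 => a)
  (fun=> measurableT : measurable [set: measurableTypeR R]) lf.
rewrite (_ : fstep_fun _ _ = (fun=> a)); last first.
  by apply/funext => l; rewrite /fstep_fun big_ord1 indicT mulr1.
move=> /eqL2_trans; apply; apply: filterS (projT E lf) => x e.
by rewrite /fstep_op big_ord1 e.
Qed.

Lemma spectral_integralZ a phi f : bounded_borel phi -> L2 mu f ->
  eqL2 mu ('Phi_(fun l => a * phi l) f) (fun x => a * 'Phi_phi f x).
Proof.
move=> bphi lf; have lF := L2_spectral_integral E lf bphi.
apply: eqL2_trans (spectral_integral_cst a lF).
exact/eqL2_sym/(spectral_integralM E (bounded_borel_cst a) bphi lf).
Qed.

(* The spectral measure of Phi(psi) f is |psi|^2 times that of f; this is used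
   here on each bounded interval [-n, n] only, and then n goes to infinity. *)
Lemma integral_spectral_measure_le (zeta : measurableTypeR R -> R[i]) psi f (C : R) :
  L2 mu f -> bounded_borel psi -> cmeasurable zeta ->
  (forall n : nat, exists M : R, forall l, `|l| <= n%:R -> normc (zeta l) <= M) ->
  (forall l, normc (zeta l * psi l) <= C) ->
  (\int['S_('Phi_psi f)]_l (normc (zeta l) ^+ 2)%:E <= ((C * nrm2 mu f) ^+ 2)%:E)%E.
Proof.
move=> lf bpsi mz bz bC; have lF := L2_spectral_integral E lf bpsi.
have C0 : 0 <= C := le_trans (normc_ge0 _) (bC 0).
pose F (n : nat) : borel := `[- n%:R, n%:R]%classic.
have mF n : measurable (F n) by exact: measurable_itv.
have FE n l : F n l <-> `|l| <= n%:R by rewrite /F /= in_itv /= ler_norml.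
have mz2 : measurable_fun setT (fun l => (normc (zeta l) ^+ 2)%:E).
  by apply/measurable_EFinP; exact: measurable_sqr_normc.
have ndF : {homo F : n m / (n <= m)%N >-> (n <= m)%O}.
  move=> n m nm; apply/subsetPset => l /FE ln; apply/FE.
  by rewrite (le_trans ln)// ler_nat.
have UF : \bigcup_n F n = setT.
  apply/seteqP; split => // l _; exists (Num.truncn `|l|).+1 => //; apply/FE.
  by apply/ltW/truncnS_gt.
have pos (n : nat) l : F n l -> (0 <= (normc (zeta l) ^+ 2)%:E)%E.
  by move=> _; rewrite lee_fin sqr_ge0.
have := @ge0_nondecreasing_set_cvg_integral _ _ _ F
  (fun l => (normc (zeta l) ^+ 2)%:E) 'S_('Phi_psi f) ndF mF
  (fun n => measurable_funS measurableT (@subsetT _ _) mz2) pos.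
rewrite UF => cv; apply: (cvge_to_le cv).
apply: nearW => n; rewrite integral_mkcond.
pose zn l := zeta l * (\1_(F n) l : R)%:C.
have [M zM] := bz n.
have mzn : cmeasurable zn by apply: cmeasurableM => //; exact: cmeasurable_indic.
have bzn : bounded_borel zn.
  split => //; exists (Num.max 0 M) => l; rewrite /zn normcM normc_real indicE.
  have [/set_mem/FE/zM lM|_] := boolP (l \in F n).
    by rewrite normr1 mulr1 le_max lM orbT.
  by rewrite normr0 mulr0 le_max lexx.
rewrite (_ : integral _ _ _ =
    \int['S_('Phi_psi f)]_l (normc (zn l) ^+ 2)%:E)%E; last first.
  apply: eq_integral => l _; rewrite /zn patchE indicE normcM normc_real.
  by case: ifPn; rewrite ?normr1 ?normr0 ?mulr1 ?mulr0 ?expr0n.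
rewrite sqr_nrm2; last exact: L2_spectral_bounded.
rewrite -nrm2_spectral_integral// lee_fin lerXn2r ?nnegrE ?nrm2_ge0 ?mulr_ge0 ?nrm2_ge0//.
rewrite (eq_nrm2 _ _ (spectral_integralM E bzn bpsi lf)).
- apply: nrm2_spectral_integral_le => //; first by apply: cmeasurableM => //; case: bpsi.
  move=> l; rewrite /zn -mulrA mulrCA normcM normc_real indicE.
  apply: le_trans (bC l); rewrite ler_piMl//.
  by case: (_ \in _); rewrite ?normr1 ?normr0.
- exact: L2_spectral_integral.
- by apply: L2_spectral_integral => //; exact: bounded_borelM.
Qed.

(** Meant for theta = lambda^2 and psi = exp(-t lambda^2): it shows that the semigroup maps into the
    domain of L. The approximant of theta is a step function near theta on [-n, n] and near 0
    outside, where the decay of theta psi controls the error. *)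
Lemma spectral_integral_unbounded (theta : measurableTypeR R -> R[i]) psi f :
  L2 mu f -> bounded_borel psi -> (forall l, normc (psi l) <= 1) ->
  cmeasurable theta ->
  (forall n : nat, exists M : R, forall l, `|l| <= n%:R -> normc (theta l) <= M) ->
  bounded_borel (fun l => theta l * psi l) ->
  (forall k : R, 0 < k -> exists n : nat, forall l, n%:R < `|l| ->
     normc (theta l * psi l) <= k) ->
  is_spectral_integral E theta ('Phi_psi f) ('Phi_(fun l => theta l * psi l) f).
Proof.
move=> lf bpsi psi1 mth bth bthpsi dec.
have lF := L2_spectral_integral E lf bpsi; have lG := L2_spectral_integral E lf bthpsi.
split => // e e0.
pose m := Num.min 1 e; have m0 : 0 < m by rewrite lt_min ltr01.
(* The total error 2 k |f| is at most m / 2; as m <= 1, its square is below e as well, which the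
   spectral side asks for. *)
pose k := (m / (2 * (1 + nrm2 mu f))) / 2.
have nf := nrm2_ge0 mu f.
have den : 0 < 2 * (1 + nrm2 mu f) by rewrite mulr_gt0// ltr_pwDl.
have k0 : 0 < k by rewrite !divr_gt0.
have kf : 2 * k * nrm2 mu f <= m / 2.
  rewrite /k mulrCA divff ?mulr1; last by rewrite pnatr_eq0.
  by rewrite div_double_succ_le// ltW.
have [n nk] := dec k k0; have [M bM] := bth n.
pose F : borel := `[- n%:R, n%:R]%classic.
have FE l : F l <-> `|l| <= n%:R by rewrite /F /= in_itv /= ler_norml.
have mF : measurable F by exact: measurable_itv.
have bn : forall l, normc (theta l * (\1_F l : R)%:C) <= Num.max 0 M.
  move=> l; rewrite normcM normc_real indicE.
  have [/set_mem/FE/bM lM|_] := boolP (l \in F).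
    by rewrite normr1 mulr1 le_max lM orbT.
  by rewrite normr0 mulr0 le_max lexx.
have mn : cmeasurable (fun l => theta l * (\1_F l : R)%:C).
  by apply: cmeasurableM => //; exact: cmeasurable_indic.
have [I [c [A [mA sA]]]] := fstep_approx mn bn k0.
have bs := bounded_borel_fstep c mA.
(* On [-n, n] the step function is within k of theta and |psi| <= 1. Outside, theta psi and the step
   function are each at most k in modulus. *)
have zb l : normc ((theta l - fstep_fun c A l) * psi l) <= 2 * k.
  have := sA l; rewrite indicE; have [/set_mem/FE lM|] := boolP (l \in F).
    rewrite mulr1 normcM => h; rewrite (le_trans (ler_piMr _ (psi1 l)))//.
    by rewrite (le_trans h)// ler_peMl ?ltW// ltr1n.
  move=> /negP lF0; rewrite mulr0 sub0r normcN => h.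
  have ln : n%:R < `|l|.
    by rewrite ltNge; apply/negP => /FE lF1; apply: lF0; exact: mem_set.
  rewrite mulrBl (le_trans (le_normcB _ _))// [2 * k]mulr_natl mulr2n lerD ?nk//.
  by rewrite normcM (le_trans (ler_piMr _ (psi1 l))).
have [n' [c' [A' [mA' sf so]]]] := fstep_step E c mA.
exists n', c', A'; split => //.
  apply: (@le_lt_trans _ _ ((2 * k * nrm2 mu f) ^+ 2)%:E).
    rewrite (_ : (fun l => _) = (fun l => (normc (theta l - fstep_fun c A l) ^+ 2)%:E)).
      apply: integral_spectral_measure_le => //.
        by apply: cmeasurableB => //; exact: cmeasurable_fstep.
      move=> p; have [N bN] := bth p; have [_ [D bD]] := bs.
      exists (N + D) => l lp; rewrite (le_trans (le_normcB _ _))// lerD//.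
      exact: bN.
    by rewrite sf.
  rewrite lte_fin; apply: (@le_lt_trans _ _ ((m / 2) ^+ 2)).
    apply: lerXn2r => //; rewrite nnegrE; last by rewrite divr_ge0// ltW.
    by rewrite mulr_ge0// mulr_ge0// ltW.
  have m1 : m <= 1 by rewrite ge_min lexx.
  have me : m <= e by rewrite ge_min lexx orbT.
  apply: lt_le_trans me; clear -m0 m1; nra.
have lso := L2_fstep_op E c mA lF.
rewrite so /distL2 L2_fine ?lte_fin; last exact: (L2B lG lso).1.
rewrite (eq_nrm2 (g := 'Phi_(fun l => theta l * psi l - fstep_fun c A l * psi l) f)).
- apply: (@le_lt_trans _ _ (2 * k * nrm2 mu f)).
    apply: nrm2_spectral_integral_le => //.
      apply: cmeasurableB; first by case: bthpsi.
      by case: (bounded_borelM bs bpsi).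
    by move=> l; rewrite -mulrBl.
  apply: (le_lt_trans kf); apply: (@lt_le_trans _ _ m); last by rewrite ge_min lexx orbT.
  by rewrite ltr_pdivrMr// ltr_pMr// ltr1n.
- exact: (L2B lG lso).1.
- by apply: L2_spectral_integral => //; apply: bounded_borelB => //; exact: bounded_borelM.
- apply: eqL2_sym; apply: eqL2_trans (spectral_integralB E bthpsi (bounded_borelM bs bpsi) lf) _.
  apply: filterS2 (spectral_integralM E bs bpsi lf) (spectral_integral_fstep c mA lF).
  by move=> x -> ->.
Qed.

End SquareRootCalculus.

(** * Imaginary powers and the heat semigroup *)

Section ImaginaryPowers.
Context (R : realType) (d : measure_display) (T : measurableType d).
Variables (mu : {measure set T -> \bar R}) (E : pvm mu).
Implicit Types (f g h : T -> R[i]) (u v t l : R).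
Local Notation borel := (set (measurableTypeR R)).
Local Notation "''S_' f" := (spectral_measure E f) (at level 8, f at level 2).
Local Notation "''Phi_' phi" := (spectral_integral E phi) (at level 8, phi at level 2).

Definition power_symbol u : measurableTypeR R -> R[i] := fun l =>
  if 0 < l then cos (2 * u * ln l) +i* sin (2 * u * ln l) else 0.

Lemma normc_power_symbol u l : normc (power_symbol u l) <= 1.
Proof.
rewrite /power_symbol; case: ifP => _; last by rewrite normc0.
by rewrite /= cos2Dsin2 sqrtr1.
Qed.

Lemma measurable_gt0 : measurable_fun setT (fun l : measurableTypeR R => 0 < (l : R)).
Proof. by apply: measurable_fun_ltr; [exact: measurable_cst|exact: measurable_id]. Qed.

Lemma cmeasurable_power_symbol u : cmeasurable (power_symbol u).
Proof.
have mln : measurable_fun setT (fun l : measurableTypeR R => 2 * u * ln (l : R)).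
  by apply: measurable_funM; [exact: measurable_cst|exact: measurable_ln].
split.
  rewrite (_ : (fun l => _) = (fun l : measurableTypeR R =>
      if 0 < (l : R) then cos (2 * u * ln l) else 0)).
    apply: measurable_fun_ifT; [exact: measurable_gt0| |exact: measurable_cst].
    apply: measurableT_comp mln.
    by apply: continuous_measurable_fun; exact: continuous_cos.
  by apply/funext => l; rewrite /power_symbol; case: ifP.
rewrite (_ : (fun l => _) = (fun l : measurableTypeR R =>
    if 0 < (l : R) then sin (2 * u * ln l) else 0)).
  apply: measurable_fun_ifT; [exact: measurable_gt0| |exact: measurable_cst].
  apply: measurableT_comp mln.
  by apply: continuous_measurable_fun; exact: continuous_sin.
by apply/funext => l; rewrite /power_symbol; case: ifP.
Qed.

Lemma bounded_power_symbol u : bounded_borel (power_symbol u).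
Proof.
by split; [exact: cmeasurable_power_symbol|exists 1; exact: normc_power_symbol].
Qed.

Lemma power_symbolM u v l : power_symbol u l * power_symbol v l = power_symbol (u + v) l.
Proof.
rewrite /power_symbol; case: ifP => _; last by rewrite mulr0.
simpc; rewrite mulrDr mulrDl cosD sinD; congr (_ +i* _); ring.
Qed.

Lemma L2_imaginary_power u f : L2 mu f -> L2 mu (imaginary_power E u f).
Proof.
by move=> lf; apply: L2_spectral_integral => //; exact: bounded_power_symbol.
Qed.

Lemma imaginary_powerD u v f : L2 mu f ->
  eqL2 mu (imaginary_power E u (imaginary_power E v f)) (imaginary_power E (u + v) f).
Proof.
move=> lf; have := spectral_integralM E (bounded_power_symbol u) (bounded_power_symbol v) lf.
by rewrite (funext (power_symbolM u v)).
Qed.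

Lemma imaginary_power_lincomb u a f g : L2 mu f -> L2 mu g ->
  eqL2 mu (imaginary_power E u (lincomb a f g))
    (lincomb a (imaginary_power E u f) (imaginary_power E u g)).
Proof. by apply: spectral_integral_lincomb; exact: bounded_power_symbol. Qed.

(** The symbols converge pointwise and are bounded by 1. *)
Lemma imaginary_power_cvg (w : nat -> R) u f : L2 mu f -> w n @[n --> \oo] --> u ->
  nrm2 mu (fun x => imaginary_power E (w n) f x - imaginary_power E u f x)
    @[n --> \oo] --> 0.
Proof.
move=> lf wu; apply: (@spectral_integral_cvg _ _ _ _ _ (fun n => power_symbol (w n))
  (power_symbol u) f 1) => //.
- by move=> n; exact: cmeasurable_power_symbol.
- exact: cmeasurable_power_symbol.
- by move=> n l; exact: normc_power_symbol.
move=> l; rewrite /power_symbol; case: ifP => _; last first.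
  by under eq_fun do rewrite subrr normc0; exact: cvg_cst.
have arg : 2 * w n * ln l @[n --> \oo] --> 2 * u * ln l.
  by apply: cvgMl; exact: cvgMr.
have cc := cvg_comp _ _ arg (@continuous_cos R (2 * u * ln l)).
have cs := cvg_comp _ _ arg (@continuous_sin R (2 * u * ln l)).
pose a n := cos (2 * w n * ln l) - cos (2 * u * ln l).
pose b n := sin (2 * w n * ln l) - sin (2 * u * ln l).
have a0 : a n @[n --> \oo] --> 0.
  by rewrite -(subrr (cos (2 * u * ln l))); apply: cvgB => //; exact: cvg_cst.
have b0 : b n @[n --> \oo] --> 0.
  by rewrite -(subrr (sin (2 * u * ln l))); apply: cvgB => //; exact: cvg_cst.
have ab0 : a n * a n + b n * b n @[n --> \oo] --> 0.
  by rewrite [X in _ --> X](_ : _ = 0 * 0 + 0 * 0);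
    [apply: cvgD; exact: cvgM|rewrite mulr0 addr0].
have := cvg_comp _ _ ab0 (@sqrt_continuous R 0); rewrite sqrtr0.
by apply: cvg_trans; apply: near_eq_cvg; apply: nearW => n; rewrite /= -!expr2.
Qed.

End ImaginaryPowers.

(** * The identity L^{i0} = 1 and the family t L exp(-tL) *)

Section HeatSemigroup.
Context (R : realType) (d : measure_display) (T : measurableType d).
Variables (mu : {measure set T -> \bar R}) (L : unbounded_op mu) (E : pvm mu).
Hypothesis hE : sqrt_spectral_measure L E.
Implicit Types (f g h : T -> R[i]) (u v t l : R).
Local Notation borel := (set (measurableTypeR R)).
Local Notation "''S_' f" := (spectral_measure E f) (at level 8, f at level 2).
Local Notation "''Phi_' phi" := (spectral_integral E phi) (at level 8, phi at level 2).

(** The symbol at u = 0 is the indicator of the positive half-line, not 1. The difference is E of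
    the complementary half-line, whose negative part vanishes by the choice of E and whose part at 0
    vanishes by injectivity. *)
Lemma imaginary_power0 f : injective_op L -> L2 mu f ->
  eqL2 mu (imaginary_power E 0 f) f.
Proof.
move=> L_inj lf.
pose neg : borel := [set l | (l : R) < 0]; pose z : borel := [set 0].
have mneg : measurable neg.
  by rewrite /neg (_ : [set l : R | l < 0] = `]-oo, 0[%classic)//; apply/seteqP; split => l;
    rewrite /= in_itv.
have mz : measurable z by exact: measurable_set1.
(* The range of E({0}) lies in the kernel of L. *)
have Ez g : L2 mu g -> eqL2 mu (E z g) (fun=> 0).
  move=> lg; have lk := proj_L2 E mz lg.
  suff [dk Lk] : dom L (E z g) /\ eqL2 mu (L (E z g)) (fun=> 0) by exact: L_inj.
  apply: (hE.2 _ _ lk (L2_0 mu)).1; split => //; first exact: L2_0.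
  (* The empty step function is an exact approximant: the spectral measure of E({0}) g lives on {0},
     where lambda^2 vanishes. *)
  move=> e e0; exists 0%N, (fun=> 0), (fun=> set0); split; first by case.
    rewrite (_ : integral _ _ _ = 0%E) ?lte_fin//.
    rewrite -[RHS](integral0 'S_(E z g) setT); apply: ae_eq_integral => //.
      apply/measurable_EFinP/measurable_sqr_normc/cmeasurableB.
        by apply: cmeasurable_real; exact: exprn_measurable.
      by apply: (@cmeasurable_fstep _ _ (fun=> 0) (fun=> set0)) => -[].
    exists (~` z); split.
    - exact: measurableC.
    - rewrite [LHS](spectral_measureE E lk (measurableC mz)).
      rewrite (eq_nrm2 _ (L2_0 mu)) ?nrm2_0 ?expr0n//.
        by apply: proj_L2 => //; exact: measurableC.
      apply: eqL2_trans (eqL2_sym (projI E (measurableC mz) mz lg)) _.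
      by rewrite setICl; exact: proj0.
    - move=> l /=; apply: contra_not => lz _; rewrite /step_fun big_ord0 lz.
      by rewrite expr0n subr0 normc0 expr0n.
  rewrite /distL2 (L2_fine (L2B (L2_0 mu) _).1) ?lte_fin; last first.
    by rewrite /step_op; under eq_fun do rewrite big_ord0; exact: L2_0.
  rewrite (_ : (fun x => _) = (fun=> 0)) ?nrm2_0//.
  by apply/funext => x; rewrite /step_op big_ord0 subr0.
have b1 := bounded_borel_cst (1 : R[i]); have b0 := @bounded_power_symbol R 0.
pose A := neg `|` z.
have mA : measurable A by exact: measurableU.
have EA : eqL2 mu (E A f) (fun=> 0).
  apply: nrm2_eq0; first exact: proj_L2.
  apply/eqP; rewrite -sqrf_eq0; apply/eqP/EFin_inj.
  rewrite -spectral_measureE// [LHS](@measureU _ _ _ 'S_f neg z)//.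
    rewrite [X in (X + _)%E](spectral_measureE E lf mneg).
    rewrite [X in (_ + X)%E](spectral_measureE E lf mz).
    rewrite (eq_nrm2 (proj_L2 E mneg lf) (L2_0 mu) (hE.1 f lf)).
    rewrite (eq_nrm2 (proj_L2 E mz lf) (L2_0 mu) (Ez f lf)).
    by rewrite nrm2_0 expr0n/= adde0.
  by apply/seteqP; split => // l [/= h0 h1]; move: h0; rewrite /neg h1 /= ltxx.
have e1 := spectral_integralB E b1 b0 lf.
have e2 := spectral_integral_indic E lf mA.
have e3 := spectral_integral_cst E 1 lf.
rewrite (_ : (fun l => 1 - power_symbol 0 l) = (fun l => (\1_A l : R)%:C)) in e1.
  have h : eqL2 mu (fun x => 'Phi_(fun=> 1) f x - 'Phi_(power_symbol 0) f x) (fun=> 0).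
    by apply: eqL2_trans (eqL2_sym e1) _; exact: eqL2_trans e2 EA.
  by apply: filterS2 h e3 => x /eqP; rewrite subr_eq0 mul1r => /eqP ->.
apply/funext => l; rewrite /power_symbol indicE.
have [l0|l0] := ltP 0 l.
  rewrite memNset; first by rewrite mulr0 mul0r cos0 sin0 subrr.
  move=> [|] /=; rewrite /neg/z/=.
    by rewrite ltNge (ltW l0).
  by move=> e; rewrite e ltxx in l0.
rewrite mem_set ?subr0//; move: l0; rewrite le_eqVlt => /orP[/eqP->|l0].
  by right.
by left.
Qed.

(** The symbol of t L exp(-tL), in the spectral variable of the square root of L. *)
Definition heat_symbol t : measurableTypeR R -> R[i] :=
  fun l => (t * (l : R) ^+ 2 * expR (- (t * l ^+ 2)))%:C.

Let exp_symbol t : measurableTypeR R -> R[i] := fun l => (expR (- (t * l ^+ 2)))%:C.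

(** Squaring e^{x/2} >= x/2. It yields lambda^2 exp(-t lambda^2) <= 4 / (t^2 lambda^2), the decay
    required by [spectral_integral_unbounded]. *)
Lemma expR_ge_sqr (x : R) : 0 <= x -> x ^+ 2 / 4 <= expR x.
Proof.
move=> x0; have h : x / 2 <= expR (x / 2).
  by rewrite (le_trans _ (expR_ge1Dx _))// lerDr.
rewrite [leRHS](_ : _ = expR (x / 2) ^+ 2); last first.
  by rewrite -expRM_natl mulrC divfK ?pnatr_eq0.
rewrite [leLHS](_ : _ = (x / 2) ^+ 2); last by field.
by rewrite lerXn2r ?nnegrE ?divr_ge0 ?expR_ge0.
Qed.

Lemma mul_expRN_le1 (x : R) : 0 <= x -> 0 <= x * expR (- x) <= 1.
Proof.
move=> x0; rewrite mulr_ge0 ?expR_ge0//= expRN ler_pdivrMr ?expR_gt0// mul1r.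
by rewrite (le_trans _ (expR_ge1Dx _))// lerDr.
Qed.

Lemma normc_heat_symbol t l : 0 <= t -> normc (heat_symbol t l) <= 1.
Proof.
move=> t0; rewrite normc_real.
have /mul_expRN_le1/andP[h1 h2] : 0 <= t * l ^+ 2 by rewrite mulr_ge0// sqr_ge0.
by rewrite ger0_norm.
Qed.

Let cmeasurable_exp_symbol t : cmeasurable (exp_symbol t).
Proof.
apply: cmeasurable_real; apply: measurableT_comp => //.
apply: measurableT_comp => //.
by apply: measurable_funM; [exact: measurable_cst|exact: exprn_measurable].
Qed.

Let cmeasurable_sqr : cmeasurable (fun l : measurableTypeR R => ((l : R) ^+ 2)%:C).
Proof. by apply: cmeasurable_real; exact: exprn_measurable. Qed.

Lemma cmeasurable_heat_symbol t : cmeasurable (heat_symbol t).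
Proof.
rewrite (_ : heat_symbol t = (fun l => t%:C * ((l ^+ 2)%:C * exp_symbol t l))).
  apply: cmeasurableM; first exact: cmeasurable_cst.
  exact: cmeasurableM.
by apply/funext => l; rewrite /heat_symbol /exp_symbol -!rmorphM mulrA.
Qed.

Lemma bounded_heat_symbol t : 0 <= t -> bounded_borel (heat_symbol t).
Proof.
move=> t0; split; first exact: cmeasurable_heat_symbol.
by exists 1 => l; exact: normc_heat_symbol.
Qed.

Lemma semigroup_L f t : L2 mu f -> 0 < t ->
  dom L (semigroup E t f) /\
  eqL2 mu (fun x => t%:C * L (semigroup E t f) x) ('Phi_(heat_symbol t) f).
Proof.
move=> lf t0.
have n1 l : normc (exp_symbol t l) <= 1.
  rewrite normc_real ger0_norm ?expR_ge0// -expR0 ler_expR oppr_le0.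
  by rewrite mulr_ge0 ?sqr_ge0// ltW.
have be : bounded_borel (exp_symbol t) by split; [|exists 1].
pose th : measurableTypeR R -> R[i] := fun l => ((l : R) ^+ 2)%:C.
have hs l : heat_symbol t l = t%:C * (th l * exp_symbol t l).
  by rewrite /heat_symbol /th /exp_symbol -!rmorphM mulrA.
have nth l : normc (th l * exp_symbol t l) = t^-1 * normc (heat_symbol t l).
  by rewrite hs [normc (t%:C * _)]normcM normc_real gtr0_norm// mulKf// gt_eqF.
have bth : bounded_borel (fun l => th l * exp_symbol t l).
  split; first exact: cmeasurableM.
  exists t^-1 => l; rewrite nth ler_piMr ?invr_ge0 ?(ltW t0)//.
  by apply: normc_heat_symbol; exact: ltW.
have SI : is_spectral_integral E th ('Phi_(exp_symbol t) f)
    ('Phi_(fun l => th l * exp_symbol t l) f).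
  apply: spectral_integral_unbounded => //.
    move=> n; exists (n%:R ^+ 2) => l ln; rewrite normc_real normrX.
    by rewrite lerXn2r ?nnegrE.
  move=> k k0; pose N := 4 / (t ^+ 2 * k).
  have N0 : 0 < N by rewrite divr_gt0// mulr_gt0// exprn_gt0.
  (* The successor forces |l| >= 1 besides |l| > N, so that l^2 > N, which is the bound 4 / (t^2
     l^2) < k. *)
  exists (Num.truncn N).+1 => l ln.
  have Nl : N < l ^+ 2.
    rewrite -[l ^+ 2]ger0_norm ?sqr_ge0// normrX.
    have h1 : 1 <= `|l| by rewrite (le_trans _ (ltW ln))// ler1n.
    have h2 : N < `|l| := lt_trans (truncnS_gt N) ln.
    by rewrite (lt_le_trans h2)// expr2 ler_peMl// (le_trans ler01).
  rewrite nth normc_real ger0_norm; last first.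
    by rewrite mulr_ge0 ?expR_ge0// mulr_ge0 ?sqr_ge0// ltW.
  have x0 : 0 < t * l ^+ 2 by rewrite mulr_gt0// (lt_trans N0).
  rewrite -mulrA mulKf ?gt_eqF// expRN.
  apply: (@le_trans _ _ (l ^+ 2 / ((t * l ^+ 2) ^+ 2 / 4))).
    rewrite ler_wpM2l ?sqr_ge0// lef_pV2 ?posrE ?expR_gt0 ?divr_gt0 ?exprn_gt0//.
    by apply: expR_ge_sqr; exact: ltW.
  have l20 : 0 < l ^+ 2 := lt_trans N0 Nl.
  have l00 : l != 0 by rewrite -sqrf_eq0 gt_eqF.
  rewrite (_ : _ / _ = 4 / t ^+ 2 / l ^+ 2); last first.
    by field; rewrite l00 gt_eqF.
  rewrite ler_pdivrMr// -ler_pdivrMl// (_ : k^-1 * _ = N); first exact: ltW.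
  by rewrite /N; field; rewrite !gt_eqF.
have lS := L2_spectral_integral E lf be; have lTh := L2_spectral_integral E lf bth.
have [dS LS] := (hE.2 _ _ lS lTh).1 SI.
split => //.
have := spectral_integralZ E t%:C bth lf.
rewrite (_ : (fun l => t%:C * _) = heat_symbol t); last by apply/funext => l; rewrite hs.
by move=> e; apply: filterS2 LS e => x -> ->.
Qed.

Definition heat t f : T -> R[i] := fun x => (t ^+ 2)%:C * L (semigroup E (t ^+ 2) f) x.

Lemma heatE t f : L2 mu f -> 0 < t -> eqL2 mu (heat t f) ('Phi_(heat_symbol (t ^+ 2)) f).
Proof. by move=> lf t0; apply: (semigroup_L lf _).2; rewrite exprn_gt0. Qed.

Lemma L2_heat t f : L2 mu f -> 0 < t -> L2 mu (heat t f).
Proof.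
move=> lf t0; apply: (L2Z _ _).1; apply: op_L2.
by apply: (semigroup_L lf _).1; rewrite exprn_gt0.
Qed.

Lemma nrm2_heat t f : L2 mu f -> 0 < t -> nrm2 mu (heat t f) <= nrm2 mu f.
Proof.
move=> lf t0; have t20 : 0 <= t ^+ 2 by rewrite sqr_ge0.
rewrite (eq_nrm2 (L2_heat lf t0) _ (heatE lf t0)); last first.
  by apply: L2_spectral_integral => //; exact: bounded_heat_symbol.
rewrite -[leRHS]mul1r; apply: nrm2_spectral_integral_le => //.
  exact: cmeasurable_heat_symbol.
by move=> l; exact: normc_heat_symbol.
Qed.

Lemma heat_lincomb t a f g : L2 mu f -> L2 mu g -> 0 < t ->
  eqL2 mu (heat t (lincomb a f g)) (lincomb a (heat t f) (heat t g)).
Proof.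
move=> lf lg t0; have b := bounded_heat_symbol (sqr_ge0 t).
have e := spectral_integral_lincomb E a b lf lg.
have e0 := heatE (L2_lincomb a lf lg) t0.
have e1 := heatE lf t0; have e2 := heatE lg t0.
apply: eqL2_trans e0 _; apply: eqL2_trans e _.
by apply: filterS2 e1 e2 => x; rewrite /lincomb => -> ->.
Qed.

Lemma heat_ae t f g : L2 mu f -> L2 mu g -> 0 < t -> eqL2 mu f g ->
  eqL2 mu (heat t f) (heat t g).
Proof.
move=> lf lg t0 fg; have b := bounded_heat_symbol (sqr_ge0 t).
apply: eqL2_trans (heatE lf t0) _.
by apply: eqL2_trans (spectral_integral_ae E b lf lg fg) (eqL2_sym (heatE lg t0)).
Qed.

(** Continuity in t is what permits the rounding of t in [measurable_cone_energy]. *)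
Lemma heat_cvg (s : nat -> R) t f : L2 mu f -> (forall n, 0 < s n) -> 0 < t ->
  s n @[n --> \oo] --> t ->
  nrm2 mu (fun x => heat (s n) f x - heat t f x) @[n --> \oo] --> 0.
Proof.
move=> lf s0 t0 st.
have eqn n : nrm2 mu (fun x => heat (s n) f x - heat t f x) =
    nrm2 mu (fun x => 'Phi_(heat_symbol (s n ^+ 2)) f x - 'Phi_(heat_symbol (t ^+ 2)) f x).
  apply: eq_nrm2.
  - exact: (L2B (L2_heat lf (s0 n)) (L2_heat lf t0)).1.
  - by apply: (L2B _ _).1; apply: L2_spectral_integral => //;
      apply: bounded_heat_symbol; exact: sqr_ge0.
  - by apply: filterS2 (heatE lf (s0 n)) (heatE lf t0) => x -> ->.
under eq_fun do rewrite eqn.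
apply: (@spectral_integral_cvg _ _ _ _ _ (fun n => heat_symbol (s n ^+ 2))
  (heat_symbol (t ^+ 2)) f 1) => //.
- by move=> n; exact: cmeasurable_heat_symbol.
- exact: cmeasurable_heat_symbol.
- by move=> n l; apply: normc_heat_symbol; exact: sqr_ge0.
move=> l; rewrite /heat_symbol; under eq_fun do rewrite -rmorphB normc_real.
have s2 : s n ^+ 2 @[n --> \oo] --> t ^+ 2.
  by rewrite expr2; under eq_fun do rewrite expr2; exact: cvgM.
have sl : s n ^+ 2 * l ^+ 2 @[n --> \oo] --> t ^+ 2 * l ^+ 2.
  by apply: cvgM => //; exact: cvg_cst.
have se : expR (- (s n ^+ 2 * l ^+ 2)) @[n --> \oo] --> expR (- (t ^+ 2 * l ^+ 2)).
  exact: (cvg_comp _ _ (cvgN sl) (@continuous_expR R _)).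
have sle : s n ^+ 2 * l ^+ 2 * expR (- (s n ^+ 2 * l ^+ 2)) @[n --> \oo] -->
    t ^+ 2 * l ^+ 2 * expR (- (t ^+ 2 * l ^+ 2)) by exact: cvgM.
move/cvgrPdist_le : sle => H; apply/cvgrPdist_le => e e0.
by apply: filterS (H _ e0) => n; rewrite sub0r normrN normr_id distrC.
Qed.

End HeatSemigroup.

(** * Measurability of the cone integrals *)

Section ProductMeasurability.
Context (R : realType) (d : measure_display) (T : measurableType d).

Lemma emeasurable_fun_gt (f : T -> \bar R) :
  (forall a : R, measurable [set x | (a%:E < f x)%E]) -> measurable_fun setT f.
Proof.
move=> H; apply: (measurability _ (ErealGenOInfty.measurableE R)).
move=> _ [_ [a ->] <-]; rewrite setTI.
rewrite (_ : _ @^-1` _ = [set x | (a%:E < f x)%E])//.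
by apply/seteqP; split => x /=; rewrite in_itv/= andbT.
Qed.

(** A fibre is a difference of two sets n t < j; the one over 0 is treated apart because it also
    contains all t with n t < 0. *)
Lemma measurable_truncn_fiber (n k : nat) :
  measurable [set t : measurableTypeR R | Num.truncn (n%:R * (t : R)) = k].
Proof.
have mle j : measurable [set t : measurableTypeR R | n%:R * (t : R) < j.+1%:R].
  have mf : measurable_fun setT (fun t : measurableTypeR R => n%:R * (t : R)).
    by apply: measurable_funM; [exact: measurable_cst|exact: measurable_id].
  rewrite (_ : [set t | _] = (fun t : measurableTypeR R => n%:R * (t : R)) @^-1`
    `]-oo, j.+1%:R[%classic); last by apply/seteqP; split => t /=; rewrite in_itv.
  by rewrite -[X in measurable X]setTI; exact: mf.
case: k => [|k].
  rewrite (_ : [set t | _] = [set t : measurableTypeR R | n%:R * (t : R) < 1%:R])//.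
  by apply/seteqP; split => t /=; rewrite -truncn_le_nat leqn0 => /eqP.
rewrite (_ : [set t | _] = [set t : measurableTypeR R | n%:R * (t : R) < k.+2%:R] `\`
  [set t : measurableTypeR R | n%:R * (t : R) < k.+1%:R]); first exact: measurableD.
apply/seteqP; split => t /=; rewrite -!truncn_le_nat.
  by move=> ->; rewrite leqnn ltnn.
by move=> [h1 /negP]; rewrite -ltnNge => h2; apply/eqP; rewrite eqn_leq h1 h2.
Qed.

Lemma measurable_fun_discretize (F : nat -> T -> \bar R) (n : nat) :
  (forall k, measurable_fun setT (F k)) ->
  measurable_fun setT (fun z : T * measurableTypeR R =>
    F (Num.truncn (n%:R * (z.2 : R))) z.1).
Proof.
move=> mF _ Y mY; rewrite setTI.
rewrite (_ : _ @^-1` _ = \bigcup_k ((F k @^-1` Y) `*`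
  [set t : measurableTypeR R | Num.truncn (n%:R * (t : R)) = k])); last first.
  apply/seteqP; split => [[x t] /= FY|[x t] [k _ [/= FY tk]]]; last by rewrite tk.
  by exists (Num.truncn (n%:R * t)).
apply: bigcupT_measurable => k; apply: measurableX.
  by rewrite -[X in measurable X]setTI; exact: mF.
exact: measurable_truncn_fiber.
Qed.

End ProductMeasurability.

Section BallMeasurability.
Context (R : realType) (d : measure_display) (T : metricMeasurableType R d).
Variable mu : {measure set T -> \bar R}.
Hypothesis borelT : (measurable : set (set T)) = <<s (open : set (set T)) >>.

Let open_measurableT (A : set T) : open A -> measurable A.
Proof. by move=> oA; rewrite borelT; exact: sub_sigma_algebra. Qed.

Let openT (A : set T) :
  (forall x, A x -> exists2 e : R, 0 < e & forall y, mdist x y < e -> A y) -> open A.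
Proof.
move=> H; rewrite openE => x /H[e e0 eA].
by apply/nbhs_ballP; exists e => //= y; rewrite ballEmdist; exact: eA.
Qed.

Lemma measurable_metric_ball (x : T) (t : R) : measurable (ball x t).
Proof.
apply: open_measurableT; apply: openT => y; rewrite ballEmdist /= => xy.
exists (t - mdist x y); first by rewrite subr_gt0.
by move=> z yz; have := metric_triangle x y z; lra.
Qed.

Lemma measurable_cone_section (x : T) (t : R) : measurable (cone_section x t).
Proof.
rewrite -[cone_section _ _]setCK; apply: measurableC; apply: open_measurableT.
apply: openT => y /= /negP; rewrite -ltNge => xy.
exists (mdist x y - t); first by rewrite subr_gt0.
move=> z yz; apply/negP; rewrite -ltNge.
by have := metric_triangle x z y; rewrite (metric_sym z y); lra.
Qed.

Variable w : T -> \bar R.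
Hypotheses (w0 : forall x, (0 <= w x)%E) (mw : measurable_fun setT w).

Let J (x : T) (t : R) : \bar R := (\int[mu]_(y in ball x t) w y)%E.

Let le_J (x y : T) (s t : R) : ball x s `<=` ball y t -> (J x s <= J y t)%E.
Proof.
move=> st; apply: ge0_subset_integral => //; try exact: measurable_metric_ball.
exact: measurable_funTS.
Qed.

(** An open ball is the increasing union of the smaller concentric ones, so J x is continuous from
    the left by monotone convergence. *)
Let J_lt (x : T) (t : R) (a : \bar R) : (a < J x t)%E -> exists n, (a < J x (t - n.+1%:R^-1))%E.
Proof.
move=> aJ; apply: contrapT => H.
have {}H n : (J x (t - n.+1%:R^-1) <= a)%E.
  by rewrite leNgt; apply/negP => h; apply: H; exists n.
pose F (n : nat) : set T := ball x (t - n.+1%:R^-1).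
have ndF : {homo F : n m / (n <= m)%N >-> (n <= m)%O}.
  move=> n m nm; apply/subsetPset => y; rewrite /F !ballEmdist /= => xy.
  by rewrite (lt_le_trans xy)// lerB// lef_pV2 ?posrE// ler_nat.
have UF : \bigcup_n F n = ball x t.
  apply/seteqP; split => [y [n _]|y]; rewrite ?/F !ballEmdist /= => xy.
    by rewrite (lt_trans xy)// ltrBlDr ltrDl invr_gt0.
  have h0 : 0 < t - mdist x y by rewrite subr_gt0.
  exists (Num.truncn (t - mdist x y)^-1) => //; rewrite /F ballEmdist /= ltrBrDr -ltrBrDl.
  by rewrite invf_plt ?posrE// truncnS_gt.
have := @ge0_nondecreasing_set_cvg_integral _ _ _ F w mu ndF
  (fun n => measurable_metric_ball _ _) (fun n => measurable_funTS mw) (fun n y _ => w0 y).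
rewrite UF => cv; have : (J x t <= a)%E by apply: (cvge_to_le cv); exact: nearW.
by rewrite leNgt aJ.
Qed.

(** By left-continuity a strict lower bound for J survives a small decrease of the radius. This
    leaves room to move the centre, so superlevel sets at fixed radius are open, and room for a
    rational radius, so the superlevel set in (x, t) is a countable union of measurable
    rectangles. *)
Lemma measurable_ball_integral :
  measurable_fun setT (fun z : T * measurableTypeR R => J z.1 z.2).
Proof.
apply: emeasurable_fun_gt => a.
have mJ (r : R) : measurable [set x | (a%:E < J x r)%E].
  apply: open_measurableT; apply: openT => x /= /J_lt[n an].
  exists n.+1%:R^-1; first by rewrite invr_gt0.
  move=> y xy; apply: (lt_le_trans an); apply: le_J => z; rewrite !ballEmdist /= => xz.
  rewrite (le_lt_trans (metric_triangle y x z))// (metric_sym y x).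
  by have := ltrD xy xz; rewrite [ltRHS]addrC subrK.
rewrite (_ : [set z | _] = \bigcup_(q : rat) ([set x | (a%:E < J x (ratr q))%E] `*`
   [set t : measurableTypeR R | ratr q < (t : R)])).
  apply: bigcupT_measurable_rat => q; apply: measurableX => //.
  rewrite (_ : [set t | _] = `]ratr q, +oo[%classic)//.
  by apply/seteqP; split => t /=; rewrite in_itv/= andbT.
apply/seteqP; split => [[x t] /= /J_lt[n an]|[x t] [q _ [/= aq qt]]].
  have /rat_in_itvoo[q] : t - n.+1%:R^-1 < t by rewrite ltrBlDr ltrDl invr_gt0.
  rewrite in_itv /= => /andP[q1 q2]; exists q => //; split => //=.
  apply: (lt_le_trans an); apply: le_J => y; rewrite !ballEmdist /= => xy.
  exact: lt_trans q1.
apply: (lt_le_trans aq); apply: le_J => y; rewrite !ballEmdist /= => xy.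
exact: lt_trans qt.
Qed.

End BallMeasurability.

Section Restriction.
Context (R : realType) (d : measure_display) (T : measurableType d).
Variable mu : {measure set T -> \bar R}.
Implicit Types (f g : T -> R[i]) (A : set T).

(** Multiplying by the indicator makes integrals over balls and cone sections into norms on all of
    T, to which the triangle inequality applies. *)
Definition restr A g : T -> R[i] := fun y => (\1_A y : R)%:C * g y.

Lemma normc_restr A g y : normc (restr A g y) <= normc (g y).
Proof.
rewrite /restr normcM normc_real indicE ler_piMl//.
by case: (_ \in _); rewrite ?normr1 ?normr0.
Qed.

Lemma L2_restr A g : measurable A -> L2 mu g ->
  L2 mu (restr A g) /\ nrm2 mu (restr A g) <= nrm2 mu g.
Proof.
move=> mA lg; apply: L2_le => // [|y]; last exact: normc_restr.
apply: cmeasurableM; last by case: lg.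
by apply: cmeasurable_real; exact: measurable_indic.
Qed.

Lemma integral_sqr_restr A g : measurable A -> L2 mu g ->
  (\int[mu]_(y in A) (normc (g y) ^+ 2)%:E = (nrm2 mu (restr A g) ^+ 2)%:E)%E.
Proof.
move=> mA lg; rewrite -sqr_nrm2; last exact: (L2_restr mA lg).1.
rewrite integral_mkcond; apply: eq_integral => y _.
rewrite patchE /restr normcM normc_real indicE.
by case: ifPn; rewrite ?normr1 ?normr0 ?mul1r ?mul0r ?expr0n.
Qed.

End Restriction.

(** * The inner integral of the square function as a measurable density in (x, t) *)

Section ConeDensity.
Context (R : realType) (d : measure_display) (T : metricMeasurableType R d).
Variable mu : {measure set T -> \bar R}.
Hypothesis hT : homogeneous_type mu.
Variables (L : unbounded_op mu) (E : pvm mu).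
Hypothesis hE : sqrt_spectral_measure L E.
Implicit Types (f g : T -> R[i]) (z : T * measurableTypeR R).

Let borelT : (measurable : set (set T)) = <<s (open : set (set T)) >>.
Proof. by case: hT. Qed.

(** The integrand splits into this factor and [cone_weight], which depends neither on f nor on y;
    dependence on f thus reduces to L^2 estimates. *)
Definition cone_energy f z : \bar R :=
  if 0 < (z.2 : R)
  then (\int[mu]_(y in cone_section z.1 z.2) (normc (heat L E z.2 f y) ^+ 2)%:E)%E
  else 0%E.

Definition cone_weight z : R :=
  if 0 < (z.2 : R) then (fine (mu (ball z.1 z.2)))^-1 / z.2 else 0.

(* The inner integral of the square function, extended by 0 to t <= 0. *)
Definition cone_density f z : \bar R := (cone_energy f z * (cone_weight z)%:E)%E.

Lemma cone_energyE f z : L2 mu f -> 0 < (z.2 : R) -> cone_energy f z =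
  (nrm2 mu (restr (cone_section z.1 z.2) (heat L E z.2 f)) ^+ 2)%:E.
Proof.
move=> lf z0; rewrite /cone_energy z0 integral_sqr_restr//.
  exact: measurable_cone_section.
exact: L2_heat.
Qed.

Lemma cone_energy_ge0 f z : (0 <= cone_energy f z)%E.
Proof.
rewrite /cone_energy; case: ifP => // _.
by apply: integral_ge0 => y _; rewrite lee_fin sqr_ge0.
Qed.

Lemma cone_weight_ge0 z : 0 <= cone_weight z.
Proof.
by rewrite /cone_weight; case: ifP => // z0; rewrite mulr_ge0// invr_ge0 ?fine_ge0// ltW.
Qed.

Lemma cone_density_ge0 f z : (0 <= cone_density f z)%E.
Proof. by rewrite mule_ge0 ?cone_energy_ge0// lee_fin cone_weight_ge0. Qed.

Lemma cone_energy_le f z : L2 mu f -> (cone_energy f z <= (nrm2 mu f ^+ 2)%:E)%E.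
Proof.
move=> lf; have [z0|z0] := ltP 0 (z.2 : R); last first.
  by rewrite /cone_energy ltNge z0/= lee_fin sqr_ge0.
rewrite cone_energyE// lee_fin lerXn2r ?nnegrE ?nrm2_ge0//.
apply: le_trans (nrm2_heat hE lf z0); apply: (L2_restr _ _).2; last exact: L2_heat.
exact: measurable_cone_section.
Qed.

Lemma cone_energy_ae f g z : L2 mu f -> L2 mu g -> eqL2 mu f g ->
  cone_energy f z = cone_energy g z.
Proof.
move=> lf lg fg; have [z0|z0] := ltP 0 (z.2 : R); last first.
  by rewrite /cone_energy ltNge z0 /=.
have mC := measurable_cone_section borelT z.1 z.2.
rewrite !cone_energyE//; congr ((_ ^+ _)%:E); apply: eq_nrm2.
- by apply: (L2_restr _ _).1 => //; exact: L2_heat.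
- by apply: (L2_restr _ _).1 => //; exact: L2_heat.
- by apply: filterS (heat_ae hE lf lg z0 fg) => y; rewrite /restr => ->.
Qed.

(** The triangle inequality squared, with (b + c)^2 <= 2 b^2 + 2 c^2. All later factors 2 in the
    Hardy norm go back to this. *)
Lemma cone_energyB f g z : L2 mu f -> L2 mu g ->
  (cone_energy (fun x => f x - g x)%R z <=
   2%:E * cone_energy f z + 2%:E * cone_energy g z)%E.
Proof.
move=> lf lg; have [z0|z0] := ltP 0 (z.2 : R); last first.
  by rewrite /cone_energy ltNge z0/= mule0 adde0.
have mC := measurable_cone_section borelT z.1 z.2.
have lfg := (L2B lf lg).1.
have lHf := L2_heat hE lf z0; have lHg := L2_heat hE lg z0.
have lrf := (L2_restr mC lHf).1; have lrg := (L2_restr mC lHg).1.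
have lH := L2_heat hE lfg z0.
rewrite !cone_energyE// -!EFinM -EFinD lee_fin.
rewrite (eq_nrm2 (g := fun y => restr (cone_section z.1 z.2) (heat L E z.2 f) y -
   restr (cone_section z.1 z.2) (heat L E z.2 g) y)).
- have := (L2B lrf lrg).2; have := nrm2_ge0 mu (fun y =>
    restr (cone_section z.1 z.2) (heat L E z.2 f) y -
    restr (cone_section z.1 z.2) (heat L E z.2 g) y).
  move: (nrm2 _ _) (nrm2 _ _) (nrm2 _ _) => c b a a0 abc.
  have bc0 : 0 <= b + c := le_trans a0 abc.
  apply: (@le_trans _ _ ((b + c) ^+ 2)); first by rewrite lerXn2r ?nnegrE.
  rewrite -subr_ge0 (_ : _ - _ = (b - c) ^+ 2); last by ring.
  exact: sqr_ge0.
- exact: (L2_restr mC lH).1.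
- exact: (L2B lrf lrg).1.
- have := heat_lincomb hE (-1) lg lf z0.
  rewrite (_ : lincomb (-1) g f = (fun x => f x - g x)); last first.
    by apply/funext => x; rewrite /lincomb mulN1r addrC.
  by apply: filterS => y; rewrite /restr => ->; rewrite /lincomb; ring.
Qed.

(* Rounding t up to a multiple of 1/(n+1) reduces joint measurability to
   measurability in x for each fixed t. *)
Lemma measurable_cone_energy f : L2 mu f -> measurable_fun setT (cone_energy f).
Proof.
move=> lf.
pose s n k : R := k.+1%:R / n.+1%:R.
have s0 n k : 0 < s n k by rewrite divr_gt0.
pose G n k x := (\int[mu]_(y in ball x (s n k)) (normc (heat L E (s n k) f y) ^+ 2)%:E)%E.
have mG n k : measurable_fun setT (G n k).
  have mw : measurable_fun setT (fun y => (normc (heat L E (s n k) f y) ^+ 2)%:E).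
    by apply/measurable_EFinP/measurable_sqr_normc; case: (L2_heat hE lf (s0 n k)).
  have w0 y : (0 <= (normc (heat L E (s n k) f y) ^+ 2)%:E)%E.
    by rewrite lee_fin sqr_ge0.
  have := measurable_ball_integral mu borelT w0 mw.
  by move=> /measurableT_comp /(_ (pair2_measurable (s n k : measurableTypeR R))).
pose K n z := if 0 < (z.2 : R) then G n (Num.truncn (n.+1%:R * (z.2 : R))) z.1 else 0%E.
have mpos : measurable_fun setT (fun z : T * measurableTypeR R => 0 < (z.2 : R)).
  by apply: measurableT_comp (@measurable_gt0 R) _; exact: measurable_snd.
have mK n : measurable_fun setT (K n).
  apply: measurable_fun_ifT => //.
  exact: (measurable_fun_discretize n.+1 (mG n)).
apply: (emeasurable_fun_cvg K _ mK) => -[x t] _; rewrite /K /=.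
have [t0|t0] := ltP 0 (t : R); last first.
  by rewrite /cone_energy /= ltNge t0; exact: cvg_cst.
(* Rounding strictly upwards makes the open balls of radius r n contain the closed section at t, to
   which they shrink as r n tends to t. *)
pose r n := s n (Num.truncn (n.+1%:R * (t : R))).
have r0 n : 0 < r n by exact: s0.
have tr n : t < r n.
  by rewrite /r /s ltr_pdivlMr// mulrC; exact: truncnS_gt.
have rt n : r n <= t + n.+1%:R^-1.
  rewrite /r /s ler_pdivrMr// mulrDl mulVf ?pnatr_eq0// -[leLHS]natr1 lerD2r [leRHS]mulrC.
  by have /andP[] := truncn_itv (ltW (mulr_gt0 (ltr0Sn R n) t0)).
have rcvg : r n @[n --> \oo] --> (t : R).
  apply: (@squeeze_cvgr _ _ _ _ (fun=> t) (fun n => t + n.+1%:R^-1)).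
  - by apply: nearW => n; rewrite rt ltW.
  - exact: cvg_cst.
  - rewrite -[X in _ --> X]addr0; apply: cvgD; first exact: cvg_cst.
    exact: cvg_harmonic.
have mC := measurable_cone_section borelT x t.
have mB n := measurable_metric_ball borelT x (r n).
have lg := L2_heat hE lf t0; have lgn n := L2_heat hE lf (r0 n).
have lC := (L2_restr mC lg).1; have lB n := (L2_restr (mB n) (lgn n)).1.
have lBg n := (L2_restr (mB n) lg).1.
rewrite (_ : (fun n => _) = (fun n => (nrm2 mu (restr (ball x (r n)) (heat L E (r n) f)) ^+ 2)%:E)); last first.
  by apply/funext => n; exact: (integral_sqr_restr (mB n) (lgn n)).
rewrite cone_energyE//=; apply: cvg_EFin; first exact: nearW.
suff h : nrm2 mu (restr (ball x (r n)) (heat L E (r n) f)) @[n --> \oo] -->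
    nrm2 mu (restr (cone_section x t) (heat L E t f)).
  rewrite [X in X @ _ --> _](_ : _ = (fun n =>
    nrm2 mu (restr (ball x (r n)) (heat L E (r n) f)) *
    nrm2 mu (restr (ball x (r n)) (heat L E (r n) f)))).
    by rewrite expr2; exact: cvgM.
  by apply/funext => n; rewrite /= expr2.
have h1 := heat_cvg hE lf r0 t0 rcvg.
have h2 : nrm2 mu (fun y => restr (ball x (r n)) (heat L E t f) y -
    restr (cone_section x t) (heat L E t f) y) @[n --> \oo] --> 0.
  apply: (nrm2_dominated_cvg lg).
  - by move=> n; have [[]] := L2B (lBg n) lC.
  - move=> n y; rewrite /restr -mulrBl -rmorphB normcM normc_real !indicE ler_piMl//.
    by do 2 case: (_ \in _); rewrite ?subrr ?subr0 ?sub0r ?normrN ?normr1 ?normr0.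
  move=> y; have [ty|ty] := leP (mdist x y) t.
    rewrite [X in X @ _ --> _](_ : _ = (fun=> 0)); first exact: cvg_cst.
    apply/funext => n; rewrite /restr !indicE !mem_set ?subrr ?normc0//.
    by rewrite ballEmdist /=; exact: le_lt_trans (tr n).
  have : \forall n \near \oo, r n < mdist x y.
    move/cvgrPdist_lt : rcvg => /(_ (mdist x y - t)); rewrite subr_gt0 => /(_ ty).
    by apply: filterS => n; rewrite distrC gtr0_norm ?subr_gt0// ltrD2r.
  move=> near_r; apply: cvg_near_cst; apply: filterS near_r => n rn.
  rewrite /restr !indicE !memNset ?mul0r ?subrr ?normc0//=.
    by rewrite /cone_section /= leNgt ty.
  by rewrite ballEmdist /=; apply/negP; rewrite -leNgt ltW.
(* Two errors are separated: the change of time inside a fixed ball, and the change from ball to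
   section at a fixed time. *)
have h3 : nrm2 mu (fun y => heat L E (r n) f y - heat L E t f y) +
    nrm2 mu (fun y => restr (ball x (r n)) (heat L E t f) y -
      restr (cone_section x t) (heat L E t f) y) @[n --> \oo] --> 0.
  by rewrite -[X in _ --> X]addr0; exact: cvgD.
apply/cvgrPdist_le => e e0; move/cvgrPdist_le : h3 => /(_ _ e0).
apply: filterS => n; rewrite sub0r normrN => le.
rewrite distrC (le_trans (nrm2_dist (lB n) lC))//.
apply: le_trans (nrm2_triangle (lB n) (lBg n) lC) _.
apply: le_trans le; rewrite ger0_norm ?addr_ge0 ?nrm2_ge0// lerD2r.
have := (L2_restr (mB n) (L2B (lgn n) lg).1).2.
rewrite (_ : restr _ _ = (fun y => restr (ball x (r n)) (heat L E (r n) f) y -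
  restr (ball x (r n)) (heat L E t f) y))//.
by apply/funext => y; rewrite /restr mulrBr.
Qed.

Lemma measurable_volume :
  measurable_fun setT (fun z : T * measurableTypeR R => fine (mu (ball z.1 z.2))).
Proof.
have := measurable_ball_integral mu borelT (fun=> lee01) (measurable_cst _).
move=> m1; apply: (measurableT_comp (fine_measurable measurableT)).
rewrite (_ : (fun z => _) = (fun z : T * measurableTypeR R => \int[mu]_(y in ball z.1 z.2) 1)%E)//.
apply/funext => z; rewrite integral_cst ?mul1e//.
exact: measurable_metric_ball.
Qed.

Lemma measurable_cone_weight : measurable_fun setT cone_weight.
Proof.
have mpos : measurable_fun setT (fun z : T * measurableTypeR R => 0 < (z.2 : R)).
  by apply: measurableT_comp (@measurable_gt0 R) _; exact: measurable_snd.
rewrite (_ : cone_weight = (fun z => if 0 < (z.2 : R)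
    then (fine (mu (ball z.1 z.2))) `^ (-1) * (z.2 : R) `^ (-1) else 0)).
  apply: measurable_fun_ifT => //.
  apply: measurable_funM.
    by apply: measurableT_comp (measurable_powR _) _; exact: measurable_volume.
  by apply: measurableT_comp (measurable_powR _) _; exact: measurable_snd.
apply/funext => z; rewrite /cone_weight; case: ifP => // z0.
by rewrite !powR_inv1 ?fine_ge0// ltW.
Qed.

Lemma measurable_cone_density f : L2 mu f -> measurable_fun setT (cone_density f).
Proof.
move=> lf; apply: emeasurable_funM; first exact: measurable_cone_energy.
by apply/measurable_EFinP; exact: measurable_cone_weight.
Qed.

Lemma cone_density_ae f g z : L2 mu f -> L2 mu g -> eqL2 mu f g ->
  cone_density f z = cone_density g z.
Proof. by move=> lf lg fg; rewrite /cone_density (cone_energy_ae z lf lg fg). Qed.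

Lemma cone_densityB f g z : L2 mu f -> L2 mu g ->
  (cone_density (fun x => f x - g x)%R z <=
   2%:E * cone_density f z + 2%:E * cone_density g z)%E.
Proof.
move=> lf lg; have := cone_energyB z lf lg; rewrite /cone_density.
move: (cone_energy_ge0 f z) (cone_energy_ge0 g z) (cone_weight_ge0 z).
move: (cone_energy _ z) (cone_energy _ z) (cone_energy _ z) (cone_weight z).
move=> a b c w b0 c0 w0 ab; rewrite !muleA -ge0_muleDl ?mule_ge0//.
by rewrite lee_wpmul2r// lee_fin.
Qed.

Lemma square_functionE f x : L2 mu f ->
  square_function L E f x = sqrte (\int[lebesgue_measure]_t cone_density f (x, t))%E.
Proof.
move=> lf; rewrite /square_function; congr sqrte.
rewrite integral_mkcond; apply: eq_integral => t _; rewrite patchE.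
case: ifPn => [|]; last first.
  rewrite notin_setE /= in_itv /= andbT => /negP t0.
  by rewrite /cone_density /cone_energy /= (negbTE t0) mul0e.
rewrite inE /= in_itv /= andbT => t0.
have lH := L2_heat hE lf t0.
rewrite /cone_density /cone_energy /cone_weight /= t0 -ge0_integralZr//.
- by apply: eq_integral => y _; rewrite -EFinM /heat mulrA.
- exact: measurable_cone_section.
- by apply: measurable_funTS; apply/measurable_EFinP/measurable_sqr_normc; case: lH.
- by move=> y _; rewrite lee_fin sqr_ge0.
- by rewrite lee_fin mulr_ge0// invr_ge0 ?fine_ge0// ltW.
Qed.

End ConeDensity.

(** * The square function over a region *)

Section Sqrte.
Context (R : realType).
Implicit Types a b s : \bar R.

Lemma le_sqrte_sqr a s : (0 <= s)%E -> (a <= s ^+ 2)%E -> (sqrte a <= s)%E.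
Proof.
move=> s0 as2; rewrite -[leRHS]gee0_abs// -sqrte_sqr lee_sqrt//.
exact: sqre_ge0.
Qed.

Lemma le_sqr_sqrte a s : (0 <= a)%E -> (sqrte a <= s)%E -> (a <= s ^+ 2)%E.
Proof.
by move=> a0 h; rewrite -[leLHS]sqr_sqrte// !expe2 lee_pmul ?sqrte_ge0.
Qed.

Lemma sqrteD_le a b : (0 <= a)%E -> (0 <= b)%E ->
  (sqrte (a + b) <= sqrte a + sqrte b)%E.
Proof.
move=> a0 b0; apply: le_sqrte_sqr; first by rewrite adde_ge0 ?sqrte_ge0.
case: a b a0 b0 => [a| |] [b| |]//=; rewrite !lee_fin => a0 b0.
rewrite -[in leLHS](sqr_sqrtr a0) -[in leLHS](sqr_sqrtr b0).
by have := mulr_ge0 (sqrtr_ge0 a) (sqrtr_ge0 b); nra.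
Qed.

Lemma sqrte_cvg0 (u : (\bar R)^nat) : (forall n, (0 <= u n)%E) ->
  u @ \oo --> 0%E -> (fun n => sqrte (u n)) @ \oo --> 0%E.
Proof.
move=> u0 /fine_cvgP[ufin ucvg]; apply/fine_cvgP; split.
  by apply: filterS ufin => n fn; rewrite sqrte_fin_num.
have := cvg_comp _ _ ucvg (@sqrt_continuous R 0); rewrite sqrtr0.
apply: cvg_trans; apply: near_eq_cvg; apply: nearW => n /=.
by case: (u n) => [r| |] //=; rewrite sqrtr0.
Qed.

End Sqrte.

Section SquareFunctional.
Context (R : realType) (d : measure_display) (T : measurableType d).
Variable mu : {measure set T -> \bar R}.
Local Notation TR := (T * measurableTypeR R)%type.
Implicit Types (W : TR -> \bar R) (Q : set TR).

(** The density is abstracted to any W, so that the measure theory is free of operators. The region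
    enters through its indicator, which keeps all slices integrals over the same line. *)
Definition slice W Q (x : T) : \bar R :=
  (\int[lebesgue_measure]_t (W (x, t) * (\1_Q (x, t))%:E))%E.

Definition square_functional W Q : \bar R := (\int[mu]_x sqrte (slice W Q x))%E.

Section Properties.
Variable W : TR -> \bar R.
Hypotheses (W0 : forall z, (0 <= W z)%E) (mW : measurable_fun setT W).

Let WQ0 Q z : (0 <= W z * (\1_Q z)%:E)%E.
Proof. by rewrite mule_ge0// lee_fin. Qed.

Let mWQ Q : measurable Q -> measurable_fun setT (fun z => W z * (\1_Q z)%:E)%E.
Proof.
move=> mQ; apply: emeasurable_funM => //; apply/measurable_EFinP.
exact: measurable_indic.
Qed.

Let mWQx Q x : measurable Q ->
  measurable_fun setT (fun t : measurableTypeR R => W (x, t) * (\1_Q (x, t))%:E)%E.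
Proof.
move=> mQ; exact: (measurableT_comp (mWQ mQ) (pair1_measurable x)).
Qed.

Lemma slice_ge0 Q x : (0 <= slice W Q x)%E.
Proof. by apply: integral_ge0 => t _; exact: WQ0. Qed.

Lemma measurable_slice Q : measurable Q -> measurable_fun setT (slice W Q).
Proof.
move=> mQ; apply: (@measurable_fun_fubini_tonelli_F _ _ T (measurableTypeR R) R
  lebesgue_measure (fun z => W z * (\1_Q z)%:E)%E); [exact: mWQ|exact: WQ0].
Qed.

Lemma measurable_sqrte_slice Q : measurable Q ->
  measurable_fun setT (fun x => sqrte (slice W Q x)).
Proof.
move=> mQ; rewrite (_ : (fun x => _) = (fun x => slice W Q x `^ 2^-1)%E).
  exact: measurableT_comp (measurable_poweR _) (measurable_slice mQ).
by apply/funext => x; rewrite poweR12_sqrt// slice_ge0.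
Qed.

Lemma square_functional_ge0 Q : (0 <= square_functional W Q)%E.
Proof. by apply: integral_ge0 => x _; exact: sqrte_ge0. Qed.

Lemma le_slice Q Q' x : measurable Q -> measurable Q' -> Q `<=` Q' ->
  (slice W Q x <= slice W Q' x)%E.
Proof.
move=> mQ mQ' QQ'; apply: ge0_le_integral => //.
- exact: mWQx.
- exact: mWQx.
- move=> t _; rewrite lee_wpmul2l// lee_fin !indicE.
  case: (boolP ((x, t) \in Q)) => [/set_mem/QQ'/mem_set ->//|_].
  by rewrite ler0n.
Qed.

Lemma le_square_functional Q Q' : measurable Q -> measurable Q' -> Q `<=` Q' ->
  (square_functional W Q <= square_functional W Q')%E.
Proof.
move=> mQ mQ' QQ'; apply: ge0_le_integral => //.
- by move=> x _; exact: sqrte_ge0.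
- exact: measurable_sqrte_slice.
- exact: measurable_sqrte_slice.
- by move=> x _; rewrite lee_sqrt ?slice_ge0// le_slice.
Qed.

Lemma square_functional_subU Q Q1 Q2 : measurable Q -> measurable Q1 -> measurable Q2 ->
  Q `<=` Q1 `|` Q2 ->
  (square_functional W Q <= square_functional W Q1 + square_functional W Q2)%E.
Proof.
move=> mQ mQ1 mQ2 QQ; rewrite /square_functional -ge0_integralD//; last 4 first.
- by move=> x _; exact: sqrte_ge0.
- exact: measurable_sqrte_slice.
- by move=> x _; exact: sqrte_ge0.
- exact: measurable_sqrte_slice.
apply: ge0_le_integral => //.
- by move=> x _; exact: sqrte_ge0.
- exact: measurable_sqrte_slice.
- by apply: emeasurable_funD; exact: measurable_sqrte_slice.
move=> x _; apply: le_trans (sqrteD_le (slice_ge0 _ _) (slice_ge0 _ _)).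
rewrite lee_sqrt; last by rewrite adde_ge0 ?slice_ge0.
rewrite /slice -ge0_integralD//; last 2 first.
- exact: mWQx.
- exact: mWQx.
apply: ge0_le_integral => //.
- exact: mWQx.
- by apply: emeasurable_funD; exact: mWQx.
move=> t _; rewrite -ge0_muleDr ?lee_fin// lee_wpmul2l// -EFinD lee_fin !indicE.
case: (boolP ((x, t) \in Q)) => [/set_mem/QQ[]/mem_set ->|_].
- by rewrite lerDl ler0n.
- by rewrite lerDr ler0n.
- by rewrite addr_ge0// ler0n.
Qed.

(** Monotone convergence is used twice, in x for the roots and in t for the slices; between the two,
    the limit S of the roots is squared to bound every slice. *)
Lemma square_functional_bigcup (Q_ : nat -> set TR) c :
  (forall k, measurable (Q_ k)) -> {homo Q_ : m n / (m <= n)%N >-> m `<=` n} ->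
  (forall k, (square_functional W (Q_ k) <= c)%E) ->
  (square_functional W (\bigcup_k Q_ k) <= c)%E.
Proof.
move=> mQ ndQ bc; have mU : measurable (\bigcup_k Q_ k) by exact: bigcup_measurable.
pose s k x := sqrte (slice W (Q_ k) x).
have nds x : {homo s ^~ x : m n / (m <= n)%N >-> (m <= n)%E}.
  by move=> m n mn; rewrite lee_sqrt ?slice_ge0// le_slice//; exact: ndQ.
have ms k : measurable_fun setT (s k) by exact: measurable_sqrte_slice.
have s0 k x : (0 <= s k x)%E by exact: sqrte_ge0.
apply: (@le_trans _ _ (\int[mu]_x limn (s ^~ x))%E); last first.
  rewrite monotone_convergence//; apply: lime_le.
    apply: ereal_nondecreasing_is_cvgn => m n mn; apply: ge0_le_integral => // x _.
    exact: nds.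
  exact: nearW.
apply: ge0_le_integral => //.
- by move=> x _; exact: sqrte_ge0.
- exact: measurable_sqrte_slice.
- apply: (emeasurable_fun_cvg s) => // x _.
  by apply: ereal_nondecreasing_is_cvgn; exact: nds.
move=> x _; set S := limn _.
have sS k : (s k x <= S)%E.
  rewrite /S (cvg_lim _ (ereal_nondecreasing_cvgn (nds x)))//.
  by apply: ereal_sup_ubound; exists k.
apply: le_sqrte_sqr; first exact: le_trans (sS 0%N).
have le1 k : (slice W (Q_ k) x <= S ^+ 2)%E.
  by apply: le_sqr_sqrte; [exact: slice_ge0|exact: sS].
pose g k (t : measurableTypeR R) := (W (x, t) * (\1_(Q_ k) (x, t))%:E)%E.
have ndg t : {homo g ^~ t : m n / (m <= n)%N >-> (m <= n)%E}.
  move=> m n mn; rewrite /g lee_wpmul2l// lee_fin !indicE.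
  case: (boolP ((x, t) \in Q_ m)) => [/set_mem/(ndQ _ _ mn)/mem_set ->//|_].
  by rewrite ler0n.
have := @cvg_monotone_convergence _ _ _ lebesgue_measure setT measurableT g
  (fun k => mWQx x (mQ k)) (fun k t _ => WQ0 _ _) (fun t _ => ndg t).
rewrite (_ : (\int[_]_(t in setT) limn (g ^~ t))%E = slice W (\bigcup_k Q_ k) x).
  by move=> cv; apply: (cvge_to_le cv); exact: nearW.
apply: eq_integral => t _; apply/cvg_lim => //.
have [[k _ Qk]|nQ] := pselect ((\bigcup_k Q_ k) (x, t)).
  apply: cvg_near_cst; exists k => // n /= kn.
  rewrite /g !indicE !mem_set//; last exact: (ndQ _ _ kn).
  by exists k.
rewrite [X in X @ _ --> _](_ : _ = (fun=> W (x, t) * (\1_(\bigcup_k Q_ k) (x, t))%:E)%E).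
  exact: cvg_cst.
apply/funext => n; rewrite /g !indicE !memNset//; apply: contra_not nQ => Qn.
by exists n.
Qed.

(** Dominated convergence in t, at almost every x where the whole slice is finite, and then in x
    with the root of the whole slice as majorant. *)
Lemma square_functional_tail (Q_ : nat -> set TR) (e : R) :
  (forall k, measurable (Q_ k)) -> {homo Q_ : m n / (m <= n)%N >-> m `<=` n} ->
  (forall z, W z != 0%E -> (\bigcup_k Q_ k) z) ->
  (square_functional W setT < +oo)%E -> 0 < e ->
  exists k, (square_functional W (~` Q_ k) <= e%:E)%E.
Proof.
move=> mQ ndQ supp fin e0.
have mC k : measurable (~` Q_ k) by exact: measurableC.
pose s k x := sqrte (slice W (~` Q_ k) x).
have isT : mu.-integrable setT (fun x => sqrte (slice W setT x)).
  apply/integrableP; split; first exact: measurable_sqrte_slice.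
  by under eq_integral do rewrite gee0_abs ?sqrte_ge0//.
have s_le k x : (s k x <= sqrte (slice W setT x))%E.
  by rewrite lee_sqrt ?slice_ge0// le_slice.
have s_cvg : {ae mu, forall x, setT x -> s k x @[k --> \oo] --> 0%E}.
  apply: filterS (integrable_ae measurableT isT) => x /(_ Logic.I) fx _.
  apply: sqrte_cvg0 => [k|]; first exact: slice_ge0.
  rewrite sqrte_fin_num ?slice_ge0// in fx.
  pose g k (t : measurableTypeR R) := (W (x, t) * (\1_(~` Q_ k) (x, t))%:E)%E.
  pose G (t : measurableTypeR R) := (W (x, t) * (\1_[set: TR] (x, t))%:E)%E.
  have GE t : G t = W (x, t) by rewrite /G indicT mule1.
  have iG : lebesgue_measure.-integrable setT G.
    apply/integrableP; split; first exact: mWQx.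
    under eq_integral do rewrite gee0_abs ?WQ0//.
    by rewrite ltey_eq; apply/orP; left.
  have g_cvg (t : measurableTypeR R) : setT t -> g k t @[k --> \oo] --> 0%E.
    move=> _; have [Wz|/supp[k _ Qk]] := eqVneq (W (x, t)) 0%E.
      rewrite (_ : (fun k => _) = (fun=> 0%E)); first exact: cvg_cst.
      by apply/funext => k; rewrite /g Wz mul0e.
    apply: cvg_near_cst; exists k => // n /= kn.
    rewrite /g indicE memNset ?mule0// => nQ; apply: nQ; exact: (ndQ _ _ kn).
  have gG (t : measurableTypeR R) k : setT t -> (`|g k t| <= G t)%E.
    move=> _; rewrite gee0_abs ?WQ0// GE /g.
    by rewrite -[leRHS]mule1 lee_wpmul2l// lee_fin indicE lern1 leq_b1.
  have [_ _] := @dominated_convergence _ _ _ lebesgue_measure setT measurableT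
    g (cst 0%E) G (fun k => mWQx x (mC k)) (measurable_cst _) (nearW _ g_cvg) iG
    (nearW _ gG).
  by rewrite integral0.
have s_dom x k : setT x -> (`|s k x| <= sqrte (slice W setT x))%E.
  by move=> _; rewrite gee0_abs ?sqrte_ge0.
have [_ _] := @dominated_convergence _ _ _ mu setT measurableT s (cst 0%E)
  (fun x => sqrte (slice W setT x)) (fun k => measurable_sqrte_slice (mC k))
  (measurable_cst _) s_cvg isT (nearW _ s_dom).
rewrite integral0 => cv.
move/fine_cvgP : cv => [[k0 _ fink] /cvgrPdist_le /(_ _ e0)[k1 _ hk]].
exists (maxn k0 k1); have := hk _ (leq_maxr k0 k1); have := fink _ (leq_maxl k0 k1).
rewrite /= sub0r normrN => f1 h1.
by rewrite -[leLHS](fineK f1) lee_fin (le_trans _ h1)// ler_norm.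
Qed.

End Properties.

(** The root of 2 a + 2 b is at most sqrt 2 times the sum of the roots, and sqrt 2 is rounded up to
    2. *)
Lemma square_functional_le_lin W W1 W2 Q : measurable Q ->
  (forall z, (0 <= W z)%E) -> measurable_fun setT W ->
  (forall z, (0 <= W1 z)%E) -> measurable_fun setT W1 ->
  (forall z, (0 <= W2 z)%E) -> measurable_fun setT W2 ->
  (forall z, W z <= 2%:E * W1 z + 2%:E * W2 z)%E ->
  (square_functional W Q <= 2%:E * (square_functional W1 Q + square_functional W2 Q))%E.
Proof.
move=> mQ W0 mW W10 mW1 W20 mW2 WW.
rewrite /square_functional -ge0_integralD//; last 4 first.
- by move=> x _; exact: sqrte_ge0.
- exact: measurable_sqrte_slice.
- by move=> x _; exact: sqrte_ge0.
- exact: measurable_sqrte_slice.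
have mI : measurable_fun setT (fun z : TR => (\1_Q z : R)%:E).
  by apply/measurable_EFinP; exact: measurable_indic.
rewrite -ge0_integralZl_EFin//; last 2 first.
- by move=> x _; rewrite adde_ge0// sqrte_ge0.
- by apply: emeasurable_funD; exact: measurable_sqrte_slice.
apply: ge0_le_integral => //.
- by move=> x _; exact: sqrte_ge0.
- exact: measurable_sqrte_slice.
- apply: emeasurable_funM; first exact: measurable_cst.
  by apply: emeasurable_funD; exact: measurable_sqrte_slice.
move=> x _.
have sl : (slice W Q x <= 2%:E * slice W1 Q x + 2%:E * slice W2 Q x)%E.
  have mx (V : TR -> \bar R) : measurable_fun setT V ->
      measurable_fun setT (fun t : measurableTypeR R => V (x, t) * (\1_Q (x, t))%:E)%E.
    by move=> mV; exact: (measurableT_comp (emeasurable_funM mV mI) (pair1_measurable x)).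
  have V0 (V : TR -> \bar R) t : (forall z, (0 <= V z)%E) ->
      (0 <= V (x, t) * (\1_Q (x, t))%:E)%E.
    by move=> h; rewrite mule_ge0// lee_fin.
  have mZ (V : TR -> \bar R) : measurable_fun setT V ->
      measurable_fun setT (fun t : measurableTypeR R =>
        2%:E * (V (x, t) * (\1_Q (x, t))%:E))%E.
    by move=> mV; apply: emeasurable_funM; [exact: measurable_cst|exact: mx].
  have Z0 (V : TR -> \bar R) t : (forall z, (0 <= V z)%E) ->
      (0 <= 2%:E * (V (x, t) * (\1_Q (x, t))%:E))%E.
    by move=> h; rewrite mule_ge0 ?V0// lee_fin.
  rewrite /slice -!ge0_integralZl_EFin//; try (by move=> t _; exact: V0); try exact: mx.
  rewrite -ge0_integralD//; try (by move=> t _; exact: Z0); try exact: mZ.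
  apply: ge0_le_integral => //.
  - by move=> t _; exact: V0.
  - exact: mx.
  - by apply: emeasurable_funD; exact: mZ.
  move=> t _; rewrite !muleA -ge0_muleDl ?mule_ge0//.
  by rewrite lee_wpmul2r// lee_fin.
have sl1 := slice_ge0 W10 Q x; have sl2 := slice_ge0 W20 Q x.
move: (slice W Q x) (slice W1 Q x) (slice W2 Q x) sl sl1 sl2 => c a b sl a0 b0.
apply: (@le_trans _ _ (sqrte (2%:E * a + 2%:E * b))).
  by rewrite lee_sqrt// adde_ge0// mule_ge0.
apply: (le_trans (sqrteD_le _ _)); rewrite ?mule_ge0//.
rewrite ge0_muleDr ?sqrte_ge0// !sqrteM//.
have s2 : (sqrte 2%:E <= 2%:E :> \bar R)%E.
  by apply: le_sqrte_sqr; rewrite // expe2 -EFinM lee_fin; lra.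
by apply: leeD; rewrite lee_wpmul2r ?sqrte_ge0.
Qed.

End SquareFunctional.

(** * The Hardy norm cut along the regions *)

Section HardyFunctional.
Context (R : realType) (d : measure_display) (T : metricMeasurableType R d).
Variable mu : {measure set T -> \bar R}.
Hypothesis hT : homogeneous_type mu.
Variables (L : unbounded_op mu) (E : pvm mu).
Hypothesis hE : sqrt_spectral_measure L E.
Local Notation TR := (T * measurableTypeR R)%type.
Implicit Types (f g : T -> R[i]) (Q : set TR).

Let borelT : (measurable : set (set T)) = <<s (open : set (set T)) >>.
Proof. by case: hT. Qed.

(* On each region the square function is controlled by the L^2 norm, see
   hardy_on_region_le; the regions exhaust the upper half space. *)
Definition region (k : nat) : set TR := [set z |
  [/\ mdist point z.1 < k.+1%:R, k.+1%:R^-1 < (z.2 : R) < k.+1%:R &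
      k.+1%:R^-1 < fine (mu (ball z.1 z.2))]].

Definition hardy_on f Q : \bar R := square_functional mu (cone_density L E f) Q.

Lemma measurable_region k : measurable (region k).
Proof.
rewrite (_ : region k = (ball (point : T) k.+1%:R `*`
    (`]k.+1%:R^-1, k.+1%:R[%classic : set (measurableTypeR R))) `&`
    ((fun z : TR => fine (mu (ball z.1 z.2))) @^-1` `]k.+1%:R^-1, +oo[)).
  apply: measurableI.
    by apply: measurableX; [exact: measurable_metric_ball|exact: measurable_itv].
  by rewrite -[X in measurable X]setTI; exact: (measurable_volume hT).
apply/seteqP; split => z; rewrite /region /= !in_itv/= andbT
  (_ : ball point _ z.1 = (mdist point z.1 < k.+1%:R)); try by rewrite ballEmdist.
  by move=> [h1 h2 h3]; split.
by move=> [[h1 h2] h3]; split.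
Qed.

Lemma region_homo : {homo region : m n / (m <= n)%N >-> m `<=` n}.
Proof.
move=> m n mn z [h1 /andP[h2 h3] h4].
have le1 : (m.+1%:R : R) <= n.+1%:R by rewrite ler_nat.
have le2 : (n.+1%:R : R)^-1 <= m.+1%:R^-1 by rewrite lef_pV2 ?posrE.
split; first exact: lt_le_trans le1.
- by rewrite (le_lt_trans le2 h2) (lt_le_trans h3 le1).
- exact: le_lt_trans h4.
Qed.

Lemma region_cover (z : TR) : 0 < (z.2 : R) -> (\bigcup_k region k) z.
Proof.
move=> z0; have [_ vol _] := hT.
have v0 : 0 < fine (mu (ball z.1 z.2)) by apply: fine_gt0; exact: vol.
(* The region index must exceed the distance, t, 1 / t and 1 / V, so it is read off their
   maximum. *)
pose m := Num.max (mdist point z.1) (Num.max (z.2 : R)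
  (Num.max (z.2 : R)^-1 (fine (mu (ball z.1 z.2)))^-1)).
have mk := truncnS_gt m.
have inv (x : R) : 0 < x -> x^-1 <= m -> (Num.truncn m).+1%:R^-1 < x.
  move=> x0 xm; rewrite invf_plt ?posrE//; exact: le_lt_trans mk.
exists (Num.truncn m) => //; split.
- by apply: le_lt_trans mk; rewrite le_max lexx.
- rewrite inv//=; first by apply: le_lt_trans mk; rewrite !le_max lexx orbT.
  by rewrite !le_max lexx !orbT.
- by apply: inv => //; rewrite !le_max lexx !orbT.
Qed.

Lemma cone_density_support f (z : TR) : cone_density L E f z != 0%E ->
  (\bigcup_k region k) z.
Proof.
have [z0 _|z0] := ltP 0 (z.2 : R); first exact: region_cover.
by rewrite /cone_density /cone_energy ltNge z0 /= mul0e eqxx.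
Qed.

Lemma hardy_normE f : L2 mu f -> hardy_norm L E f = hardy_on f setT.
Proof.
move=> lf; apply: eq_integral => x _; rewrite square_functionE//; congr sqrte.
by apply: eq_integral => t _; rewrite indicT mule1.
Qed.

Let cd0 f := @cone_density_ge0 _ _ _ mu L E f.
Let cdm f (lf : L2 mu f) := measurable_cone_density hT hE lf.

Lemma hardy_on_ge0 f Q : (0 <= hardy_on f Q)%E.
Proof. exact: square_functional_ge0. Qed.

Lemma le_hardy_on f Q Q' : L2 mu f -> measurable Q -> measurable Q' -> Q `<=` Q' ->
  (hardy_on f Q <= hardy_on f Q')%E.
Proof. by move=> lf; apply: le_square_functional; [exact: cd0|exact: cdm]. Qed.

Lemma hardy_on_region_subU f k : L2 mu f ->
  (hardy_on f setT <= hardy_on f (region k) + hardy_on f (~` region k))%E.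
Proof.
move=> lf; apply: square_functional_subU; [exact: cd0|exact: cdm|by []|
  exact: measurable_region|apply: measurableC; exact: measurable_region|].
by rewrite setUv.
Qed.

Lemma hardy_onB f g Q : L2 mu f -> L2 mu g -> measurable Q ->
  (hardy_on (fun x => f x - g x)%R Q <= 2%:E * (hardy_on f Q + hardy_on g Q))%E.
Proof.
move=> lf lg mQ; apply: square_functional_le_lin => //; try exact: cdm.
- by apply: cdm; exact: (L2B lf lg).1.
- by move=> z; exact: (cone_densityB hT hE).
Qed.

Lemma hardy_on_ae f g Q : L2 mu f -> L2 mu g -> eqL2 mu f g ->
  hardy_on f Q = hardy_on g Q.
Proof.
move=> lf lg fg; have e : cone_density L E f = cone_density L E g.
  by apply/funext => z; exact: (cone_density_ae hT hE).
by rewrite /hardy_on e.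
Qed.

Lemma hardy_on_tail f (e : R) : L2 mu f -> (hardy_on f setT < +oo)%E -> 0 < e ->
  exists k, (hardy_on f (~` region k) <= e%:E)%E.
Proof.
move=> lf fin e0; apply: square_functional_tail => //.
- exact: cdm.
- exact: measurable_region.
- exact: region_homo.
- by move=> z; exact: cone_density_support.
Qed.

(** With K = k + 1, on the region the weight is at most K^2 and t < K, so a slice is at most K^3
    |f|^2, rounded up to the square of K^2 |f|. Integrating the root over the ball of radius K gives
    this constant. *)
Definition region_cst (k : nat) : R :=
  fine (mu (ball (point : T) k.+1%:R)) * k.+1%:R ^+ 2.

Lemma region_cst_ge0 k : 0 <= region_cst k.
Proof. by rewrite mulr_ge0 ?fine_ge0 ?sqr_ge0. Qed.

Lemma hardy_on_region_le f Q k : L2 mu f -> measurable Q -> Q `<=` region k ->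
  (hardy_on f Q <= (region_cst k * nrm2 mu f)%:E)%E.
Proof.
move=> lf mQ Qk; pose K : R := k.+1%:R; pose n := nrm2 mu f.
have K1 : 1 <= K by rewrite ler1n.
have K0 : 0 < K by rewrite ltr0n.
have n0 : 0 <= n := nrm2_ge0 _ _.
pose B := ball (point : T) K; have mB : measurable B by exact: measurable_metric_ball.
pose I : set (measurableTypeR R) := `]0, K[%classic.
have mI : measurable I by exact: measurable_itv.
have lI : lebesgue_measure I = K%:E.
  by rewrite /I lebesgue_measure_itv /= lte_fin K0 sube0.
have bd x t : (cone_density L E f (x, t) * (\1_Q (x, t))%:E <=
    (n ^+ 2 * K ^+ 2 * \1_B x)%:E * (\1_I t)%:E)%E.
  have r0 : 0 <= n ^+ 2 * K ^+ 2 * \1_B x :> R by rewrite mulr_ge0// mulr_ge0 ?sqr_ge0.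
  have [Qz|nQ] := pselect (Q (x, t)); last first.
    by rewrite indicE memNset// mule0 mule_ge0 ?lee_fin.
  have [/= h1 /andP[h2 h3] h4] := Qk _ Qz.
  have t0 : 0 < (t : R) by rewrite (lt_trans _ h2)// invr_gt0.
  rewrite !indicE (mem_set Qz) (mem_set (_ : B x)); last by rewrite /B ballEmdist.
  rewrite (mem_set (_ : I t)); last by rewrite /I /= in_itv /= t0.
  rewrite !mule1 mulr1 /cone_density.
  have w : cone_weight mu (x, t) <= K ^+ 2.
    rewrite /cone_weight /= t0 expr2.
    have v0 : 0 < fine (mu (ball x t)) by rewrite (lt_trans _ h4)// invr_gt0.
    apply: ler_pM; rewrite ?invr_ge0 ?(ltW v0) ?(ltW t0)//.
      by rewrite -[leRHS]invrK lef_pV2 ?posrE ?invr_gt0// ltW.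
    by rewrite -[leRHS]invrK lef_pV2 ?posrE ?invr_gt0// ltW.
  rewrite EFinM lee_pmul ?lee_fin ?cone_weight_ge0//.
    exact: cone_energy_ge0.
  exact: (cone_energy_le hT hE).
have sl x : (sqrte (slice (cone_density L E f) Q x) <= (K ^+ 2 * n)%:E * (\1_B x)%:E)%E.
  apply: le_sqrte_sqr; first by rewrite mule_ge0 ?lee_fin ?mulr_ge0 ?sqr_ge0.
  apply: (@le_trans _ _ (\int[lebesgue_measure]_t
     ((n ^+ 2 * K ^+ 2 * \1_B x)%:E * (\1_I t)%:E))%E).
    apply: ge0_le_integral => //.
    - by move=> t _; rewrite mule_ge0 ?cd0 ?lee_fin.
    - have m : measurable_fun setT
          (fun z : TR => cone_density L E f z * (\1_Q z)%:E)%E.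
        apply: emeasurable_funM; first exact: cdm.
        by apply/measurable_EFinP; exact: measurable_indic.
      exact: (measurableT_comp m (pair1_measurable x)).
    - apply: emeasurable_funM; first exact: measurable_cst.
      by apply/measurable_EFinP; exact: measurable_indic.
  rewrite ge0_integralZl_EFin; last 4 first.
  - exact: measurableT.
  - by move=> t _; rewrite lee_fin.
  - by apply/measurable_EFinP; exact: measurable_indic.
  - by rewrite mulr_ge0// mulr_ge0 ?sqr_ge0.
  rewrite integral_indic// setIT [X in (_ * X)%E]lI.
  rewrite -!EFinM expe2 -EFinM lee_fin indicE; case: (_ \in _); last by rewrite !mulr0 mul0r.
  rewrite !mulr1.
  have KK : K ^+ 2 <= K ^+ 3 by rewrite ler_weXn2l.
  have nn : 0 <= n ^+ 2 by rewrite sqr_ge0.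
  rewrite -subr_ge0.
  rewrite (_ : _ - _ = K * (K ^+ 3 - K ^+ 2) * n ^+ 2); last by ring.
  by rewrite mulr_ge0// mulr_ge0 ?subr_ge0//; exact: ltW.
rewrite /hardy_on /square_functional.
apply: (@le_trans _ _ (\int[mu]_x ((K ^+ 2 * n)%:E * (\1_B x)%:E))%E).
  apply: ge0_le_integral => //.
  - by move=> x _; exact: sqrte_ge0.
  - by apply: measurable_sqrte_slice => //; exact: cdm.
  - apply: emeasurable_funM; first exact: measurable_cst.
    by apply/measurable_EFinP; exact: measurable_indic.
rewrite ge0_integralZl_EFin; last 4 first.
- exact: measurableT.
- by move=> x _; rewrite lee_fin.
- by apply/measurable_EFinP; exact: measurable_indic.
- by rewrite mulr_ge0 ?sqr_ge0.
rewrite integral_indic// setIT.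
have [_ vol _] := hT; have /andP[v0 voo] := vol point K K0.
rewrite -[X in (_ * X)%E](@fineK _ (mu B)); last by rewrite ge0_fin_numE// ltW.
rewrite -EFinM lee_fin /region_cst -/K -/B.
by rewrite -mulrA mulrC -mulrA [n * _]mulrC.
Qed.

(** Within a region, f = h_n - (h_n - f) and the second term is negligible by [hardy_on_region_le];
    [hardy_onB] costs the factor 2. The index n depends on the region, but the resulting bound does
    not, so the union over the regions can be taken. *)
Lemma hardy_on_lsc f (h_ : nat -> T -> R[i]) Q (c : R) : L2 mu f ->
  (forall n, L2 mu (h_ n)) -> measurable Q ->
  nrm2 mu (fun x => h_ n x - f x) @[n --> \oo] --> 0 ->
  (forall n, (hardy_on (h_ n) Q <= c%:E)%E) -> (hardy_on f Q <= (2 * c)%:E)%E.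
Proof.
move=> lf lh mQ hf hc.
have mQk k : measurable (Q `&` region k).
  by apply: measurableI => //; exact: measurable_region.
have -> : hardy_on f Q = hardy_on f (\bigcup_k (Q `&` region k)).
  apply: eq_integral => x _; congr sqrte; apply: eq_integral => t _.
  have [->|/cone_density_support[k _ kz]] := eqVneq (cone_density L E f (x, t)) 0%E.
    by rewrite !mul0e.
  congr (_ * _%:E)%E; rewrite !indicE; congr (_ %:R); congr nat_of_bool.
  apply/idP/idP => /set_mem h; apply/mem_set; first by exists k.
  by case: h => j _ [].
apply: square_functional_bigcup => //.
- exact: cdm.
- by move=> m n mn z [Qz /(region_homo mn)].
move=> k; apply/lee_addgt0Pr => e e0; rewrite -EFinD.
have C0 := region_cst_ge0 k.
have e1 : 0 < e / (2 * (1 + region_cst k)) by rewrite divr_gt0// mulr_gt0// ltr_pwDl.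
move/cvgrPdist_le : hf => /(_ _ e1)[n _ /(_ n (leqnn n))].
rewrite /= sub0r normrN ger0_norm ?nrm2_ge0// => hn.
have lB := (L2B (lh n) lf).1.
rewrite [X in square_functional _ (cone_density _ _ X) _](_ : f =
  (fun x => h_ n x - (h_ n x - f x))); last by apply/funext => x; ring.
apply: (le_trans (hardy_onB (lh n) lB (mQk k))).
apply: (@le_trans _ _ (2%:E * (c%:E + (region_cst k * (e / (2 * (1 + region_cst k))))%:E))%E).
  rewrite lee_wpmul2l ?lee_fin// leeD//.
    by apply: le_trans (hc n); apply: le_hardy_on => // z [].
  apply: (le_trans (hardy_on_region_le lB (mQk k) (@subIsetr _ _ _))).
  by rewrite lee_fin ler_wpM2l.
rewrite -EFinD -EFinM lee_fin mulrDr lerD2l.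
rewrite (_ : 2 * _ = e * (region_cst k / (1 + region_cst k))); last first.
  by field; rewrite gt_eqF// ltr_pwDl.
have K1 : 0 < 1 + region_cst k by rewrite ltr_pwDl.
by rewrite ler_piMr ?(ltW e0)// ler_pdivrMr// mul1r lerDr.
Qed.

End HardyFunctional.

(** * Strong continuity *)

Section BaireInterval.
Context (R : realType).
Implicit Types (A : set R) (u v : R).

(** Points of the closure; the sets to which this is applied need not be closed, as limits only
    satisfy their defining bound up to a factor 2. *)
Definition adherent A u := forall e : R, 0 < e -> exists2 v, A v & `|u - v| < e.

Lemma adherent_seq A u : adherent A u ->
  exists v_ : nat -> R, (forall n, A (v_ n)) /\ v_ n @[n --> \oo] --> u.
Proof.
move=> Au; have /choice[v_ hv] : forall n, exists v, A v /\ `|u - v| < n.+1%:R^-1.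
  by move=> n; have [|v Av uv] := Au n.+1%:R^-1; [rewrite invr_gt0|exists v].
exists v_; split=> [n|]; first exact: (hv n).1.
apply/cvgrPdist_lt => e e0; have [n _ hn] := near_infty_natSinv_lt (PosNum e0).
exists n => // m nm; exact: lt_trans (hv m).2 (hn _ nm).
Qed.

Let open_real (A : set R) :
  (forall u, A u -> exists2 e : R, 0 < e & forall v, `|u - v| < e -> A v) ->
  open (A : set R^o).
Proof.
by move=> H; rewrite openE => u /H[e e0 eA]; apply/nbhs_ballP; exists e.
Qed.

(** If no closure contained an interval inside (-r, r), the open sets [G n] would all be dense, and
    a common point with modulus below r would escape every A n. *)
Lemma baire_interval (A : nat -> set R) (r : R) : 0 < r ->
  (forall u, `|u| < r -> exists n, A n u) ->
  exists n a s, 0 < s /\ forall u, `|u - a| < s -> `|u| < r /\ adherent (A n) u.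
Proof.
move=> r0 cov; apply: contrapT => H.
(* Adding the exterior makes [G n] dense in the whole line, so that Baire's theorem can be applied
   in R. *)
pose G n : set R^o := [set u | ~ adherent (A n) u] `|` [set u | r < `|u|].
have oG n : open (G n).
  apply: open_real => u [nu|ru].
    have [e e0 he] : exists2 e : R, 0 < e & forall v, A n v -> e <= `|u - v|.
      apply: contrapT => hn; apply: nu => e e0; apply: contrapT => hv; apply: hn.
      exists e => // v Av; rewrite leNgt; apply/negP => uv; apply: hv.
      by exists v.
    exists (e / 2) => [|v uv]; first by rewrite divr_gt0.
    left => hv; have [|w Aw vw] := hv (e / 2); first by rewrite divr_gt0.
    have := he _ Aw; rewrite -(subrK v u) -addrA leNgt => /negP; apply.
    by rewrite (le_lt_trans (ler_normD _ _))// [ltRHS](splitr e) ltrD.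
  exists (`|u| - r) => [|v uv]; first by rewrite subr_gt0.
  by right; move: uv => /=; have := lerB_dist u v; lra.
have dG n : dense (G n).
  move=> O [x Ox] oO.
  have /nbhs_ballP[e /= e0 eO] : nbhs x O by exact: open_nbhs_nbhs.
  have [xr|xr|xr] := ltgtP `|x| r.
  - have s0 : 0 < Num.min e (r - `|x|) by rewrite lt_min e0 subr_gt0.
    apply: contrapT => nO; apply: H.
    exists n, x, (Num.min e (r - `|x|)); split => // u.
    rewrite lt_min => /andP[ue ur]; split.
      rewrite -(subrK x u) (le_lt_trans (ler_normD _ _))//; lra.
    apply: contrapT => nu; apply: nO; exists u; split; last by left.
    by apply: eO; rewrite /ball /= distrC.
  - by exists x; split => //; right.
  (* A point with |x| = r is pushed radially outwards by e / 2. *)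
  - exists (x * (1 + e / (2 * r))); split.
      apply: eO; rewrite /ball /= mulrDr mulr1 opprD addrA subrr sub0r normrN normrM xr.
      rewrite gtr0_norm; last by rewrite divr_gt0// mulr_gt0.
      rewrite [ltLHS](_ : _ = e / 2); first by rewrite ltr_pdivrMr// ltr_pMr// ltr1n.
      by field; rewrite gt_eqF.
    right => /=; rewrite normrM xr ger0_norm; last first.
      by rewrite addr_ge0// divr_ge0// ltW// mulr_gt0.
    by rewrite ltr_pMr// ltrDl divr_gt0// mulr_gt0.
have := @Baire R R^o G (fun n => conj (oG n) (dG n)).
move=> /(_ (ball (0 : R^o) r)) [||u [u0 uG]].
- by exists 0; exact: ballxx.
- exact: ball_open.
- have ur : `|u| < r by move: u0; rewrite /ball /= sub0r normrN.
  have [n Au] := cov u ur; have [nu|/=] := uG n Logic.I.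
    by apply: nu => e e0; exists u => //; rewrite subrr normr0.
  by rewrite ltNge (ltW ur).
Qed.

End BaireInterval.

Section ComplexNormedModule.
Context (R : realType) (H : completeNormedModType R[i]).
Implicit Types h k : H.

(** The norm of H takes its values in R[i], which is only partially ordered; estimates are made in
    R. *)
Definition rnorm h : R := complex.Re `|h|.

Lemma rnormE h : `|h| = (rnorm h)%:C.
Proof. by rewrite /rnorm RRe_real// normr_real. Qed.

Lemma rnorm_ge0 h : 0 <= rnorm h.
Proof. by rewrite -lecR -rnormE; exact: normr_ge0. Qed.

Lemma rnormD h k : rnorm (h + k) <= rnorm h + rnorm k.
Proof. by rewrite -lecR rmorphD/= -!rnormE ler_normD. Qed.

Lemma rnormN h : rnorm (- h) = rnorm h.
Proof. by rewrite /rnorm normrN. Qed.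

(** An integer bound sorts the operators into countably many classes, ready for Baire's theorem. *)
Lemma continuous_linear_rnorm (J : {linear H -> H}) : continuous J ->
  exists n : nat, forall h, rnorm (J h) <= n%:R * rnorm h.
Proof.
move=> cJ; have := continuous_linear_bounded (0 : H) (cJ 0).
move=> /linear_boundedP[M [Mr hM]].
exists (Num.truncn (complex.Re M)).+1 => h.
have := hM (Num.truncn (complex.Re M)).+1%:R; rewrite -lecR rmorphM/= -!rnormE rmorph_nat.
apply; rewrite -(RRe_real Mr) -(rmorph_nat (@real_complex R)) ltcR.
exact: truncnS_gt.
Qed.

End ComplexNormedModule.

(** * Bounds and continuity at 0, on the pre-Hardy space and on its completion *)

Section StrongContinuity.
Context (R : realType) (d : measure_display) (Omega : metricMeasurableType R d).
Variables (mu : {measure set Omega -> \bar R}) (hOmega : homogeneous_type mu).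
Variables (L : unbounded_op mu) (L_inj : injective_op L).
Variables (E : pvm mu) (hE : sqrt_spectral_measure L E).
Variables (H : completeNormedModType R[i]) (iota : (Omega -> R[i]) -> H).
Hypothesis hH : hardy_completion L E iota.
Variable Liu : R -> {linear H -> H}.
Hypothesis hLiu : forall u : R,
  bounded_extension L E iota (imaginary_power E u) (Liu u).
Implicit Types (f g : Omega -> R[i]) (u v : R).
Local Notation ph := (pre_hardy L E).
Local Notation P := (imaginary_power E).

Let pre_hardyP u f : ph f -> ph (P u f).
Proof. by move=> /(hLiu u).2[]. Qed.

Let hardy_rnorm f : ph f -> hardy_norm L E f = (rnorm (iota f))%:E.
Proof.
move=> phf; have [lf fin] := phf; have [_ isom _] := hH.
have := isom f phf; rewrite rnormE => /complexI ->.
by rewrite fineK// ge0_fin_numE// (hardy_normE hOmega hE lf) hardy_on_ge0.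
Qed.

Let pre_hardyB f g : ph f -> ph g -> ph (fun x => f x - g x).
Proof.
move=> [lf Nf] [lg Ng]; have lB := (L2B lf lg).1; split; first exact: lB.
rewrite (hardy_normE hOmega hE lB).
apply: (le_lt_trans (hardy_onB hOmega hE lf lg measurableT)).
rewrite -(hardy_normE hOmega hE lf) -(hardy_normE hOmega hE lg).
by apply: lte_mul_pinfty; [rewrite lee_fin| |exact: (lte_add_pinfty Nf Ng)].
Qed.

Let iotaB f g : ph f -> ph g -> iota (fun x => f x - g x) = iota f - iota g.
Proof.
move=> phf phg; have [lin _ _] := hH.
rewrite (_ : (fun x => _) = lincomb (-1) g f).
  by rewrite lin// scaleN1r addrC.
by apply/funext => x; rewrite /lincomb mulN1r addrC.
Qed.

(** The group law holds only almost everywhere while [iota] acts on functions; its norm is read off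
    [hardy_norm], which sees only classes. *)
Let pre_hardy_ae f g : ph f -> L2 mu g -> eqL2 mu f g ->
  ph g /\ rnorm (iota g) = rnorm (iota f).
Proof.
move=> phf lg fg; have [lf Nf] := phf.
have e : hardy_norm L E g = hardy_norm L E f.
  by rewrite (hardy_normE hOmega hE lf) (hardy_normE hOmega hE lg)
    (hardy_on_ae hOmega hE _ lf lg fg).
have phg : ph g by split; [exact: lg|rewrite e; exact: Nf].
by split; [exact: phg|apply: EFin_inj; rewrite -!hardy_rnorm].
Qed.

Let rnorm_lsc f u (A : set R) (c : R) : ph f -> adherent A u ->
  (forall v, A v -> rnorm (iota (P v f)) <= c) -> rnorm (iota (P u f)) <= 2 * c.
Proof.
move=> phf /adherent_seq[v_ [Av vu]] hc; have [lf _] := phf.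
rewrite -lee_fin -hardy_rnorm; last exact: pre_hardyP.
rewrite (hardy_normE hOmega hE); last exact: L2_imaginary_power.
apply: (hardy_on_lsc hOmega hE (L2_imaginary_power E u lf)
  (fun n => L2_imaginary_power E (v_ n) lf) measurableT (imaginary_power_cvg E lf vu)) => n.
rewrite -(hardy_normE hOmega hE (L2_imaginary_power E (v_ n) lf)).
by rewrite (hardy_rnorm (pre_hardyP (v_ n) phf)) lee_fin; exact: hc.
Qed.

(** Near 0 one writes L^{iu} = L^{i(a+u)} L^{-ia} with a + u in the Baire interval. The constant
    collects n from the Baire set, 2 from semicontinuity and m, a bound for L^{-ia}. *)
Lemma imaginary_power_bounded_near0 : exists r M : R, [/\ 0 < r, 0 <= M &
  forall u f, `|u| < r -> ph f -> rnorm (iota (P u f)) <= M * rnorm (iota f)].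
Proof.
pose A (n : nat) : set R := [set u | forall f, ph f ->
  rnorm (iota (P u f)) <= n%:R * rnorm (iota f)].
have cov u : exists n, A n u.
  have [n hn] := continuous_linear_rnorm (hLiu u).1.
  exists n => f phf; have [_ <-] := (hLiu u).2 f phf; exact: hn.
have [n [a [s [s0 hs]]]] := baire_interval ltr01 (fun u _ => cov u).
have [m hm] := cov (- a).
exists s, (2 * (n%:R * m%:R)); split => // u f us phf; have [lf _] := phf.
have phaf := pre_hardyP (- a) phf; have [laf _] := phaf.
have [_ adh] : `|a + u| < 1 /\ adherent (A n) (a + u) by apply: hs; rewrite addrC addKr.
have := imaginary_powerD E (a + u) (- a) lf; rewrite addrAC subrr add0r => e.
have [_ ->] := pre_hardy_ae (pre_hardyP (a + u) phaf) (L2_imaginary_power E u lf) e.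
rewrite -!mulrA; apply: (rnorm_lsc phaf adh) => v Av.
by apply: (le_trans (Av _ phaf)); rewrite ler_wpM2l// hm.
Qed.

Lemma imaginary_power_cvg0 f (e : R) : ph f -> 0 < e ->
  exists2 del : R, 0 < del &
    forall u, `|u| < del -> rnorm (iota (P u f) - iota f) <= e.
Proof.
move=> phf e0; have [lf _] := phf.
have [r [M [r0 M0 hM]]] := imaginary_power_bounded_near0.
(* The number 9 is 1 + 2 (2 + 2): one for the part in the region, and outside it a factor 2 for the
   difference of two functions, each bounded by 2 e1 through semicontinuity. The factor 1 + M pays
   for the application of L^{-ia}. *)
pose e1 := e / (9 * (1 + M)).
have e10 : 0 < e1 by rewrite divr_gt0// mulr_gt0// ltr_pwDl.
pose A (k : nat) : set R := [set u | (hardy_on L E (P u f) (~` region mu k) <= e1%:E)%E].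
have lP u : L2 mu (P u f) by exact: L2_imaginary_power.
have cov u : `|u| < r -> exists k, A k u.
  move=> _; have [_ fin] := pre_hardyP u phf.
  apply: (hardy_on_tail hOmega hE (lP u) _ e10).
  by rewrite -(hardy_normE hOmega hE (lP u)); exact: fin.
have [k [a [s [s0 hs]]]] := baire_interval r0 cov.
have mC : measurable (~` region mu k).
  by apply: measurableC; exact: (measurable_region hOmega).
have tail u : `|u - a| < s -> (hardy_on L E (P u f) (~` region mu k) <= (2 * e1)%:E)%E.
  move=> /hs[_ /adherent_seq[v_ [Av vu]]].
  exact: (hardy_on_lsc hOmega hE (lP u) (fun n => lP (v_ n)) mC
    (imaginary_power_cvg E lf vu) Av).
have ar : `|- a| < r by rewrite normrN; apply: (hs a _).1; rewrite subrr normr0.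
(* Dominated convergence speaks of sequences, so the limit at 0 is tested along them. *)
have L2cont : nrm2 mu (fun x => P (a + u) f x - P a f x) @[u --> (0 : R)] --> (0 : R).
  apply/(@cvg_nbhsP _ R^o) => w w0; apply: imaginary_power_cvg => //.
  by rewrite -[X in _ --> X]addr0; apply: cvgD => //; exact: cvg_cst.
have C0 := region_cst_ge0 mu k.
have C1 : 0 < e1 / (1 + region_cst mu k) by rewrite divr_gt0// ltr_pwDl.
move/cvgrPdist_le : L2cont => /(_ _ C1) /nbhs_ballP[del /= del0 hdel].
exists (Num.min s del) => [|u]; first by rewrite lt_min s0.
rewrite lt_min => /andP[us udel].
pose D := fun x => P (a + u) f x - P a f x.
have phD : ph D by apply: pre_hardyB; exact: pre_hardyP.
have lD : L2 mu D := phD.1.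
have nD : region_cst mu k * nrm2 mu D <= e1.
  have := hdel u; rewrite /ball /= !sub0r !normrN => /(_ udel).
  rewrite ger0_norm ?nrm2_ge0// => h; rewrite (le_trans (ler_wpM2l C0 h))//.
  by rewrite mulrCA ler_piMr ?(ltW e10)// ler_pdivrMr ?mul1r ?lerDr// ltr_pwDl.
have wD : rnorm (iota D) <= 9 * e1.
  rewrite -lee_fin -(hardy_rnorm phD) (hardy_normE hOmega hE lD).
  apply: (le_trans (hardy_on_region_subU hOmega hE k lD)).
  rewrite (_ : 9 * e1 = e1 + 2 * (2 * e1 + 2 * e1)); last by ring.
  rewrite EFinD; apply: leeD.
    apply: (le_trans (hardy_on_region_le hOmega hE lD
      (measurable_region hOmega k) (@subset_refl _ _))).
    by rewrite lee_fin.
  apply: (le_trans (hardy_onB hOmega hE (lP _) (lP _) mC)).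
  rewrite EFinM; apply: lee_wpmul2l; first by rewrite lee_fin.
  rewrite EFinD; apply: leeD; apply: tail.
    by rewrite addrC addKr.
  by rewrite subrr normr0.
(* L^{-ia} brings the increment at a back to 0; its norm is at most M because |a| < r. *)
have e2 : eqL2 mu (P (- a) D) (fun x => P u f x - f x).
  have lin := imaginary_power_lincomb E (- a) (-1) (lP a) (lP (a + u)).
  rewrite (_ : lincomb (-1) _ _ = D) in lin; last first.
    by apply/funext => x; rewrite /lincomb /D mulN1r addrC.
  have d1 := imaginary_powerD E (- a) (a + u) lf; rewrite addKr in d1.
  have d2 := imaginary_powerD E (- a) a lf; rewrite addNr in d2.
  have d3 := eqL2_trans d2 (imaginary_power0 hE L_inj lf).
  apply: eqL2_trans lin _; apply: filterS2 d1 d3 => x h1 h2.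
  by rewrite /lincomb h1 h2 mulN1r; exact: addrC.
rewrite -(iotaB (pre_hardyP u phf) phf).
have [_ ->] := pre_hardy_ae (pre_hardyP (- a) phD) (L2B (lP u) lf).1 e2.
apply: (le_trans (hM _ _ ar phD)).
apply: (le_trans (ler_wpM2l M0 wD)).
rewrite (_ : M * (9 * e1) = e * (M / (1 + M))); last first.
  by rewrite /e1; field; rewrite gt_eqF// ltr_pwDl.
by rewrite ler_piMr ?(ltW e0)// ler_pdivrMr ?mul1r ?lerDr// ltr_pwDl.
Qed.

Lemma pre_hardy_dense (h : H) (e : R) : 0 < e -> exists2 f, ph f & rnorm (h - iota f) < e.
Proof.
move=> e0; have [_ _ den] := hH.
have e0C : (0 : R[i]) < e%:C by rewrite ltcR.
have [||k [hk [f phf fk]]] := den (ball h e%:C).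
- by exists h; exact: ballxx.
- exact: ball_open.
exists f => //; rewrite fk; move: hk; rewrite -ball_normE /ball_ /= rnormE ltcR.
by [].
Qed.

(** M carries over from the dense subspace: the bound n of a single extension depends on u, but only
    multiplies an approximation error that can be chosen after it. *)
Lemma extension_bounded_near0 : exists r M : R, [/\ 0 < r, 0 <= M &
  forall u h, `|u| < r -> rnorm (Liu u h) <= M * rnorm h].
Proof.
have [r [M [r0 M0 hM]]] := imaginary_power_bounded_near0.
exists r, M; split => // u h ur; have [n hn] := continuous_linear_rnorm (hLiu u).1.
apply/ler_addgt0Pr => e e0.
have K0 : 0 < n%:R + M + 1 by rewrite ltr_wpDl// addr_ge0.
have [f phf hf] := pre_hardy_dense h (divr_gt0 e0 K0).
have [_ Lf] := (hLiu u).2 f phf.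
have h1 : rnorm (Liu u h) <= n%:R * rnorm (h - iota f) + M * rnorm (iota f).
  rewrite -[in leLHS](subrK (iota f) h) linearD (le_trans (rnormD _ _))// lerD//.
  by rewrite Lf; exact: hM.
have h2 : rnorm (iota f) <= rnorm h + rnorm (h - iota f).
  by rewrite -[in leLHS](subKr h (iota f)) (le_trans (rnormD _ _))// rnormN.
have h3 : (n%:R + M) * rnorm (h - iota f) <= e.
  have := ltW hf; rewrite ler_pdivlMr// mulrC => h4; apply: le_trans h4.
  by rewrite ler_wpM2r ?rnorm_ge0// lerDl.
have h5 := ler_wpM2l M0 h2.
apply: (le_trans h1); rewrite mulrDl in h3; lra.
Qed.

End StrongContinuity.

Unset Implicit Arguments.

Theorem corollary3p3 (R : realType) (d : measure_display)
    (Omega : metricMeasurableType R d) (mu : {measure set Omega -> \bar R})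
    (hOmega : homogeneous_type mu)
    (L : unbounded_op mu) (L_sa : self_adjoint L) (L_ge0 : nonnegative_op L)
    (L_inj : injective_op L)
    (E : pvm mu) (hE : sqrt_spectral_measure L E)
    (hDG : davies_gaffney E)
    (H : completeNormedModType R[i]) (iota : (Omega -> R[i]) -> H)
    (hH : hardy_completion L E iota)
    (Liu : R -> {linear H -> H})
    (hLiu : forall u : R,
      bounded_extension L E iota (imaginary_power E u) (Liu u))
    (f : H) :
  Liu u f @[u --> (0 : R)^'] --> f.
Proof.
have [r [M [r0 M0 hM]]] := extension_bounded_near0 hOmega hE hH hLiu.
apply/cvgrPdist_le => eC; rewrite ltcE /= => /andP[/eqP im0 e0].
set e := complex.Re eC in e0.
have eE : eC = e%:C by rewrite /e; case: eC im0 {e0 e} => x y /= ->.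
have K0 : 0 < M + 1 + 1 by rewrite ltr_wpDl// addr_ge0.
(* Replacing f by a pre-Hardy function costs M for [Liu u] and 1 for the identity, together at most
   e / 2. *)
have d0 : 0 < e / 2 / (M + 1 + 1) by rewrite !divr_gt0.
have [g phg hg] := pre_hardy_dense hH f d0.
have e20 : 0 < e / 2 by rewrite divr_gt0.
have [del del0 hdel] := imaginary_power_cvg0 hOmega L_inj hE hH hLiu phg e20.
near=> u.
have u1 : `|u| < Num.min r del.
  near: u; apply: nbhs_dnbhs; apply/nbhs_ballP; exists (Num.min r del).
    by rewrite /= lt_min r0.
  by move=> u; rewrite /ball /= sub0r normrN.
move: u1; rewrite lt_min => /andP[ur udel].
rewrite eE rnormE lecR -rnormN opprB.
have [_ Lg] := (hLiu u).2 g phg.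
have -> : Liu u f - f = Liu u (f - iota g) +
    ((iota (imaginary_power E u g) - iota g) - (f - iota g)).
  by rewrite linearB -Lg opprB [_ + (iota g - f)]addrA subrK addrA subrK.
apply: (le_trans (rnormD _ _)).
have h1 := hM u (f - iota g) ur.
have h2 := rnormD (iota (imaginary_power E u g) - iota g) (- (f - iota g)); rewrite rnormN in h2.
have h3 := hdel u udel.
have h4 : (M + 1) * rnorm (f - iota g) <= e / 2.
  have := ltW hg; rewrite ler_pdivlMr// mulrC => h; apply: le_trans h.
  by rewrite ler_wpM2r ?rnorm_ge0// lerDl.
rewrite mulrDl mul1r in h4; lra.
Unshelve. all: end_near. Qed.
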